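(* Let $\mathfrak{s}=(s_1,\ldots,s_r)\in\mathbb{N}^r$, $d_1=s_1+\cdots+s_r$, and let the finite list of triples $(b_\ell,\mathfrak{s}_\ell,\mathbf{u}_\ell)_{1\le\ell\le T}$, the $t$-modules $(G_\ell,\rho_\ell)=G_{\widetilde{\mathfrak{s}}_\ell,\widetilde{\mathbf{u}}_\ell}$, the points $\mathbf{v}_\ell=\mathbf{v}_{\widetilde{\mathfrak{s}}_\ell,\widetilde{\mathbf{u}}_\ell}$, the vectors $\mathbf{Y}_\ell=\mathbf{Y}_{\widetilde{\mathfrak{s}}_\ell,\widetilde{\mathbf{u}}_\ell}$, and $Z_{\mathfrak{s}}$ be as in the context. Then \[Z_{\mathfrak{s}}=\begin{pmatrix}(\partial_t^{d_1-1}\zeta_A^{\mathrm{AT}}(\mathfrak{s}))|_{t=\theta}\\ \vdots\\ (\partial_t^{1}\zeta_A^{\mathrm{AT}}(\mathfrak{s}))|_{t=\theta}\\ \zeta_A^{\mathrm{AT}}(\mathfrak{s})|_{t=\theta}\\ (\partial\rho_{s+1}(b_{s+1})\mathbf{Y}_{s+1})_-\\ \vdots\\ (\partial\rho_T(b_T)\mathbf{Y}_T)_-\end{pmatrix},\qquad\text{and }\ \zeta_A^{\mathrm{AT}}(\mathfrak{s})|_{t=\theta}=\Gamma_{\mathfrak{s}}\zeta_A(\mathfrak{s}).\]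
   Context: $q$ a power of the prime $p$, $A=\mathbb{F}_q[\theta]$, $A_+$ its monic elements, $K=\mathbb{F}_q(\theta)$, $|\theta|_\infty=q$, $\mathbb{C}_\infty$ the completion of an algebraic closure of $\mathbb{F}_q((1/\theta))$, $\overline{K}$ the algebraic closure of $K$ in it. $f^{(n)}$ raises coefficients to the $q^n$-th power. $\mathbb{T}_\theta=\{\sum b_it^i:|b_i\theta^i|_\infty\to0\}$. Hyperderivatives $\partial_t^n(\sum a_it^i)=\sum\binom{i}{n}a_it^{i-n}$ (mod $p$) preserve $\mathbb{T}_\theta$; $(\partial_t^nf)|_{t=\theta}$ is the $n$-th Taylor coefficient at $\theta$. $L_0=\mathbb{L}_0=1$, $L_i=\prod_{k=1}^i(\theta-\theta^{q^k})$, $\mathbb{L}_i=\prod_{k=1}^i(t-\theta^{q^k})$. Thakur's MZV: $\zeta_A(\mathfrak{s})=\sum\frac{1}{a_1^{s_1}\cdots a_r^{s_r}}$ over $a_i\in A_+$ with $|a_1|_\infty>\cdots>|a_r|_\infty$. Anderson–Thakur polynomials: $G_0(y)=1$, $G_n(y)=\prod_{i=1}^n(t^{q^n}-y^{q^i})$, $D_0=1$, $D_i=\prod_{j=0}^{i-1}(\theta^{q^i}-\theta^{q^j})$, $\Gamma_{n+1}=\prod_iD_i^{n_i}$ for $n=\sum n_iq^i$ in base $q$, and $H_n(t)\in A[t]$ by $\big(1-\sum_{i\ge0}\frac{G_i(\theta)}{D_i|_{\theta=t}}x^{q^i}\big)^{-1}=\sum_{n\ge0}\frac{H_n(t)}{\Gamma_{n+1}|_{\theta=t}}x^n$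 (coefficients of $H_{s-1}$ have absolute value $<q^{sq/(q-1)}$). $\Gamma_{\mathfrak{s}}=\Gamma_{s_1}\cdots\Gamma_{s_r}$; $\zeta_A^{\mathrm{AT}}(\mathfrak{s})=\sum_{i_1>\cdots>i_r\ge0}\frac{H_{s_1-1}^{(i_1)}\cdots H_{s_r-1}^{(i_r)}}{\mathbb{L}_{i_1}^{s_1}\cdots\mathbb{L}_{i_r}^{s_r}}\in\mathbb{T}_\theta$. For $\mathfrak{n}\in\mathbb{N}^k$, $\mathbf{w}\in\overline{K}^k$ with $|w_1|_\infty<q^{n_1q/(q-1)}$, $|w_i|_\infty\le q^{n_iq/(q-1)}$: $\mathfrak{Li}^\star_{\mathfrak{n},\mathbf{w}}=\sum_{i_1\ge\cdots\ge i_k\ge0}\frac{w_1^{q^{i_1}}\cdots w_k^{q^{i_k}}}{\mathbb{L}_{i_1}^{n_1}\cdots\mathbb{L}_{i_k}^{n_k}}\in\mathbb{T}_\theta$. For a tuple $\Lambda=(\lambda_1,\ldots,\lambda_k)$, $\widetilde\Lambda=(\lambda_k,\ldots,\lambda_1)$. The triples: write $H_{s_i-1}=\sum_{j=0}^{n_i}u_{ij}t^j$; for $\mathbf{j}=(j_1,\ldots,j_r)\in\prod_i\{0,\ldots,n_i\}$ and a decomposition $P$ of $(1,\ldots,r)$ into consecutive nonempty blocks $B_1,\ldots,B_k$, the triple is $b=(-1)^{r-1}t^{j_1+\cdots+j_r}$, $\mathfrak{s}_P=(\sum_{B_1}s_i,\ldots,\sum_{B_k}s_i)$, $\mathbf{u}=(\prod_{B_1}u_{ij_i},\ldots,\prod_{B_k}u_{ij_i})\in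 A^k$; these are enumerated as $\ell=1,\ldots,T$ so that exactly those with $k=1$ are $\ell=1,\ldots,s$. They satisfy $\zeta_A^{\mathrm{AT}}(\mathfrak{s})=\sum_\ell b_\ell(-1)^{\mathrm{dep}(\mathfrak{s}_\ell)-1}\mathfrak{Li}^\star_{\mathfrak{s}_\ell,\mathbf{u}_\ell}$. $t$-modules: for $\mathfrak{n}=(n_1,\ldots,n_k)$, $\mathbf{w}\in\overline{K}^k$, put $e_i=n_i+\cdots+n_k$, $e=\sum e_i$; $G_{\mathfrak{n},\mathbf{w}}$ is $\mathbb{G}_a^e$ with $\rho(t)=\theta I_e+N+E\tau$ ($\tau$ = $q$-th power on coordinates), $N$ block diagonal with $i$-th block the $e_i\times e_i$ matrix with $1$'s on the first superdiagonal, $E$ block upper triangular (blocks $e_\ell\times e_m$) with only the lower-left entry of block $(\ell,m)$, $\ell\le m$, possibly nonzero, equal to $1$ if $\ell=m$ and $(-1)^{m-\ell}\prod_{c=\ell}^{m-1}w_c$ if $\ell<m$. $\partial\rho(b)$ is the $\tau^0$-coefficient of $\rho(b)$ ($\rho$ the $\mathbb{F}_q$-linear ring homomorphism determined by $\rho(t)$). $\mathrm{Exp}$ is the unique entire $\mathbb{F}_q$-linear $\sum c_i\mathbf{z}^{(i)}$, $c_0=I$, with $\mathrm{Exp}(\partial\rho(t)\mathbf{z})=\rho(t)(\mathrm{Exp}(\mathbf{z}))$, $\mathrm{Log}$ its formal inverse. $\mathbf{v}_{\mathfrak{n},\mathbf{w}}$ has $i$-th block $(0,\ldots,0,(-1)^{k-i}w_i\cdots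 w_k)^{\mathrm{tr}}$. $\mathbf{Y}_{\mathfrak{n},\mathbf{w}}$ has $i$-th block with entries $(-1)^{k-i}(\partial_t^m\mathfrak{Li}^\star_{(n_k,\ldots,n_i),(w_k,\ldots,w_i)})|_{t=\theta}$, $m=e_i-1,\ldots,0$. For each $\ell$, $\mathrm{Log}_{G_\ell}$ converges at $\mathbf{v}_\ell$; put $Z_\ell=\mathrm{Log}_{G_\ell}(\mathbf{v}_\ell)$. Note $G_\ell$ has first block size $d_1$. For a vector $\mathbf{z}$ of length $\ge d_1$, $\hat{\mathbf{z}}$ is its first $d_1$ coordinates and $\mathbf{z}_-$ the rest. Define $Z_{\mathfrak{s}}=\big(\sum_{\ell=1}^T\widehat{\partial\rho_\ell(b_\ell)Z_\ell}{}^{\mathrm{tr}},(\partial\rho_{s+1}(b_{s+1})Z_{s+1})_-^{\mathrm{tr}},\ldots,(\partial\rho_T(b_T)Z_T)_-^{\mathrm{tr}}\big)^{\mathrm{tr}}$ (this is the logarithmic vector, on the fiber-coproduct $t$-module $G_{\mathfrak{s}}$, of the special point $\mathbf{v}_{\mathfrak{s}}$). *)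

(* Defs.v *)
(* MathComp / MathComp-Analysis *)
From HB Require Import structures.
From mathcomp Require Import all_boot all_order all_algebra.
From mathcomp Require Import all_classical all_reals topology normedtype.

Set Implicit Arguments.
Unset Strict Implicit.
Unset Printing Implicit Defensive.

Import Order.TTheory GRing.Theory Num.Theory.
Import numFieldNormedType.Exports.

Local Open Scope classical_set_scope.
Local Open Scope ring_scope.

(* A complete non-archimedean algebraically closed extension of F(theta), with
   |theta| = #|F| = q, in which the elements algebraic over
   F((1/theta)) = { theta^N * \sum_i c_i theta^-i } are dense.  This determines
   the valued field up to isometric F(theta)-isomorphism: it is the completion
   of an algebraic closure of F((1/theta)).
   MathComp's normed modules cannot be used for the absolute value, since their
   norm satisfies `|x *+ n| = `|x| *+ n, which fails in characteristic p. *)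
Record Cinfty (R : realType) (F : finFieldType) := MkCinfty {
  Cfield :> closedFieldType ;
  Cconst : {rmorphism F -> Cfield} ;
  theta : Cfield ;
  cabs : Cfield -> R ;
  cabs_ge0 : forall x, 0 <= cabs x ;
  cabs_eq0 : forall x, cabs x = 0 -> x = 0 ;
  cabsM : forall x y, cabs (x * y) = cabs x * cabs y ;
  cabsD : forall x y, cabs (x + y) <= Num.max (cabs x) (cabs y) ;
  cabs_theta : cabs theta = (#|F|)%:R ;
  C_complete : forall u : nat -> Cfield,
    (forall eps : R, 0 < eps -> exists N : nat, forall m n : nat,
        (N <= m)%N -> (N <= n)%N -> cabs (u m - u n) < eps) ->
    exists l : Cfield, (fun n => cabs (u n - l)) @ \oo --> (0 : R) ;
  C_dense :
    let Kinfty := [set x : Cfield | exists (N : nat) (c : nat -> F),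
      (fun n => cabs (theta ^+ N * (\sum_(i < n) Cconst (c i) / theta ^+ i)
                      - x)) @ \oo --> (0 : R)] in
    forall (x : Cfield) (eps : R), 0 < eps ->
      exists y : Cfield, cabs (x - y) < eps /\
        exists p : {poly Cfield},
          [/\ p != 0, (forall i, Kinfty p`_i) & root p y]
}.

Section PowerSeries.
Variable T : nzRingType.
Implicit Types f g : nat -> T.

Definition ps_one : nat -> T := fun n => (n == 0%N)%:R.
Definition ps_mul f g : nat -> T := fun n => \sum_(i < n.+1) f i * g (n - i)%N.
Definition ps_inv f : nat -> T := xget ps_one [set g | ps_mul f g = ps_one].
Definition ps_of_poly (p : {poly T}) : nat -> T := fun n => p`_n.

Definition hyperder (m : nat) f : nat -> T :=
  fun i => f (i + m)%N *+ 'C(i + m, m).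
End PowerSeries.

(* A is {poly F}, with variable theta, and A[t] is {poly {poly F}}: the outer
   variable is t, the inner one theta.  Accordingly p^:P is p|_{theta = t}. *)
Section AndersonThakur.
Variable F : finFieldType.
Local Notation q := #|F|.

Definition carlitzD (i : nat) : {poly F} :=
  \prod_(j < i) ('X ^+ (q ^ i) - 'X ^+ (q ^ j)).

(* Gamma_m; the base-q digits of n = m - 1 vanish beyond index n. *)
Definition carlitz_gamma (m : nat) : {poly F} :=
  \prod_(i < m.-1.+1) carlitzD i ^+ ((m.-1 %/ q ^ i) %% q).

Definition AT_G (n : nat) : {poly {poly F}} :=
  \prod_(1 <= i < n.+1) ('X ^+ (q ^ n) - ('X ^+ (q ^ i))%:P).

Definition AT_den (m : nat) : {fraction {poly {poly F}}} :=
  (m == 0%N)%:R -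
  \sum_(i < m.+1 | (q ^ i == m)%N) tofrac (AT_G i) / tofrac (carlitzD i)^:P.

(* The sequence is unique; its existence in A[t] is Anderson and Thakur's. *)
Definition AT_H : nat -> {poly {poly F}} :=
  xget (fun=> 0) [set H : nat -> {poly {poly F}} |
    ps_mul AT_den
      (fun n => tofrac (H n) / tofrac (carlitz_gamma n.+1)^:P)
    = ps_one {fraction {poly {poly F}}}].
End AndersonThakur.

Section Values.
Variables (R : realType) (F : finFieldType) (C : Cinfty R F).
Local Notation q := #|F|.
Local Notation theta := (theta C).

Definition ofA (a : {poly F}) : C := (map_poly (Cconst C) a).[theta].

Definition frob (n : nat) (x : C) : C := x ^+ (q ^ n).

Definition cvgC (u : nat -> C) (l : C) : Prop :=
  (fun n => cabs (u n - l)) @ \oo --> (0 : R).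
(* The limits and inverses chosen by xget below are unique when they exist. *)
Definition limC (u : nat -> C) : C := xget 0 [set l | cvgC u l].

Definition in_Ttheta (f : nat -> C) : Prop :=
  (fun i => cabs (f i * theta ^+ i)) @ \oo --> (0 : R).

(* Convergence in the Gauss norm sup_i |f_i theta^i|. *)
Definition cvgT (S : nat -> nat -> C) (f : nat -> C) : Prop :=
  in_Ttheta f /\
  forall eps : R, 0 < eps -> exists N : nat, forall n : nat, (N <= n)%N ->
    in_Ttheta (S n) /\ forall i, cabs ((S n i - f i) * theta ^+ i) <= eps.
Definition limT (S : nat -> nat -> C) : nat -> C :=
  xget (fun=> 0) [set f | cvgT S f].

Definition ps_eval (f : nat -> C) (x : C) : C :=
  limC (fun N => \sum_(i < N) f i * x ^+ i).

Definition taylor_at_theta (m : nat) (f : nat -> C) : C :=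
  ps_eval (hyperder m f) theta.

Definition LL (i : nat) : {poly C} :=
  \prod_(1 <= k < i.+1) ('X - (theta ^+ (q ^ k))%:P).

(* The N-th partial sum ranges over the monic a_i of degree < N. *)
Definition zeta_A (s : seq nat) : C :=
  limC (fun N =>
    \sum_(a : {ffun 'I_(size s) -> {poly_N F}} |
          [forall i : 'I_(size s), (a i : {poly F}) \is monic] &&
          [forall i : 'I_(size s), forall j : 'I_(size s),
             (i < j)%N ==> (cabs (ofA (a j)) < cabs (ofA (a i)))])
      \prod_(i < size s) (ofA (a i) ^+ nth 0%N s i)^-1).

Definition AT_Htwist (m n : nat) : {poly C} :=
  map_poly (frob n) (map_poly ofA (AT_H F m)).

Definition zeta_AT (s : seq nat) : nat -> C :=
  limT (fun N m =>
    \sum_(i : {ffun 'I_(size s) -> 'I_N} |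
          [forall a : 'I_(size s), forall b : 'I_(size s),
             (a < b)%N ==> (i b < i a)%N])
      (\big[@ps_mul C/ps_one C]_(a < size s)
         ps_mul (ps_of_poly (AT_Htwist (nth 0%N s a).-1 (i a)))
                (ps_inv (ps_of_poly (LL (i a) ^+ nth 0%N s a)))) m).

Definition Li_star (n : seq nat) (w : seq C) : nat -> C :=
  limT (fun N m =>
    \sum_(i : {ffun 'I_(size n) -> 'I_N} |
          [forall a : 'I_(size n), forall b : 'I_(size n),
             (a < b)%N ==> (i b <= i a)%N])
      (\big[@ps_mul C/ps_one C]_(a < size n)
         ps_mul (ps_of_poly (frob (i a) w`_a)%:P)
                (ps_inv (ps_of_poly (LL (i a) ^+ nth 0%N n a)))) m).

(* Twisted power series \sum_i f_i tau^i with matrix coefficients. *)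
Section Twisted.
Variable d : nat.

Definition twmx (e : nat) (n : nat) (A : 'M[C]_(d, e)) : 'M[C]_(d, e) :=
  map_mx (frob n) A.

Definition tw_one : nat -> 'M[C]_d := fun n => if n == 0%N then 1%:M else 0.
Definition tw_mul (f g : nat -> 'M[C]_d) : nat -> 'M[C]_d :=
  fun n => \sum_(i < n.+1) f i *m twmx i (g (n - i)%N).

Definition tw_psum (f : nat -> 'M[C]_d) (z : 'cV[C]_d) : nat -> 'cV[C]_d :=
  fun N => \sum_(i < N) f i *m twmx i z.
Definition cvgV (u : nat -> 'cV[C]_d) (l : 'cV[C]_d) : Prop :=
  forall i, cvgC (fun n => u n i 0) (l i 0).
Definition tw_eval (f : nat -> 'M[C]_d) (z : 'cV[C]_d) : 'cV[C]_d :=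
  xget 0 [set y | cvgV (tw_psum f z) y].
End Twisted.

(* In the sequel tuples (x_1, ..., x_k) are sequences indexed from 0, so that
   the block of index i here is the (i+1)-st one. *)
Section TModule.
Variables (n : seq nat) (w : seq C).
Local Notation k := (size n).

Definition bdim (i : nat) : nat := sumn (drop i n).
Definition tdim : nat := (\sum_(i < k) bdim i)%N.

Definition tmN : 'M[C]_tdim :=
  \mxdiag_(i < k) (\matrix_(a < bdim i, b < bdim i) (b == a.+1 :> nat)%:R).

Definition tmE : 'M[C]_tdim :=
  \mxblock_(l < k, m < k) (\matrix_(a < bdim l, b < bdim m)
    (if [&& (l <= m)%N, a.+1 == bdim l & b == 0%N :> nat]
     then (-1) ^+ (m - l) * \prod_(l <= c < m) w`_c else 0)).

Definition rho_t : nat -> 'M[C]_tdim :=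
  fun i => if i == 0%N then theta%:M + tmN
           else if i == 1%N then tmE else 0.

Definition rho (b : {poly F}) : nat -> 'M[C]_tdim :=
  fun i => \sum_(j < size b)
    Cconst C b`_j *: iter j (tw_mul rho_t) (@tw_one tdim) i.

Definition drho (b : {poly F}) : 'M[C]_tdim := rho b 0%N.

(* Entire F_q-linear series c = \sum_i c_i tau^i with c_0 = I satisfying
   Exp(drho(t) z) = rho(t)(Exp z); it exists and is unique. *)
Definition is_Exp (c : nat -> 'M[C]_tdim) : Prop :=
  [/\ c 0%N = 1%:M,
      (forall z, exists y, cvgV (tw_psum c z) y) &
      (forall z, tw_eval c (drho 'X *m z) = tw_eval (rho 'X) (tw_eval c z))].

Definition Exp_coef : nat -> 'M[C]_tdim := xget (@tw_one tdim) is_Exp.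

Definition Log_coef : nat -> 'M[C]_tdim :=
  xget (@tw_one tdim) [set l | tw_mul Exp_coef l = @tw_one tdim /\
                               tw_mul l Exp_coef = @tw_one tdim].

Definition tm_v : 'cV[C]_tdim :=
  \mxcol_(i < k) (\col_(a < bdim i)
    (if a.+1 == bdim i
     then (-1) ^+ (k - i.+1) * \prod_(i <= c < k) w`_c else 0)).

Definition tm_Z : 'cV[C]_tdim := tw_eval Log_coef tm_v.

Definition tm_Y : 'cV[C]_tdim :=
  \mxcol_(i < k) (\col_(a < bdim i)
    ((-1) ^+ (k - i.+1) *
     taylor_at_theta (bdim i - a.+1)
       (Li_star (rev (drop i n)) (rev (drop i w))))).
End TModule.

(* First d1 coordinates and remaining ones; only used with d1 <= d, so that the
   padding by 0 never occurs. *)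
Definition vnth (d : nat) (z : 'cV[C]_d) (i : nat) : C :=
  if insub i is Some j then z j 0 else 0.
Definition vhat (d1 d : nat) (z : 'cV[C]_d) : 'cV[C]_d1 :=
  \col_(i < d1) vnth z i.
Definition vminus (d1 d : nat) (z : 'cV[C]_d) : 'cV[C]_(d - d1) :=
  \col_(i < d - d1) vnth z (d1 + i).
End Values.

(* A triple is indexed by x = (j, P): x.1 is the exponent tuple (j_1, ..., j_r)
   and x.2 lists the lengths of the consecutive blocks B_1, ..., B_k. *)
Section Triples.
Variables (F : finFieldType) (s : seq nat).
Implicit Type x : seq nat * seq nat.

Definition AT_u (i j : nat) : {poly F} := (AT_H F (nth 0%N s i).-1)`_j.

Definition triple_index x : Prop :=
  [/\ size x.1 = size s,
      (forall i, (i < size s)%N ->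
         (nth 0%N x.1 i <= (size (AT_H F (nth 0%N s i).-1)).-1)%N),
      all (ltn 0%N) x.2 &
      sumn x.2 = size s].

Definition triple_b x : {poly F} := (-1) ^+ (size s).-1 * 'X ^+ sumn x.1.

Definition triple_s x : seq nat := [seq sumn B | B <- reshape x.2 s].

Definition triple_u x : seq {poly F} :=
  [seq \prod_(i <- B) AT_u i (nth 0%N x.1 i)
     | B <- reshape x.2 (iota 0 (size s))].

(* An enumeration without repetition of the triples; the first s1 entries are
   exactly those with a single block. *)
Definition triple_enum (s1 m : nat)
    (x : 'I_(s1 + m) -> seq nat * seq nat) : Prop :=
  [/\ injective x,
      (forall y, triple_index y <-> exists l, x l = y) &
      (forall l, size (x l).2 = 1%N <-> (l < s1)%N)].
End Triples.

(* The t-module G_l is attached to the reversed tuples. *)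
Section Modules.
Variables (R : realType) (F : finFieldType) (C : Cinfty R F) (s : seq nat).
Implicit Type x : seq nat * seq nat.

Definition G_s x : seq nat := rev (triple_s s x).
Definition G_u x : seq C := rev [seq ofA C a | a <- triple_u F s x].

Definition G_drho x : 'M[C]_(tdim (G_s x)) :=
  @drho R F C (G_s x) (G_u x) (triple_b F s x).
Definition G_Z x : 'cV[C]_(tdim (G_s x)) := tm_Z (G_s x) (G_u x).
Definition G_Y x : 'cV[C]_(tdim (G_s x)) := tm_Y (G_s x) (G_u x).

Definition Z_s (s1 m : nat) (x : 'I_(s1 + m) -> seq nat * seq nat) :
    'cV[C]_(sumn s + \sum_(l < m) (tdim (G_s (x (rshift s1 l))) - sumn s)) :=
  col_mx
    (\sum_(l < s1 + m) vhat (sumn s) (G_drho (x l) *m G_Z (x l)))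
    (\mxcol_(l < m) vminus (sumn s)
       (G_drho (x (rshift s1 l)) *m G_Z (x (rshift s1 l)))).
End Modules.

(* Main.v *)
(* In T_theta, inserting H_(s-1) = sum_j u_j t^j and turning strict inequalities
   between the summation indices into weak ones (sum_(i > j) = sum_(i >= j) -
   sum_(i = j)) writes every partial sum of zeta^AT as a combination of partial
   sums of the series Li^star.  Identifying block i of C^d with
   C[[X]] / X^(d_i), X = t - theta, the tau^0-part of rho(t) is multiplication by
   t, and the functional equation of the logarithm solves column by column: the
   N-th partial sum of Log at v is exactly the vector of Taylor coefficients at
   theta of the N-th partial sums of the Li^star.  The Taylor map being
   multiplicative and continuous on T_theta, both facts pass to the limit.
   For the value at theta, the numbers L_d^(n+1) sum_(a monic, deg a = d) a^-(n+1)
   and the values of the twisted Anderson-Thakur polynomials at t = theta satisfy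
   the same recursion: the former by taking the logarithmic derivative of
   prod_(a monic, deg a = d) (z - a) = E_d(z) - D_d, which is an affine additive
   polynomial, the latter by definition. *)
Require Import Defs.
From HB Require Import structures.
From mathcomp Require Import all_boot all_order all_algebra.
From mathcomp Require Import all_classical all_reals topology normedtype.
From mathcomp Require finfield.
From mathcomp Require Import zify ring.

Set Implicit Arguments.
Unset Strict Implicit.
Unset Printing Implicit Defensive.

Import Order.TTheory GRing.Theory Num.Theory.
Import numFieldNormedType.Exports.
(* MathComp-Analysis also declares a [cvgV]. *)
Import Defs.

Local Open Scope classical_set_scope.
Local Open Scope ring_scope.

(** Exp and Log are only characterised, so their coefficients must first be made accessible. The
    functional equation of Exp is an identity of functions; testing it on multiples of basis vectors
    gives additive series that vanish everywhere, hence a recursion for the coefficients. Each step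
    solves a Sylvester equation with scalar theta^(q^(i+1)) - theta, of absolute value > 1, and N
    has entries of absolute value <= 1: the ultrametric inequality gives solvability and a growth
    bound at once. The recursion for Log_(i+1) has this matrix on both sides. It closes on the
    columns at the last coordinate of each block, where v is supported: shifting by X inside block m
    amounts to multiplying the column by t - theta^(q^(i+1)), E acts only at X^(d_m - 1), and
    X^(d_m) = 0. So (t - theta^(q^(i+1)))^(d_m) times the column at level i+1 is a combination of
    columns at level i, which is how 1/LL_i^(d_m) times a truncated star sum behaves. Convergence
    rests on (q - 1) deg u + 1 <= s q for the coefficients u of H_(s-1), an integral form of the
    strict bound that survives the merging of blocks. *)

(** * Formal power series as a commutative ring *)

Lemma triangular_exchange (V : nmodType) n (F : nat -> nat -> nat -> V) :
  \sum_(i < n.+1) \sum_(j < (n - i).+1) F i j (n - i - j)%N =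
  \sum_(k < n.+1) \sum_(i < k.+1) F i (k - i)%N (n - k)%N.
Proof.
elim: n F => [|n IHn] F; first by rewrite !big_ord1.
rewrite big_ord_recl /=; under [RHS]eq_bigr do rewrite big_ord_recl.
rewrite big_split /=; congr (_ + _).
  transitivity (\sum_(j < n.+2) F 0%N j (n.+1 - j)%N) => //.
  by apply: eq_bigr => i _; rewrite subn0.
rewrite [RHS]big_ord_recl big_ord0 add0r.
exact: (IHn (fun i => F i.+1)).
Qed.

(** A separate name for [nat -> T], so that convolution becomes the ring product; it stays
    convertible to [nat -> T], so that [ps_mul] and [ps_inv] apply to it directly. *)
Definition fps (T : comNzRingType) : Type := nat -> T.

Section FormalPowerSeries.
Variable T : comNzRingType.
Implicit Types f g h : fps T.

HB.instance Definition _ := Choice.copy (fps T) (nat -> T).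
HB.instance Definition _ := GRing.Zmodule.copy (fps T) (nat -> T).

Lemma ps_mulA : associative (@ps_mul T).
Proof.
move=> f g h; apply/funext => n; rewrite /ps_mul.
under eq_bigr do rewrite mulr_sumr.
rewrite (triangular_exchange n (fun i j k => f i * (g j * h k))).
by apply: eq_bigr => k _; rewrite mulr_suml; under eq_bigr do rewrite mulrA.
Qed.

Lemma ps_mulC : commutative (@ps_mul T).
Proof.
move=> f g; apply/funext => n; rewrite /ps_mul (reindex_inj rev_ord_inj) /=.
by apply: eq_bigr => i _; rewrite mulrC subSS subKn // -ltnS.
Qed.

Lemma ps_mul1 : left_id (ps_one T : fps T) (@ps_mul T).
Proof.
move=> f; apply/funext => n; rewrite /ps_mul /ps_one big_ord_recl mul1r subn0.
by rewrite big1 ?addr0 // => i _; rewrite mul0r.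
Qed.

Lemma ps_mulDl : left_distributive (@ps_mul T : fps T -> fps T -> fps T) +%R.
Proof.
move=> f g h; apply/funext => n; rewrite /ps_mul -[RHS]/(_ + _) -big_split.
by apply: eq_bigr => i _; rewrite mulrDl.
Qed.

Lemma ps_one_neq0 : ps_one T != 0 :> fps T.
Proof.
apply/eqP => /(congr1 (fun f : fps T => f 0%N)) /eqP.
by rewrite /ps_one -[(0 : fps T) 0%N]/(0 : T) oner_eq0.
Qed.

HB.instance Definition _ :=
  GRing.Zmodule_isComNzRing.Build (fps T) ps_mulA ps_mulC ps_mul1 ps_mulDl
    ps_one_neq0.

Lemma fpsP f g : f =1 g -> f = g. Proof. exact: funext. Qed.

Lemma fpsM f g n : (f * g) n = \sum_(i < n.+1) f i * g (n - i)%N.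
Proof. by []. Qed.

Lemma fpsD f g n : (f + g) n = f n + g n. Proof. by []. Qed.

Lemma fpsN f n : (- f) n = - f n. Proof. by []. Qed.

Lemma fps0 n : (0 : fps T) n = 0. Proof. by []. Qed.

Lemma fps1 n : (1 : fps T) n = (n == 0%N)%:R. Proof. by []. Qed.

Lemma fps_sum (I : Type) (r : seq I) (P : pred I) (F : I -> fps T) n :
  (\sum_(i <- r | P i) F i) n = \sum_(i <- r | P i) F i n.
Proof. by elim/big_rec2: _ => // i y f _ <-. Qed.

Definition fps_poly (p : {poly T}) : fps T := ps_of_poly p.

Lemma fps_poly_is_zmod_morphism : zmod_morphism fps_poly.
Proof.
move=> p r; apply: fpsP => n.
by rewrite fpsD fpsN /fps_poly /ps_of_poly coefB.
Qed.

Lemma fps_poly_is_monoid_morphism : monoid_morphism fps_poly.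
Proof.
split=> [|p r]; apply: fpsP => n; first by rewrite fps1 /fps_poly /ps_of_poly coef1.
by rewrite fpsM /fps_poly /ps_of_poly coefM.
Qed.

HB.instance Definition _ :=
  GRing.isZmodMorphism.Build {poly T} (fps T) fps_poly fps_poly_is_zmod_morphism.
HB.instance Definition _ :=
  GRing.isMonoidMorphism.Build {poly T} (fps T) fps_poly
    fps_poly_is_monoid_morphism.

Lemma fps_polyC_mul c f n : (fps_poly c%:P * f) n = c * f n.
Proof.
rewrite fpsM big_ord_recl /fps_poly /ps_of_poly coefC /= subn0 big1 ?addr0 //.
by move=> i _; rewrite coefC mul0r.
Qed.

Lemma fps_polyX_mul f n : (fps_poly 'X * f) n = if n is n'.+1 then f n' else 0.
Proof.
rewrite fpsM /fps_poly /ps_of_poly; case: n => [|n].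
  by rewrite big_ord1 coefX mul0r.
rewrite big_ord_recl big_ord_recl !coefX mul0r mul1r add0r subn1 big1 ?addr0 //.
by move=> i _; rewrite coefX mul0r.
Qed.

Lemma ps_inv_eq f g : f * g = 1 -> ps_inv f = g.
Proof.
move=> fg; rewrite /ps_inv; case: xgetP => [h _ fh | /(_ g)] //=.
have /= {}fh : f * (h : fps T) = 1 := fh.
by rewrite -[LHS](@mulr1 (fps T)) -fg mulrA [X in X * g]mulrC fh mul1r.
Qed.

End FormalPowerSeries.

Arguments fps_poly {T} p.

(** * Null sequences, Frobenius powers and the ultrametric absolute value *)

Definition vanishing (R : realType) (v : nat -> R) : Prop :=
  forall e, 0 < e -> exists N, forall n, (N <= n)%N -> v n < e.

Section Vanishing.
Variable R : realType.
Implicit Types u v : nat -> R.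

Lemma cvg_vanishing v : (forall n, 0 <= v n) ->
  v @ \oo --> (0 : R) <-> vanishing v.
Proof.
move=> v0; split=> [/cvgrPdist_lt v_cvg e e0 | v_van].
  have [N _ NP] := v_cvg e e0; exists N => n /NP /=.
  by rewrite sub0r normrN ger0_norm.
apply/cvgrPdist_lt => e /v_van[N NP]; exists N => // n /= /NP.
by rewrite sub0r normrN ger0_norm.
Qed.

Lemma le_vanishing u v : (forall n, u n <= v n) -> vanishing v -> vanishing u.
Proof.
move=> uv v0 e /v0[N NP]; exists N => n /NP; exact: le_lt_trans.
Qed.

Lemma vanishingM K v : 0 <= K -> vanishing v -> vanishing (fun n => K * v n).
Proof.
move=> K0 v0 e e0; have K1 : 0 < K + 1 by rewrite ltr_wpDl.
have [N NP] := v0 _ (divr_gt0 e0 K1); exists N => n /NP vn.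
have [vn0|vn0] := leP (v n) 0; first by rewrite (le_lt_trans _ e0) // mulr_ge0_le0.
rewrite ltr_pdivlMr // in vn; apply: le_lt_trans vn.
by rewrite mulrC ler_pM2l // lerDl.
Qed.

Lemma vanishing_max u v :
  vanishing u -> vanishing v -> vanishing (fun n => Num.max (u n) (v n)).
Proof.
move=> u0 v0 e e0; have [[M MP] [N NP]] := (u0 _ e0, v0 _ e0).
exists (maxn M N) => n; rewrite geq_max gt_max => /andP[/MP-> /NP->] //.
Qed.

Lemma vanishing_expV (b : nat) : (1 < b)%N ->
  vanishing (fun n => (b%:R ^+ n)^-1 : R).
Proof.
move=> b1 e e0; have [N NP] : exists N : nat, e^-1 < N%:R.
  by exists (Num.truncn e^-1).+1; rewrite truncnS_gt.
exists N => n Nn; have bn0 : 0 < (b%:R : R) ^+ n by rewrite exprn_gt0 // ltr0n ltnW.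
rewrite -[e]invrK ltf_pV2 ?posrE ?invr_gt0 // (lt_trans NP) // -natrX ltr_nat.
exact: leq_ltn_trans Nn (ltn_expl _ _).
Qed.

Lemma vanishing_le0 (x : R) v : vanishing v -> (forall n, x <= v n) -> x <= 0.
Proof.
move=> v0 xv; rewrite leNgt; apply/negP => /v0[N /(_ N (leqnn N))].
by rewrite ltNge xv.
Qed.

End Vanishing.

Section FrobeniusPower.
Variable F : finFieldType.
Local Notation q := #|F|.

Lemma q_gt1 : (1 < q)%N. Proof. exact: card_finNzRing_gt1. Qed.

Lemma q_gt0 : (0 < q)%N. Proof. exact: ltnW q_gt1. Qed.

Variables (S : comNzRingType) (f : {rmorphism F -> S}).

Lemma pchar_nat_q n : [pchar S].-nat (q ^ n)%N.
Proof.
have [p p_pr pF] := finfield.finPcharP F.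
have pS : p \in [pchar S] := rmorph_pchar f pF.
rewrite (eq_pnat _ (pcharf_eq pS)) pnatX; apply/orP; left.
by rewrite (finfield.card_pprimeChar pF) pnatX pnat_id.
Qed.

Lemma exprB_q (x y : S) n : (x - y) ^+ (q ^ n) = x ^+ (q ^ n) - y ^+ (q ^ n).
Proof. by apply/eqP; rewrite eq_sym subr_eq -exprDn_pchar ?pchar_nat_q ?subrK. Qed.

End FrobeniusPower.

Section AbsoluteValue.
Variables (R : realType) (F : finFieldType) (C : Cinfty R F).
Local Notation q := #|F|.
Local Notation theta := (theta C).
Implicit Types (x y : C) (u v : nat -> C) (e M : R).

Lemma qR_gt1 : 1 < q%:R :> R. Proof. by rewrite ltr1n q_gt1. Qed.

Lemma qR_gt0 : 0 < q%:R :> R. Proof. exact: lt_trans ltr01 qR_gt1. Qed.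

Lemma cabs0 : cabs (0 : C) = 0.
Proof.
(* The record does not state |0| = 0. Multiplicativity gives |0| |theta| = |0|, and |theta| = q
   differs from 1. *)
have h x : cabs (0 : C) * cabs x = cabs (0 : C) by rewrite -cabsM mul0r.
have /eqP := h theta; rewrite cabs_theta -subr_eq0 -{2}[cabs _]mulr1 -mulrBr.
by rewrite mulf_eq0 [_ - 1 == 0]subr_eq0 (gt_eqF qR_gt1) orbF => /eqP.
Qed.

Lemma cabs_eq0E x : (cabs x == 0) = (x == 0).
Proof. by apply/eqP/eqP => [/cabs_eq0 | ->] //; exact: cabs0. Qed.

Lemma cabs_gt0 x : (0 < cabs x) = (x != 0).
Proof. by rewrite lt_def cabs_eq0E cabs_ge0 andbT. Qed.

Lemma cabs1 : cabs (1 : C) = 1.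
Proof.
have /mulfI : cabs (1 : C) != 0 by rewrite cabs_eq0E oner_eq0.
by apply; rewrite -cabsM !mulr1.
Qed.

Lemma cabsX x n : cabs (x ^+ n) = cabs x ^+ n.
Proof. by elim: n => [|n IHn]; rewrite ?expr0 ?cabs1 // !exprS cabsM IHn. Qed.

Lemma cabsN x : cabs (- x) = cabs x.
Proof.
rewrite -mulN1r cabsM; have : cabs (-1 : C) ^+ 2 == 1 ^+ 2.
  by rewrite -cabsX sqrrN !expr1n cabs1.
by rewrite eqrXn2 ?cabs_ge0 ?ler01 // => /eqP->; rewrite mul1r.
Qed.

Lemma cabs_distC x y : cabs (x - y) = cabs (y - x).
Proof. by rewrite -cabsN opprB. Qed.

Lemma cabsV x : cabs x^-1 = (cabs x)^-1.
Proof.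
have [->|x0] := eqVneq x 0; first by rewrite invr0 cabs0 invr0.
have cx0 : cabs x != 0 by rewrite cabs_eq0E.
by apply: (mulfI cx0); rewrite -cabsM !divff // cabs1.
Qed.

Lemma cabsD_le M x y : cabs x <= M -> cabs y <= M -> cabs (x + y) <= M.
Proof. by move=> xM yM; rewrite (le_trans (cabsD x y)) // ge_max xM. Qed.

Lemma cabsB_le M x y : cabs x <= M -> cabs y <= M -> cabs (x - y) <= M.
Proof. by move=> xM yM; rewrite cabsD_le // cabsN. Qed.

Lemma cabsD_lt e x y : cabs x < e -> cabs y < e -> cabs (x + y) < e.
Proof. by move=> xM yM; rewrite (le_lt_trans (cabsD x y)) // gt_max xM. Qed.

Lemma cabs_sum_le (I : Type) (r : seq I) (P : pred I) (f : I -> C) M : 0 <= M ->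
  (forall i, P i -> cabs (f i) <= M) -> cabs (\sum_(i <- r | P i) f i) <= M.
Proof.
by move=> M0 fM; elim/big_rec: _ => [|i x /fM]; [rewrite cabs0 | apply: cabsD_le].
Qed.

Lemma cabsD_eq x y : cabs y < cabs x -> cabs (x + y) = cabs x.
Proof.
move=> yx; apply/eqP; rewrite eq_le cabsD_le ?(ltW yx) //= leNgt; apply/negP => xy.
have := cabsD_lt xy (y := - y); rewrite cabsN => /(_ yx).
by rewrite addrK ltxx.
Qed.

(** Nonzero constants are roots of unity of order dividing q - 1. *)
Lemma cabs_const_le1 (c : F) : cabs (Cconst C c) <= 1.
Proof.
have [->|c0] := eqVneq c 0; first by rewrite rmorph0 cabs0.
have h : cabs (Cconst C c) ^+ q.-1 = 1.
  rewrite -cabsX -rmorphXn /=.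
  suff -> : c ^+ q.-1 = 1 by rewrite rmorph1 cabs1.
  apply: (mulfI c0); rewrite -exprS prednK ?q_gt0 // mulr1.
  exact: finfield.expf_card.
rewrite leNgt; apply/negP => c1.
have q1 : (0 < q.-1)%N by rewrite -subn1 subn_gt0 q_gt1.
by have := exprn_egt1 q.-1 c1; rewrite h ltxx -lt0n q1.
Qed.

Lemma frob_is_zmod_morphism n : zmod_morphism (frob n : C -> C).
Proof.
by move=> x y; rewrite /frob (exprB_q (Cconst C)).
Qed.

Lemma frob_is_monoid_morphism n : monoid_morphism (frob n : C -> C).
Proof. by split=> [|x y]; rewrite /frob ?expr1n ?exprMn. Qed.

HB.instance Definition _ n :=
  GRing.isZmodMorphism.Build C C (frob n : C -> C) (frob_is_zmod_morphism n).
HB.instance Definition _ n :=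
  GRing.isMonoidMorphism.Build C C (frob n : C -> C) (frob_is_monoid_morphism n).

Lemma frob0 x : frob 0 x = x. Proof. by rewrite /frob expn0 expr1. Qed.

Lemma frobD m n x : frob (m + n) x = frob m (frob n x).
Proof. by rewrite /frob -exprM -expnD addnC. Qed.

Lemma frob_const n c : frob n (Cconst C c) = Cconst C c.
Proof.
rewrite /frob; elim: n => [|n IHn]; first by rewrite expn0 expr1.
by rewrite expnSr exprM IHn -rmorphXn finfield.expf_card.
Qed.

Lemma cabs_frob n x : cabs (frob n x) = cabs x ^+ (q ^ n).
Proof. exact: cabsX. Qed.

Lemma cvgCP u x : cvgC u x <-> vanishing (fun n => cabs (u n - x)).
Proof. by apply: cvg_vanishing => n; exact: cabs_ge0. Qed.

Lemma cvgC_cst x : cvgC (fun=> x) x.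
Proof. by apply/cvgCP => e e0; exists 0%N => n _; rewrite subrr cabs0. Qed.

Lemma cvgC_unique u x y : cvgC u x -> cvgC u y -> x = y.
Proof.
move=> /cvgCP ux /cvgCP uy; apply/eqP; rewrite -subr_eq0 -cabs_eq0E eq_le cabs_ge0.
rewrite andbT leNgt; apply/negP => xy.
have [[M MP] [N NP]] := (ux _ xy, uy _ xy).
set k := maxn M N; have := MP k; have := NP k; rewrite leq_maxl leq_maxr.
move=> /(_ isT) uy' /(_ isT); rewrite cabs_distC => ux'.
by have := cabsD_lt ux' uy'; rewrite addrA subrK ltxx.
Qed.

Lemma limC_eq u x : cvgC u x -> limC u = x.
Proof.
move=> ux; rewrite /limC; case: xgetP => [y _ uy | /(_ x)] //=.
exact: cvgC_unique uy ux.
Qed.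

Lemma cvgC_le u x y e : cvgC u x ->
  (exists N, forall n, (N <= n)%N -> cabs (u n - y) <= e) -> cabs (x - y) <= e.
Proof.
move=> /cvgCP ux [N NP]; rewrite leNgt; apply/negP => exy.
have [M MP] := ux _ (le_lt_trans (le_trans (cabs_ge0 _) (NP N (leqnn N))) exy).
set k := maxn M N; have := MP k; have := NP k; rewrite leq_maxl leq_maxr.
move=> /(_ isT) uy' /(_ isT); rewrite cabs_distC => ux'.
have := cabsD_lt ux' (le_lt_trans uy' exy).
by rewrite addrA subrK ltxx.
Qed.

Lemma cvgCD u v x y : cvgC u x -> cvgC v y -> cvgC (fun n => u n + v n) (x + y).
Proof.
move=> /cvgCP ux /cvgCP vy; apply/cvgCP.
apply: le_vanishing (vanishing_max ux vy) => n.
by rewrite opprD addrACA cabsD.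
Qed.

Lemma cvgCZ a u x : cvgC u x -> cvgC (fun n => a * u n) (a * x).
Proof.
move=> /cvgCP ux; apply/cvgCP.
apply: le_vanishing (vanishingM (cabs_ge0 a) ux) => n.
by rewrite -mulrBr cabsM.
Qed.

Lemma cvgC_sum (I : Type) (r : seq I) (P : pred I) (u : I -> nat -> C) (l : I -> C) :
  (forall i, P i -> cvgC (u i) (l i)) ->
  cvgC (fun n => \sum_(i <- r | P i) u i n) (\sum_(i <- r | P i) l i).
Proof.
move=> ux; elim: r => [|i r IHr].
  rewrite big_nil; under eq_fun do rewrite big_nil; exact: cvgC_cst.
rewrite big_cons; under eq_fun do rewrite big_cons.
by case: ifP => // Pi; apply: cvgCD => //; exact: ux.
Qed.

Lemma cvgC_frob m u x : cvgC u x -> cvgC (fun n => frob m (u n)) (frob m x).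
Proof.
move=> /cvgCP ux; apply/cvgCP => e e0.
(* Below 1 a power with positive exponent is at most its base, so the Frobenius power of the
   difference stays below e. *)
have [N NP] : exists N, forall n, (N <= n)%N -> cabs (u n - x) < Num.min e 1.
  by apply: ux; rewrite lt_min e0 ltr01.
exists N => n /NP; rewrite lt_min => /andP[ue u1].
rewrite -rmorphB cabs_frob; apply: le_lt_trans ue.
rewrite -[leRHS]expr1; apply: ler_wiXn2l; rewrite ?cabs_ge0 ?(ltW u1) //.
by rewrite expn_gt0 q_gt0.
Qed.

Lemma cvgC_shift u x k : cvgC (fun n => u (n + k)%N) x <-> cvgC u x.
Proof.
split=> /cvgCP ux; apply/cvgCP => e /ux[N NP].
  exists (N + k)%N => n Nn; rewrite -(@subnK k n) ?(leq_trans _ Nn) ?leq_addl //.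
  by apply: NP; rewrite leq_subRL ?(leq_trans _ Nn) ?leq_addl // addnC.
by exists N => n Nn; apply: NP; rewrite (leq_trans Nn) ?leq_addr.
Qed.

(** In the ultrametric setting small consecutive steps already make a sequence Cauchy. *)
Lemma C_complete_steps u : vanishing (fun n => cabs (u n.+1 - u n)) ->
  exists x, cvgC u x.
Proof.
move=> u0; apply: C_complete => e /u0[N NP]; exists N => m n Nm Nn.
have far k : (N <= k)%N -> cabs (u k - u N) < e.
  elim: k => [|k IHk]; rewrite ?leqn0.
    by move=> /eqP->; rewrite subrr cabs0 (le_lt_trans _ (NP N (leqnn N))) ?cabs_ge0.
  rewrite leq_eqVlt => /predU1P[<-|].
    by rewrite subrr cabs0 (le_lt_trans _ (NP N (leqnn N))) ?cabs_ge0.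
  rewrite ltnS => Nk; rewrite -(subrK (u k) (u k.+1)) -addrA.
  by apply: cabsD_lt; [exact: NP | exact: IHk].
rewrite -(subrK (u N) (u m)) -addrA; apply: cabsD_lt; first exact: far.
by rewrite cabs_distC far.
Qed.

Lemma series_cvgC u : vanishing (fun n => cabs (u n)) ->
  exists x, cvgC (fun n => \sum_(i < n) u i) x.
Proof.
move=> u0; apply: C_complete_steps; apply: le_vanishing u0 => n.
by rewrite big_ord_recr /= addrAC subrr add0r.
Qed.

End AbsoluteValue.

(** * The Tate algebra, its Gauss norm and the Taylor map at theta *)

Section TateAlgebra.
Variables (R : realType) (F : finFieldType) (C : Cinfty R F).
Local Notation q := #|F|.
Local Notation theta := (theta C).
Implicit Types (f g h : fps C) (p : {poly C}) (e M : R).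

(** A bound for the Gauss norm, stated coefficientwise so that no supremum has to be formed. *)
Definition gauss_le M f : Prop := forall i, cabs (f i * theta ^+ i) <= M.

Lemma inTP f : in_Ttheta f <-> vanishing (fun i => cabs (f i * theta ^+ i)).
Proof. by apply: cvg_vanishing => i; exact: cabs_ge0. Qed.

Lemma gauss_le_trans M M' f : M <= M' -> gauss_le M f -> gauss_le M' f.
Proof. by move=> MM fM i; exact: le_trans (fM i) MM. Qed.

Lemma gauss_le_ge0 M f : gauss_le M f -> 0 <= M.
Proof. by move=> /(_ 0%N); exact: le_trans (cabs_ge0 _). Qed.

Lemma gauss_le0 M : 0 <= M -> gauss_le M 0.
Proof. by move=> M0 i; rewrite fps0 mul0r cabs0. Qed.

Lemma gauss_leD M f g : gauss_le M f -> gauss_le M g -> gauss_le M (f + g).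
Proof. by move=> fM gM i; rewrite fpsD mulrDl cabsD_le. Qed.

Lemma gauss_leN M f : gauss_le M f -> gauss_le M (- f).
Proof. by move=> fM i; rewrite fpsN mulNr cabsN. Qed.

Lemma gauss_le_sum (I : Type) (r : seq I) (P : pred I) (f : I -> fps C) M :
  0 <= M -> (forall i, P i -> gauss_le M (f i)) ->
  gauss_le M (\sum_(i <- r | P i) f i).
Proof.
move=> M0 fM; elim/big_rec: _ => [|i g /fM]; [exact: gauss_le0 | exact: gauss_leD].
Qed.

Lemma gauss_leM M N f g : gauss_le M f -> gauss_le N g -> gauss_le (M * N) (f * g).
Proof.
move=> fM gN i; have M0 := gauss_le_ge0 fM; have N0 := gauss_le_ge0 gN.
rewrite fpsM mulr_suml; apply: cabs_sum_le => [|j _]; first exact: mulr_ge0.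
rewrite -[X in theta ^+ X](@subnKC j) -1?ltnS // exprD mulrACA cabsM.
by apply: ler_pM; rewrite ?cabs_ge0.
Qed.

Lemma gauss_leC c : gauss_le (cabs c) (fps_poly c%:P).
Proof.
case=> [|i]; rewrite /fps_poly /ps_of_poly coefC /= ?mulr1 //.
by rewrite mul0r cabs0 cabs_ge0.
Qed.

Lemma gauss_le1 : gauss_le 1 1.
Proof. by rewrite -(cabs1 C) -(rmorph1 fps_poly) -polyC1; exact: gauss_leC. Qed.

Lemma inT_D f g : in_Ttheta f -> in_Ttheta g -> in_Ttheta (f + g).
Proof.
move=> /inTP fT /inTP gT; apply/inTP.
apply: le_vanishing (vanishing_max fT gT) => i.
by rewrite fpsD mulrDl cabsD.
Qed.

Lemma inT_N f : in_Ttheta f -> in_Ttheta (- f).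
Proof.
move=> /inTP fT; apply/inTP; apply: le_vanishing fT => i.
by rewrite fpsN mulNr cabsN.
Qed.

Lemma inT_B f g : in_Ttheta f -> in_Ttheta g -> in_Ttheta (f - g).
Proof. by move=> fT gT; apply: inT_D => //; exact: inT_N. Qed.

Lemma inT_poly p : in_Ttheta (fps_poly p).
Proof.
apply/inTP => e e0; exists (size p) => i pi.
by rewrite /fps_poly /ps_of_poly nth_default // mul0r cabs0.
Qed.

Lemma inT_0 : in_Ttheta (0 : fps C).
Proof. by rewrite -(rmorph0 fps_poly); exact: inT_poly. Qed.

Lemma inT_1 : in_Ttheta (1 : fps C).
Proof. by rewrite -(rmorph1 fps_poly); exact: inT_poly. Qed.

Lemma inT_sum (I : Type) (r : seq I) (P : pred I) (f : I -> fps C) :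
  (forall i, P i -> in_Ttheta (f i)) -> in_Ttheta (\sum_(i <- r | P i) f i).
Proof. by move=> fT; elim/big_rec: _ => [|i g /fT]; [exact: inT_0 | exact: inT_D]. Qed.

Lemma inT_bounded f : in_Ttheta f -> exists2 M, 0 < M & gauss_le M f.
Proof.
move=> /inTP /(_ 1 ltr01)[N NP].
exists (Num.max 1 (\big[Num.max/0]_(i < N) cabs (f i * theta ^+ i))).
  by rewrite lt_max ltr01.
move=> i; rewrite le_max; have [/NP/ltW->//|iN] := leqP N i.
apply/orP; right.
exact: (le_bigmax _ (fun i : 'I_N => cabs (f i * theta ^+ i)) (Ordinal iN)).
Qed.

Lemma inT_M f g : in_Ttheta f -> in_Ttheta g -> in_Ttheta (f * g).
Proof.
move=> fT gT; have [[M M0 fM] [K K0 gK]] := (inT_bounded fT, inT_bounded gT).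
move: fT gT => /inTP fT /inTP gT; apply/inTP => e e0.
have [N NP] := fT _ (divr_gt0 e0 K0); have [N' NP'] := gT _ (divr_gt0 e0 M0).
exists (N + N')%N => i Ni; rewrite fpsM mulr_suml.
elim/big_rec: _ => [|j x _ xe]; first by rewrite cabs0.
apply: cabsD_lt xe.
rewrite -[X in theta ^+ X](@subnKC j) -1?ltnS // exprD mulrACA cabsM.
have [Nj|jN] := leqP N j.
  apply: le_lt_trans (_ : cabs (f j * theta ^+ j) * K < _); last first.
    by rewrite -ltr_pdivlMr // NP.
  by apply: ler_wpM2l; rewrite ?cabs_ge0.
apply: le_lt_trans (_ : M * cabs (g (i - j)%N * theta ^+ (i - j)) < _); last first.
  rewrite mulrC -ltr_pdivlMr // NP' //; have := ltn_ord j; lia.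
by apply: ler_wpM2r; rewrite ?cabs_ge0.
Qed.

Lemma inT_prod (I : Type) (r : seq I) (P : pred I) (f : I -> fps C) :
  (forall i, P i -> in_Ttheta (f i)) -> in_Ttheta (\prod_(i <- r | P i) f i).
Proof. by move=> fT; elim/big_rec: _ => [|i g /fT]; [exact: inT_1 | exact: inT_M]. Qed.

Lemma inT_X f n : in_Ttheta f -> in_Ttheta (f ^+ n).
Proof.
by move=> fT; elim: n => [|n IHn]; rewrite ?exprS; [exact: inT_1 | exact: inT_M].
Qed.

(** All hyperderivatives at theta packed into one series in X = t - theta, so that their Leibniz
    rule becomes multiplicativity. *)
Definition tay f : fps C := fun m => taylor_at_theta m f.

Lemma cabs_natr_le1 n : cabs (n%:R : C) <= 1.
Proof. by elim: n => [|n IHn]; rewrite ?cabs0 // mulrS cabsD_le ?cabs1. Qed.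

(** Binomial coefficients have absolute value at most 1 and |theta|^m >= 1. Hence hyperderivatives
    do not increase the Gauss norm, which gives both the convergence of Taylor coefficients and the
    bound [tay_le]. *)
Lemma cabs_hyperder f m i :
  cabs (hyperder m f i * theta ^+ i) <= cabs (f (i + m)%N * theta ^+ (i + m)).
Proof.
rewrite /hyperder -mulr_natr exprD !cabsM.
rewrite mulrA -[leRHS]mulrA -[leLHS]mulrA.
apply: ler_wpM2l; first exact: cabs_ge0.
rewrite mulrC; apply: ler_wpM2l; first exact: cabs_ge0.
rewrite (le_trans (cabs_natr_le1 _)) // cabsX cabs_theta.
by rewrite exprn_ege1 // ltW ?qR_gt1.
Qed.

Lemma tay_cvg f m : in_Ttheta f ->
  cvgC (fun N => \sum_(i < N) hyperder m f i * theta ^+ i) (tay f m).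
Proof.
move=> /inTP fT; have [|l ll] := @series_cvgC _ _ C (fun i => hyperder m f i * theta ^+ i).
  move=> e /fT[N NP]; exists N => n Nn; apply: le_lt_trans (cabs_hyperder _ _ _) _.
  by rewrite NP // (leq_trans Nn) ?leq_addr.
by rewrite /tay /taylor_at_theta /ps_eval (limC_eq ll).
Qed.

Lemma tay_le f M m : in_Ttheta f -> gauss_le M f -> cabs (tay f m) <= M.
Proof.
move=> fT fM; have := cvgC_le (y := 0) (tay_cvg m fT); rewrite subr0; apply.
exists 0%N => n _; rewrite subr0; apply: cabs_sum_le => [|i _].
  exact: gauss_le_ge0 fM.
exact: le_trans (cabs_hyperder _ _ _) (fM _).
Qed.

Lemma tayD f g : in_Ttheta f -> in_Ttheta g -> tay (f + g) = tay f + tay g.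
Proof.
move=> fT gT; apply: fpsP => m; apply: cvgC_unique (tay_cvg m (inT_D fT gT)) _.
have := cvgCD (tay_cvg m fT) (tay_cvg m gT); congr (cvgC _ _).
apply/funext => N; rewrite -big_split; apply: eq_bigr => i _ /=.
by rewrite -mulrDl /hyperder -mulrnDl.
Qed.

Lemma tay_poly p : tay (fps_poly p) = fps_poly (p \Po ('X + theta%:P)).
Proof.
apply: fpsP => m; apply: cvgC_unique (tay_cvg m (inT_poly p)) _.
suff -> : fps_poly (p \Po ('X + theta%:P)) m = p^`N(m).[theta].
  apply/cvgCP => e e0; exists (size p^`N(m)) => N pN.
  rewrite (horner_coef_wide _ pN) (_ : _ - _ = 0) ?cabs0 //.
  apply/eqP; rewrite subr_eq0; apply/eqP/eq_bigr => i _.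
  by rewrite coef_nderivn /hyperder addnC.
rewrite /fps_poly /ps_of_poly; elim/poly_ind: p m => [|p c IHp] m.
  by rewrite comp_poly0 coef0 linear0 horner0.
rewrite comp_poly_MXaddC mulrDr !coefD coefMX coefMC coefC.
case: m => [|m] /=; rewrite ?IHp.
  by rewrite !nderivn0 !hornerE.
by rewrite nderivnMXaddC !hornerE.
Qed.

Lemma tay0 : tay 0 = 0.
Proof. by rewrite -(rmorph0 fps_poly) tay_poly comp_poly0. Qed.

Lemma tay1 : tay 1 = 1.
Proof. by rewrite -(rmorph1 fps_poly) tay_poly -polyC1 comp_polyC. Qed.

Lemma tayC c : tay (fps_poly c%:P) = fps_poly c%:P.
Proof. by rewrite tay_poly comp_polyC. Qed.

Lemma tayX : tay (fps_poly 'X) = fps_poly ('X + theta%:P).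
Proof. by rewrite tay_poly comp_polyX. Qed.

Lemma tayN f : in_Ttheta f -> tay (- f) = - tay f.
Proof.
move=> fT; apply/eqP; rewrite -addr_eq0 -tayD ?addNr ?tay0 //; exact: inT_N.
Qed.

Lemma tayB f g : in_Ttheta f -> in_Ttheta g -> tay (f - g) = tay f - tay g.
Proof. by move=> fT gT; rewrite tayD ?tayN //; exact: inT_N. Qed.

Lemma tay_sum (I : Type) (r : seq I) (P : pred I) (f : I -> fps C) :
  (forall i, P i -> in_Ttheta (f i)) ->
  tay (\sum_(i <- r | P i) f i) = \sum_(i <- r | P i) tay (f i).
Proof.
move=> fT; elim: r => [|i r IHr]; first by rewrite !big_nil tay0.
rewrite !big_cons; case: ifP => // Pi; rewrite tayD ?IHr //; first exact: fT.
exact: inT_sum.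
Qed.

Lemma fps_mul_le M N f g m : 0 <= M -> (forall i, cabs (f i) <= M) ->
  (forall i, cabs (g i) <= N) -> cabs ((f * g) m) <= M * N.
Proof.
move=> M0 fM gN; rewrite fpsM; have N0 := le_trans (cabs_ge0 _) (gN 0%N).
apply: cabs_sum_le => [|i _]; first exact: mulr_ge0.
by rewrite cabsM ler_pM ?cabs_ge0.
Qed.

Lemma inT_approx f e : in_Ttheta f -> 0 < e ->
  exists p, gauss_le e (f - fps_poly p).
Proof.
move=> /inTP fT /[dup] e0 /fT[N NP]; exists (\poly_(i < N) f i) => i.
rewrite fpsD fpsN /fps_poly /ps_of_poly coef_poly; case: ltnP => [_|/NP/ltW].
  by rewrite subrr mul0r cabs0 ltW.
by rewrite subr0.
Qed.

(* Both sides are continuous for the Gauss norm, so it suffices to compare them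
   on polynomials, where the Taylor map is composition with X + theta. *)
Lemma tayM f g : in_Ttheta f -> in_Ttheta g -> tay (f * g) = tay f * tay g.
Proof.
move=> fT gT; have [[M M0 fM] [K K0 gK]] := (inT_bounded fT, inT_bounded gT).
apply: fpsP => m; apply/eqP; rewrite -subr_eq0 -cabs_eq0E eq_le cabs_ge0 andbT.
apply/ler_addgt0Pl => e e0; rewrite addr0.
(* The bound d <= M lets the approximant p inherit the bound M of f, and d (K + M) <= e makes both
   error terms of fg - pr = (f - p) g + p (g - r) at most e. *)
pose d := Num.min M (e / (K + M)).
have KM0 : 0 < K + M by exact: addr_gt0.
have d0 : 0 < d by rewrite lt_min M0 divr_gt0.
have dM : d <= M by rewrite ge_min lexx.
have [dK dM'] : d * K <= e /\ M * d <= e.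
  have : d <= e / (K + M) by rewrite ge_min lexx orbT.
  rewrite ler_pdivlMr // mulrDr => h; split; apply: le_trans h.
    by rewrite lerDl mulr_ge0 // ltW.
  by rewrite mulrC lerDr mulr_ge0 // ltW.
have [p fp] := inT_approx fT d0; have [r gr] := inT_approx gT d0.
have pM : gauss_le M (fps_poly p).
  rewrite -[fps_poly p](subrK f) -opprB; apply: gauss_leD => //.
  exact/gauss_leN/(gauss_le_trans dM).
have [pT rT] := (inT_poly p, inT_poly r).
have fpT := inT_B fT pT; have grT := inT_B gT rT.
have prE : tay (fps_poly p * fps_poly r) = tay (fps_poly p) * tay (fps_poly r).
  by rewrite -rmorphM !tay_poly -rmorphM comp_polyM.
have split_mul (a b a' b' : fps C) : a * b = (a - a') * b + a' * (b - b') + a' * b'.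
  by ring.
rewrite [f * g](split_mul _ _ (fps_poly p) (fps_poly r)).
rewrite [tay f * tay g](split_mul _ _ (tay (fps_poly p)) (tay (fps_poly r))).
have [aT bT cT] : [/\ in_Ttheta ((f - fps_poly p) * g),
    in_Ttheta (fps_poly p * (g - fps_poly r)) &
    in_Ttheta (fps_poly p * fps_poly r)] by split; exact: inT_M.
rewrite -!tayB // [tay (_ + fps_poly p * fps_poly r)]tayD //; last exact: inT_D.
rewrite prE [tay ((_ - _) * _ + _)]tayD //.
rewrite !fpsD opprD addrACA subrr addr0; apply: cabsB_le; apply: cabsD_le.
- apply: tay_le; first exact: inT_M.
  exact/(gauss_le_trans dK)/gauss_leM.
- apply: tay_le; first exact: inT_M.
  exact/(gauss_le_trans dM')/gauss_leM.
- apply: le_trans dK; apply: fps_mul_le => [|i|i]; rewrite ?(ltW d0) //.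
    exact: tay_le.
  exact: tay_le.
- apply: le_trans dM'; apply: fps_mul_le => [|i|i]; rewrite ?(ltW M0) //.
    exact: tay_le.
  exact: tay_le.
Qed.

Implicit Types S : nat -> fps C.

Lemma cvgT_coef S f i : cvgT S f -> cvgC (fun N => S N i) (f i).
Proof.
(* Halving e turns the weak inequality of [cvgT] into the strict one of [vanishing]. *)
move=> [_ Sf]; apply/cvgCP => e e0; have e20 : 0 < e / 2 by rewrite divr_gt0.
have [N NP] := Sf _ e20; exists N => n /NP[_ /(_ i)].
rewrite cabsM cabsX cabs_theta => h; apply: (@le_lt_trans _ _ (e / 2)).
  apply: le_trans h; apply: ler_peMr; first exact: cabs_ge0.
  by rewrite exprn_ege1 // ltW ?qR_gt1.
by rewrite ltr_pdivrMr // ltr_pMr // ltr1n.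
Qed.

Lemma limT_eq S f : cvgT S f -> limT S = f.
Proof.
move=> Sf; rewrite /limT; case: xgetP => [g _ Sg | /(_ f)] //=.
by apply/funext => i; exact: cvgC_unique (cvgT_coef i Sg) (cvgT_coef i Sf).
Qed.

Lemma cvgT_cst f : in_Ttheta f -> cvgT (fun=> f) f.
Proof.
move=> fT; split=> // e e0; exists 0%N => n _; split=> // i.
by rewrite subrr mul0r cabs0 ltW.
Qed.

Lemma cvgTD S S' f f' : cvgT S f -> cvgT S' f' -> cvgT (fun N => S N + S' N) (f + f').
Proof.
move=> [fT Sf] [fT' Sf']; split=> [|e e0]; first exact: inT_D.
have [[N NP] [N' NP']] := (Sf _ e0, Sf' _ e0).
exists (maxn N N') => n; rewrite geq_max => /andP[/NP[ST Se] /NP'[ST' Se']].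
split=> [|i]; first exact: inT_D.
by rewrite !fpsD opprD addrACA mulrDl cabsD_le.
Qed.

Lemma cvgTM g S f : in_Ttheta g -> cvgT S f -> cvgT (fun N => g * S N) (g * f).
Proof.
move=> gT [fT Sf]; split=> [|e e0]; first exact: inT_M.
have [K K0 gK] := inT_bounded gT; have [N NP] := Sf _ (divr_gt0 e0 K0).
exists N => n /NP[ST Se]; split=> [|i]; first exact: inT_M.
have := gauss_leM gK (Se : gauss_le _ (S n - f)) i.
by rewrite mulrBr mulrCA divff ?mulr1 ?gt_eqF.
Qed.

Lemma cvgT_sum (I : Type) (r : seq I) (P : pred I) (S : I -> nat -> fps C)
    (f : I -> fps C) : (forall i, P i -> cvgT (S i) (f i)) ->
  cvgT (fun N => \sum_(i <- r | P i) S i N) (\sum_(i <- r | P i) f i).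
Proof.
move=> Sf; elim: r => [|i r IHr].
  by rewrite big_nil; under eq_fun do rewrite big_nil; exact/cvgT_cst/inT_0.
rewrite big_cons; under eq_fun do rewrite big_cons.
by case: ifP => // Pi; apply: cvgTD => //; exact: Sf.
Qed.

Lemma tay_continuous S f m : cvgT S f -> cvgC (fun N => tay (S N) m) (tay f m).
Proof.
move=> [fT Sf]; apply/cvgCP => e e0; have e20 : 0 < e / 2 by rewrite divr_gt0.
have [N NP] := Sf _ e20; exists N => n /NP[ST Se].
apply: (@le_lt_trans _ _ (e / 2)); last first.
  by rewrite ltr_pdivrMr // ltr_pMr // ltr1n.
by rewrite -fpsN -fpsD -tayB //; apply: tay_le => //; exact: inT_B.
Qed.

(** Completeness of T_theta. The coefficients converge in C, and the ultrametric inequality turns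
    the bound on one step into a bound on all later differences, uniformly in the index of the
    coefficient. *)
Lemma cvgT_steps S (v : nat -> R) : (forall N, in_Ttheta (S N)) -> vanishing v ->
  (forall N, gauss_le (v N) (S N.+1 - S N)) -> exists f, cvgT S f.
Proof.
move=> ST v0 Sv.
have coef_cvg i : exists l, cvgC (fun N => S N i) l.
  apply: C_complete_steps; apply: le_vanishing v0 => N; apply: le_trans (Sv N i).
  rewrite cabsM cabsX cabs_theta; apply: ler_peMr; first exact: cabs_ge0.
  by rewrite exprn_ege1 // ltW ?qR_gt1.
pose f : fps C := fun i => xget 0 [set l | cvgC (fun N => S N i) l].
have Sf i : cvgC (fun N => S N i) (f i).
  by have [l ll] := coef_cvg i; rewrite /f; case: xgetP => // /(_ l).
have near e : 0 < e -> exists N, forall n, (N <= n)%N -> gauss_le e (S n - f).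
  move=> e0; have [N NP] := v0 _ e0; exists N => n Nn i.
  have far k : gauss_le e (S (n + k)%N - S n).
    elim: k => [|k IHk]; first by rewrite addn0 subrr; exact/gauss_le0/ltW.
    rewrite -(subrK (S (n + k)%N) (S _)) -addrA addnS; apply: gauss_leD => //.
    by apply: gauss_le_trans (Sv _); apply/ltW/NP; rewrite (leq_trans Nn) ?leq_addr.
  have -> : (S n - f) i * theta ^+ i = - (theta ^+ i * f i - theta ^+ i * S n i).
    by rewrite fpsD fpsN; ring.
  rewrite cabsN; apply: cvgC_le (cvgCZ _ (Sf i)) _.
  exists n => k nk; have := far (k - n)%N i; rewrite subnKC //.
  by rewrite fpsD fpsN -mulrBr mulrC.
exists f; split=> [|e /near[N NP]].
  apply/inTP => e e0; have e20 : 0 < e / 2 by rewrite divr_gt0.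
  have [N /(_ N (leqnn N)) Nf] := near _ e20.
  have /inTP /(_ e e0)[M MP] := ST N.
  exists M => i Mi; rewrite -[f](subKr (S N)) fpsD mulrDl cabsD_lt ?MP //.
  rewrite fpsN mulNr cabsN; apply: le_lt_trans (Nf i) _.
  by rewrite ltr_pdivrMr // ltr_pMr // ltr1n.
by exists N => n /NP; split.
Qed.

(** The inverse is the geometric series - sum t^n / c^(n+1). Its terms at |t| = |theta| shrink by
    |theta / c| <= 1/q; the hypothesis holds for c = theta^(q^k) with k >= 1. *)
Lemma inv_linear c : q%:R ^+ 2 <= cabs c ->
  exists g, [/\ fps_poly ('X - c%:P) * g = 1, in_Ttheta g & gauss_le (cabs c)^-1 g].
Proof.
move=> c2; have q0 := qR_gt0 R F.
have c0 : c != 0 by rewrite -cabs_gt0 (lt_le_trans _ c2) // exprn_gt0.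
have ca0 : 0 < cabs c by rewrite cabs_gt0.
pose g : fps C := fun n => - (c ^+ n.+1)^-1.
have gE n : cabs (g n * theta ^+ n) = (cabs c)^-1 * (q%:R / cabs c) ^+ n.
  rewrite cabsM cabsN cabsV !cabsX cabs_theta exprS invfM expr_div_n.
  by rewrite -mulrA [_^-1 * q%:R ^+ n]mulrC.
have qc : q%:R / cabs c <= q%:R^-1.
  by rewrite ler_pdivrMr // -ler_pdivrMl ?invr_gt0 // invrK -expr2.
exists g; split.
- rewrite rmorphB mulrBl; apply: fpsP => n.
  rewrite fpsD fpsN fps_polyX_mul fps_polyC_mul fps1 /g.
  case: n => [|n] /=; rewrite mulrN opprK.
    by rewrite add0r expr1 divff.
  by rewrite [c ^+ n.+2]exprS invfM mulrA divff // mul1r addNr.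
- apply/inTP; have := vanishingM (K := (cabs c)^-1) _ (vanishing_expV (R := R) (q_gt1 F)).
  rewrite invr_ge0 cabs_ge0 => /(_ isT); apply: le_vanishing => n; rewrite gE.
  rewrite ler_wpM2l ?invr_ge0 ?cabs_ge0 // -exprVn lerXn2r ?nnegrE //.
    by rewrite divr_ge0 ?cabs_ge0 // ltW.
  by rewrite invr_ge0 ltW.
- move=> n; rewrite gE ler_piMr ?invr_ge0 ?cabs_ge0 // exprn_ile1 //.
    by rewrite divr_ge0 ?cabs_ge0 // ltW.
  by rewrite (le_trans qc) // invf_le1 // ltW ?qR_gt1.
Qed.

(** The exponent of q in the Gauss norm of LL_i; each factor t - theta^(q^k) contributes q^k. *)
Definition LLdeg (i : nat) : nat := (\sum_(1 <= k < i.+1) q ^ k)%N.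

Lemma inv_LL i : exists g,
  [/\ fps_poly (LL C i) * g = 1, in_Ttheta g & gauss_le (q%:R ^+ LLdeg i)^-1 g].
Proof.
elim: i => [|i [g [Lg gT gM]]].
  exists 1; rewrite /LL /LLdeg !big_nil rmorph1 mulr1 expr0 invr1.
  by split=> //; [exact: inT_1 | exact: gauss_le1].
have [|h [Lh hT hM]] := @inv_linear (theta ^+ (q ^ i.+1)).
  rewrite cabsX cabs_theta ler_weXn2l ?ltW ?qR_gt1 //.
  apply: leq_trans (q_gt1 F) _; rewrite -[leqLHS]expn1 leq_pexp2l //.
  exact: q_gt0.
exists (g * h); rewrite /LL /LLdeg !(big_nat_recr i.+1) //= rmorphM; split.
- by rewrite mulrACA Lg Lh mulr1.
- exact: inT_M.
- rewrite exprD invfM; apply: gauss_leM => //.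
  by move: hM; rewrite cabsX cabs_theta.
Qed.

Lemma ps_inv_LL i n : let g : fps C := ps_inv (ps_of_poly (LL C i ^+ n)) in
  [/\ fps_poly (LL C i ^+ n) * g = 1, in_Ttheta g &
      gauss_le (q%:R ^+ (n * LLdeg i))^-1 g].
Proof.
have [g [Lg gT gM]] := inv_LL i.
have h : fps_poly (LL C i ^+ n) * g ^+ n = 1 by rewrite rmorphXn -exprMn Lg expr1n.
rewrite /= (ps_inv_eq h) mulnC exprM; split=> //.
  exact: inT_X.
elim: n {h} => [|n IHn]; first by rewrite !expr0 invr1; exact: gauss_le1.
by rewrite !exprS invfM; exact: gauss_leM.
Qed.

End TateAlgebra.

(** * Nested sums with strictly or weakly decreasing indices *)

Section NestedSums.
Variable V : comNzRingType.
Implicit Types (x y : nat -> V) (xs ys : seq (nat -> V)).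

(* The sum of x_1 (i_1) ... x_k (i_k) over N > i_1 and i_a + d > i_(a+1):
   strictly decreasing indices for d = 0, weakly decreasing ones for d = 1. *)
Fixpoint nsum (d N : nat) xs : V :=
  if xs is x :: xs' then \sum_(i < N) x i * nsum d (i + d) xs' else 1.

Lemma nsum_cons d N x xs : nsum d N (x :: xs) = \sum_(i < N) x i * nsum d (i + d) xs.
Proof. by []. Qed.

Lemma nsumS d N x xs :
  nsum d N.+1 (x :: xs) = nsum d N (x :: xs) + x N * nsum d (N + d) xs.
Proof. by rewrite nsum_cons big_ord_recr. Qed.

Definition ffcons n N (p : 'I_N * {ffun 'I_n -> 'I_N}) : {ffun 'I_n.+1 -> 'I_N} :=
  [ffun a => oapp p.2 p.1 (unlift ord0 a)].

Lemma ffcons0 n N (p : 'I_N * {ffun 'I_n -> 'I_N}) : ffcons p ord0 = p.1.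
Proof. by rewrite ffunE unlift_none. Qed.

Lemma ffconsS n N (p : 'I_N * {ffun 'I_n -> 'I_N}) a :
  ffcons p (lift ord0 a) = p.2 a.
Proof. by rewrite ffunE liftK. Qed.

Lemma ffcons_bij n N : bijective (@ffcons n N).
Proof.
exists (fun f : {ffun 'I_n.+1 -> 'I_N} =>
    (f ord0, [ffun a : 'I_n => f (lift ord0 a)])) => [[i g]|f].
  by rewrite ffcons0; congr pair; apply/ffunP => a; rewrite ffunE ffconsS.
by apply/ffunP => a; case: (unliftP ord0 a) => [b|] ->;
  rewrite ?ffconsS ?ffcons0 //= ffunE.
Qed.

(** The induction needs a bound M apart from the index type ['I_N]: under an outermost index i the
    remaining indices lie below i + d, which still does not exceed N because d <= 1. *)
Lemma nsum_ffun_lt d N M xs : (d <= 1)%N -> (M <= N)%N ->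
  \sum_(i : {ffun 'I_(size xs) -> 'I_N} |
      [forall a, (i a < M)%N] &&
      [forall a : 'I_(size xs), forall b : 'I_(size xs),
         (a < b)%N ==> (i b < i a + d)%N])
    \prod_(a < size xs) nth (fun=> 0) xs a (i a) = nsum d M xs.
Proof.
move=> d1; elim: xs M => [|x xs IHxs] M MN.
  rewrite (eq_bigl predT) => [|i] /=; last by apply/andP; split; apply/forallP => -[].
  rewrite (eq_bigr (fun=> 1)) => [|i _]; last by rewrite big_ord0.
  by rewrite sumr_const card_ffun !card_ord expn0.
rewrite nsum_cons (reindex (@ffcons (size xs) N)) /=; last first.
  by apply: onW_bij; exact: ffcons_bij.
have step (i : 'I_N) (g : {ffun 'I_(size xs) -> 'I_N}) :
    [forall a, (ffcons (i, g) a < M)%N] &&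
    [forall a : 'I_(size xs).+1, forall b : 'I_(size xs).+1,
       (a < b)%N ==> (ffcons (i, g) b < ffcons (i, g) a + d)%N] =
    (i < M)%N && ([forall a, (g a < i + d)%N] &&
      [forall a : 'I_(size xs), forall b : 'I_(size xs),
         (a < b)%N ==> (g b < g a + d)%N]).
  apply/andP/and3P => [[/forallP lt_M /forallP dec]|[iM /forallP lt_i /forallP dec]].
    split; first by have := lt_M ord0; rewrite ffcons0.
      apply/forallP => a; have /forallP/(_ (lift ord0 a)) := dec ord0.
      by rewrite ffcons0 ffconsS.
    apply/forallP => a; apply/forallP => b.
    by have /forallP/(_ (lift ord0 b)) := dec (lift ord0 a); rewrite !ffconsS.
  split; apply/forallP => a.
    case: (unliftP ord0 a) => [b|] ->; rewrite ?ffconsS ?ffcons0 //.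
    by apply: leq_trans (lt_i b) _;
      rewrite (leq_trans (leq_add (leqnn i) d1)) // addn1.
  apply/forallP => b; case: (unliftP ord0 b) => [b'|] -> //; rewrite ffconsS.
  case: (unliftP ord0 a) => [a'|] ->; rewrite ?ffconsS ?ffcons0.
    by have /forallP := dec a'; apply.
  by rewrite lt_i implybT.
rewrite (eq_bigl (fun p : 'I_N * {ffun 'I_(size xs) -> 'I_N} =>
    (p.1 < M)%N && ([forall a, (p.2 a < p.1 + d)%N] &&
      [forall a : 'I_(size xs), forall b : 'I_(size xs),
         (a < b)%N ==> (p.2 b < p.2 a + d)%N]))); last by case=> i g; exact: step.
rewrite -(pair_big_dep (fun i : 'I_N => (i < M)%N)
  (fun (i : 'I_N) (g : {ffun 'I_(size xs) -> 'I_N}) =>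
     [forall a, (g a < i + d)%N] && [forall a : 'I_(size xs),
        forall b : 'I_(size xs), (a < b)%N ==> (g b < g a + d)%N])
  (fun i g => \prod_(a < (size xs).+1)
      nth (fun=> 0) (x :: xs) a (ffcons (i, g) a))) /=.
rewrite (big_ord_widen N (fun i => x i * nsum d (i + d) xs) MN).
apply: eq_bigr => i iM; rewrite -IHxs; last first.
  by rewrite (leq_trans (leq_add (leqnn i) d1)) // addn1.
rewrite big_distrr; apply: eq_bigr => g _ /=.
rewrite big_ord_recl ffcons0 /=; congr (_ * _).
by apply: eq_bigr => a _; rewrite ffconsS.
Qed.

Lemma nsum_strict_ffun N k xs : size xs = k ->
  \sum_(i : {ffun 'I_k -> 'I_N} |
      [forall a : 'I_k, forall b : 'I_k,
         (a < b)%N ==> (i b < i a)%N])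
    \prod_(a < k) nth (fun=> 0) xs a (i a) = nsum 0 N xs.
Proof.
move=> <-; rewrite -(nsum_ffun_lt xs (leq0n 1) (leqnn N)); apply: eq_bigl => i.
rewrite [X in X && _](_ : _ = true); last by apply/forallP => a.
by apply: eq_forallb => a; apply: eq_forallb => b; rewrite addn0.
Qed.

Lemma nsum_weak_ffun N k xs : size xs = k ->
  \sum_(i : {ffun 'I_k -> 'I_N} |
      [forall a : 'I_k, forall b : 'I_k,
         (a < b)%N ==> (i b <= i a)%N])
    \prod_(a < k) nth (fun=> 0) xs a (i a) = nsum 1 N xs.
Proof.
move=> <-; rewrite -(nsum_ffun_lt xs (leqnn 1) (leqnn N)); apply: eq_bigl => i.
rewrite [X in X && _](_ : _ = true); last by apply/forallP => a.
by apply: eq_forallb => a; apply: eq_forallb => b; rewrite addn1 ltnS.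
Qed.

Definition incr_head (c : seq nat) : seq nat :=
  if c is a :: c' then a.+1 :: c' else [::].

(** The compositions of n, generated according to whether the first element forms its own block or
    joins the next one. This dichotomy matches the induction of [nsum_strict_weak]. *)
Fixpoint comps (n : nat) : seq (seq nat) :=
  if n is n'.+1 then
    [seq 1%N :: c | c <- comps n'] ++
    [seq incr_head c | c <- comps n' & c != [::]]
  else [:: [::]].

Lemma mem_comps n c : (c \in comps n) = all (ltn 0%N) c && (sumn c == n).
Proof.
elim: n c => [|n IHn] c; first by case: c => [|[|a] c] //=; rewrite inE andbF.
rewrite mem_cat; apply/orP/andP => [[/mapP[c']|/mapP[c']]|[]].
- by rewrite IHn => /andP[c0 /eqP cn] -> /=; rewrite c0 cn add1n.
- rewrite mem_filter IHn; case: c' => [|a c'] //= /andP[/andP[a0 c0] /eqP <-] ->.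
  by split; rewrite //= addSn.
case: c => [|[|[|a]] c] //= c0 /eqP cn.
  left; apply/mapP; exists c => //; rewrite IHn c0 /=; apply/eqP.
  by move: cn; rewrite add1n => -[].
right; apply/mapP; exists (a.+1 :: c) => //.
rewrite mem_filter IHn /= c0 /=; apply/eqP.
by move: cn; rewrite addSn => -[].
Qed.

Lemma comps_uniq n : uniq (comps n).
Proof.
elim: n => [|n IHn] //=; rewrite cat_uniq map_inj_uniq; last by move=> c c' [].
rewrite IHn /= map_inj_in_uniq ?filter_uniq ?andbT //; last first.
  move=> [|a c] [|b c']; rewrite !mem_filter //= => _ _ [-> ->] //.
apply/hasPn => c /mapP[c']; rewrite mem_filter mem_comps.
case: c' => [|[|a] c'] //= _ ->; apply/mapP => -[c'' _] //.
Qed.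

Definition merge_blocks (c : seq nat) xs : seq (nat -> V) :=
  [seq (fun i => \prod_(x <- B) x i) | B <- reshape c xs].

(* Merging the two outermost indices turns weak inequalities into strict ones:
   sum_(i >= j) - sum_(i = j) = sum_(i > j). *)
Lemma nsum_strict_weak N xs :
  nsum 0 N xs = \sum_(c <- comps (size xs))
    (-1) ^+ (size xs + size c) * nsum 1 N (merge_blocks c xs).
Proof.
elim: xs N => [|x xs IHxs] N; first by rewrite /= big_seq1 mulr1.
rewrite nsum_cons; under eq_bigr do rewrite addn0 IHxs.
rewrite [comps _]/= big_cat /= !big_map big_filter.
rewrite [X in _ + X](big_mkcond (fun c => c != [::])) -big_split /=.
under eq_bigr do rewrite mulr_sumr.
rewrite exchange_big /=; apply: eq_bigr => c _.
rewrite take0 drop0 addSn addnS exprS exprS mulrA mulN1r opprK mul1r.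
case: c => [|a c] /=.
  rewrite addr0 mulr_sumr; apply: eq_bigr => i _; rewrite big_seq1.
  by rewrite mulrCA.
(* In the weak sum below i + 1 the top index can equal i; the composition with enlarged first block
   contributes exactly these terms with the opposite sign, leaving the sum below i. *)
rewrite addSn exprS mulN1r mulNr -mulrBr -sumrB mulr_sumr; apply: eq_bigr => i _.
rewrite big_seq1 big_cons addn1 big_ord_recr /= addn1.
by ring.
Qed.

Fixpoint boxes (ns : seq nat) : seq (seq nat) :=
  if ns is n :: ns' then [seq j :: js | j <- iota 0 n.+1, js <- boxes ns']
  else [:: [::]].

Lemma boxes_cons n ns :
  boxes (n :: ns) = [seq j :: js | j <- iota 0 n.+1, js <- boxes ns].
Proof. by []. Qed.

Lemma mem_boxes ns js : reflect
  (size js = size ns /\ forall i, (i < size ns)%N -> (nth 0%N js i <= nth 0%N ns i)%N)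
  (js \in boxes ns).
Proof.
elim: ns js => [|n ns IHns] js.
  by rewrite inE; case: js => [|j js]; constructor=> // -[].
apply: (iffP allpairsP) => [[[j js'] /= [jn /IHns[sjs js_le] ->]]|[sjs js_le]].
  split=> [|[|i]]; rewrite /= ?sjs //; last exact: js_le.
  by move: jn; rewrite -/(iota 0 n.+1) mem_iota.
case: js sjs js_le => [//|j js] /= [sjs] js_le.
exists (j, js); split=> //=; first by rewrite -/(iota 0 n.+1) mem_iota; exact: (js_le 0%N).
by apply/IHns; split=> // i; exact: (js_le i.+1).
Qed.

Lemma boxes_uniq ns : uniq (boxes ns).
Proof.
elim: ns => [//|n ns IHns].
by rewrite boxes_cons allpairs_uniq ?iota_uniq // => -[j js] [k ks] _ _ [-> ->].
Qed.

Lemma nsum_multilinear d N (gs : seq (nat -> nat -> V)) ns : size gs = size ns ->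
  nsum d N [seq (fun i => \sum_(0 <= j < p.2.+1) p.1 j i) | p <- zip gs ns] =
  \sum_(js <- boxes ns) nsum d N [seq p.1 p.2 | p <- zip gs js].
Proof.
elim: gs ns N => [|g gs IHgs] [|n ns] // N; first by rewrite /= big_seq1.
move=> [sgs]; rewrite boxes_cons big_allpairs_dep -[iota 0 n.+1]/(index_iota 0 n.+1).
under eq_bigr do under eq_bigr do rewrite [zip _ _]/= [map _ _]/= nsum_cons.
under eq_bigr do rewrite exchange_big.
rewrite exchange_big [map _ _]/= nsum_cons /=; apply: eq_bigr => i _.
rewrite mulr_suml; apply: eq_bigr => j _.
by rewrite IHgs // mulr_sumr.
Qed.

Lemma nsum_scale d N (I : Type) (l : seq I) (t : I -> V) (h : I -> nat -> V) :
  nsum d N [seq (fun i => t p * h p i) | p <- l] =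
  (\prod_(p <- l) t p) * nsum d N [seq h p | p <- l].
Proof.
elim: l N => [|p l IHl] N; first by rewrite big_nil mulr1.
rewrite big_cons /= mulr_sumr; apply: eq_bigr => i _.
by rewrite IHl mulrACA.
Qed.

(** The list x_(m-1), ..., x_j. The reversal reflects the reversed tuples of the modules: the
    outermost summation index belongs to the last entry. *)
Definition rev_range (x : nat -> nat -> V) j m := [seq x c | c <- rev (index_iota j m)].

Lemma rev_range_nil (x : nat -> nat -> V) j : rev_range x j j = [::].
Proof. by rewrite /rev_range /index_iota subnn. Qed.

Lemma rev_rangeS (x : nat -> nat -> V) j m : (j <= m)%N ->
  rev_range x j m.+1 = x m :: rev_range x j m.
Proof.
move=> jm; rewrite /rev_range /index_iota subSn // -addn1 iotaD subnKC //.
by rewrite rev_cat.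
Qed.

(** Sort the weakly decreasing index tuples by how many leading indices equal i: those of x_(m-1),
    ..., x_l do, and the remaining ones are below i. *)
Lemma nsum_rev_range (x : nat -> nat -> V) j m i : (j <= m)%N ->
  nsum 1 i.+1 (rev_range x j m) =
  \sum_(j <= l < m.+1) (\prod_(l <= c < m) x c i) * nsum 1 i (rev_range x j l).
Proof.
move=> jm; rewrite -(subnKC jm); elim: (m - j)%N => [|r IHr].
  by rewrite addn0 big_nat1 big_geq // rev_range_nil mulr1.
rewrite addnS rev_rangeS ?leq_addr // nsumS addn1 IHr.
rewrite [RHS]big_nat_recr /=; last by rewrite -addnS leq_addr.
rewrite [X in _ = _ + X * _]big_geq // mul1r rev_rangeS ?leq_addr // [RHS]addrC.
congr (_ + _); rewrite mulr_sumr; apply: eq_big_nat => l /andP[_ lr].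
by rewrite big_nat_recr //= mulrA; congr (_ * _); rewrite mulrC.
Qed.

End NestedSums.

(** Course-of-values recursion, for functionals that look at arbitrary earlier values such as index
    n - q^i. The auxiliary [it] uses its first argument as fuel. *)
Lemma strong_recursion (T : Type) (t0 : T) (Phi : nat -> (nat -> T) -> T) :
  (forall n f g, (forall k, (k < n)%N -> f k = g k) -> Phi n f = Phi n g) ->
  exists f, forall n, f n = Phi n f.
Proof.
move=> ext; pose it := fix it n := if n is n'.+1 then fun k => Phi k (it n') else fun=> t0.
have itS n k : (k < n)%N -> it n k = it n.+1 k.
  elim: n k => [//|n IHn] k kn; apply: ext => j jk.
  by apply: IHn; apply: leq_trans jk _.
have itD m k : (k < m)%N -> it m k = it k.+1 k.
  elim: m => [//|m IHm]; rewrite ltnS leq_eqVlt => /predU1P[->//|km].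
  by rewrite -itS // IHm.
exists (fun k => it k.+1 k) => n; apply: ext => k kn; exact: itD.
Qed.

(** * Carlitz factorials and the Anderson-Thakur polynomials *)

Section CarlitzFactorials.
Variable F : finFieldType.
Local Notation q := #|F|.

(** Carlitz's [l], out of which D_i and Gamma_(n+1) are built. *)
Definition bracket (l : nat) : {poly F} := 'X ^+ (q ^ l) - 'X.

Lemma bracket_neq0 l : (0 < l)%N -> bracket l != 0.
Proof.
move=> l0; rewrite -size_poly_gt0 /bracket size_polyDl ?size_polyXn //.
rewrite size_polyN size_polyX !ltnS.
by apply: leq_trans (q_gt1 F) _; rewrite -[leqLHS]expn1 leq_pexp2l ?q_gt0.
Qed.

Lemma carlitzD_bracket i :
  carlitzD F i = \prod_(1 <= l < i.+1) bracket l ^+ (q ^ (i - l)).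
Proof.
rewrite /carlitzD big_add1 /= big_nat_rev big_mkord /=; apply: eq_bigr => j _.
have ji : (j < i)%N := ltn_ord j.
rewrite add0n -[(i - j.+1).+1]subSn // subSS subKn; last exact: ltnW.
rewrite /bracket (exprB_q (@polyC F)) -exprM -expnD subnK //; exact: ltnW.
Qed.

Lemma base_digits n l N : (0 < q)%N -> (l <= N)%N ->
  (\sum_(l <= i < N) q ^ (i - l) * ((n %/ q ^ i) %% q) +
   q ^ (N - l) * (n %/ q ^ N) = n %/ q ^ l)%N.
Proof.
move=> q0; elim: N => [|N IHN].
  by rewrite leqn0 => /eqP->; rewrite big_geq // mul1n.
rewrite leq_eqVlt => /predU1P[->|lN]; first by rewrite big_geq // subnn mul1n.
rewrite big_nat_recr //= -addnA -[RHS]IHN //; congr addn.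
rewrite subSn // expnSr -mulnA -mulnDr; congr muln.
by rewrite addnC mulnC expnSr divnMA -divn_eq.
Qed.

Definition carlitzD_exp (i l : nat) : nat := if (l <= i)%N then (q ^ (i - l))%N else 0%N.

Lemma carlitzD_bracketW i M : (i <= M)%N ->
  carlitzD F i = \prod_(1 <= l < M.+1) bracket l ^+ carlitzD_exp i l.
Proof.
move=> iM; rewrite carlitzD_bracket (big_nat_widen _ _ M.+1) // big_mkcond /=.
by apply: eq_bigr => l _; rewrite ltnS /carlitzD_exp; case: ifP; rewrite ?expr0.
Qed.

(** The analogue of Legendre's formula: the digits of n from place l on, weighted by q^(i-l),
    recombine to floor(n / q^l). The free bound M lets several factorials be compared over one range
    of l. *)
Lemma carlitz_gammaE n M : (n <= M)%N ->
  carlitz_gamma F n.+1 = \prod_(1 <= l < M.+1) bracket l ^+ (n %/ q ^ l).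
Proof.
move=> nM.
have small l : (n < l)%N -> (n %/ q ^ l = 0)%N.
  by move=> nl; rewrite divn_small // (ltn_trans nl) // ltn_expl ?q_gt1.
rewrite (big_cat_nat (n := n.+1)) //= [X in _ * X](_ : _ = 1) ?mulr1; last first.
  by rewrite big_nat big1 // => l /andP[nl _]; rewrite small.
rewrite /carlitz_gamma /=.
rewrite (eq_bigr (fun i : 'I_n.+1 => \prod_(1 <= l < n.+1)
    bracket l ^+ (carlitzD_exp i l * ((n %/ q ^ i) %% q)))); last first.
  move=> i _; rewrite (@carlitzD_bracketW i n) -1?ltnS // -prodrXl.
  by apply: eq_bigr => l _; rewrite exprM.
rewrite exchange_big /=; apply: eq_big_nat => l /andP[l0 ln].
rewrite -expr_sum; congr (_ ^+ _).
rewrite -(big_mkord xpredT (fun i => carlitzD_exp i l * ((n %/ q ^ i) %% q)))%N.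
rewrite (big_cat_nat (n := l)) //= ?(ltnW ln) // [X in (X + _)%N](_ : _ = 0%N) ?add0n; last first.
  by rewrite big_nat big1 // => i /andP[_ il]; rewrite /carlitzD_exp leqNgt il.
rewrite -(@base_digits n l n.+1) ?q_gt0 ?(ltnW ln) // small // muln0 addn0.
by apply: eq_big_nat => i /andP[li _]; rewrite /carlitzD_exp li.
Qed.

Lemma carlitz_gamma_q i : carlitz_gamma F (q ^ i).+1 = carlitzD F i.
Proof.
have iq : (i <= q ^ i)%N by rewrite ltnW // ltn_expl ?q_gt1.
rewrite (carlitz_gammaE (leqnn _)) (carlitzD_bracketW iq).
apply: eq_bigr => l _; congr (_ ^+ _); rewrite /carlitzD_exp; case: leqP => li.
  by rewrite -{1}(subnK li) expnD mulnK // expn_gt0 q_gt0.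
by rewrite divn_small // ltn_exp2l ?q_gt1.
Qed.

(** For q^i <= n this is the analogue of a binomial coefficient, Gamma_(n+1) / (D_i
    Gamma_(n-q^i+1)). It is a polynomial because floor is superadditive, so the natural-number
    subtractions do not truncate. *)
Definition AT_B (n i : nat) : {poly F} :=
  \prod_(1 <= l < n.+1)
     bracket l ^+ (n %/ q ^ l - (n - q ^ i) %/ q ^ l - q ^ i %/ q ^ l).

Lemma carlitz_gamma_split n i : (q ^ i <= n)%N ->
  carlitz_gamma F n.+1 = AT_B n i * carlitzD F i * carlitz_gamma F (n - q ^ i).+1.
Proof.
move=> qn; rewrite -carlitz_gamma_q (carlitz_gammaE (leqnn n)) (carlitz_gammaE qn).
rewrite (carlitz_gammaE (leq_subr _ n)) -!big_split; apply: eq_bigr => l _ /=.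
rewrite -!exprD; congr (_ ^+ _).
have : ((n - q ^ i) %/ q ^ l + q ^ i %/ q ^ l <= n %/ q ^ l)%N; last first.
  by move: (n %/ _)%N (_ %/ _)%N (_ %/ _)%N => c b a; lia.
by rewrite -[X in (_ <= X %/ _)%N](subnK qn) divnD ?expn_gt0 ?q_gt0 // leq_addr.
Qed.

Lemma prod_bracket_neq0 M (e : nat -> nat) :
  \prod_(1 <= l < M.+1) bracket l ^+ e l != 0.
Proof.
rewrite prodf_seq_neq0; apply/allP => l; rewrite mem_index_iota => /andP[l0 _].
by rewrite expf_neq0 ?bracket_neq0.
Qed.

Lemma carlitzD_neq0 i : carlitzD F i != 0.
Proof. by rewrite carlitzD_bracket prod_bracket_neq0. Qed.

Lemma carlitz_gamma_neq0 n : carlitz_gamma F n.+1 != 0.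
Proof. by rewrite (carlitz_gammaE (leqnn n)) prod_bracket_neq0. Qed.

End CarlitzFactorials.

Section SparseReciprocal.
Variables (K : comNzRingType) (b : nat) (g : nat -> K).
Hypothesis b1 : (1 < b)%N.

(** The coefficient of x^m in 1 - sum_i g_i x^(b^i). Restricting to i <= m loses nothing since i <
    b^i. [AT_den] is the instance b = q. *)
Definition sparse_den (m : nat) : K :=
  (m == 0%N)%:R - \sum_(i < m.+1 | (b ^ i == m)%N) g i.

Lemma sparse_den_mul (h : nat -> K) n : ps_mul sparse_den h n =
  h n - \sum_(i < n.+1 | (b ^ i <= n)%N) g i * h (n - b ^ i)%N.
Proof.
rewrite /ps_mul /sparse_den; under eq_bigr do rewrite mulrBl.
rewrite big_split /= big_ord_recl mul1r subn0 big1 ?addr0; last first.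
  by move=> i _; rewrite mul0r.
congr (_ + _); rewrite sumrN; congr (- _).
transitivity (\sum_(m < n.+1) \sum_(i < n.+1 | (b ^ i == m)%N && (i < m.+1)%N)
    g i * h (n - m)%N).
  apply: eq_bigr => m _; rewrite -mulr_suml; congr (_ * _).
  exact: (big_ord_widen_cond n.+1 (fun i => b ^ i == m)%N g).
rewrite (exchange_big_dep predT) //= [RHS]big_mkcond; apply: eq_bigr => i _.
case: leqP => qn; last first.
  rewrite big_pred0 // => m; apply/negP => /andP[/eqP qm _].
  by move: qn; rewrite qm leqNgt ltn_ord.
rewrite (big_pred1 (inord (b ^ i))) ?inordK ?ltnS // => m /=.
apply/andP/eqP => [[/eqP qm _]|->]; first by rewrite qm inord_val.
by rewrite inordK ?ltnS // eqxx; split=> //; apply: ltnW; exact: ltn_expl.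
Qed.

Lemma sparse_den_rec (h : nat -> K) :
  ps_mul sparse_den h = ps_one _ <-> forall n,
    h n = (n == 0%N)%:R + \sum_(i < n.+1 | (b ^ i <= n)%N) g i * h (n - b ^ i)%N.
Proof.
split=> [dh n|hE]; first by rewrite -[_%:R]/(ps_one _ n) -dh sparse_den_mul subrK.
by apply/funext => n; rewrite sparse_den_mul {1}hE addrK.
Qed.

End SparseReciprocal.

Lemma frac_cancel (K : fieldType) (a b c d e : K) : b != 0 -> c != 0 -> d != 0 ->
  a / d * (e / c) = a * b * e / (b * d * c).
Proof. by move=> b0 c0 d0; field; rewrite b0 c0 d0. Qed.

Section AndersonThakurPolynomials.
Variable F : finFieldType.
Local Notation q := #|F|.
Implicit Types n : nat.

Local Notation frac := (@tofrac {poly {poly F}}).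
Let g i : {fraction {poly {poly F}}} := frac (AT_G F i) / frac (carlitzD F i)^:P.

Lemma frac_polyC_neq0 (p : {poly F}) : p != 0 -> frac p^:P != 0.
Proof.
by move=> p0; rewrite tofrac_eq0 map_polyC_eq0.
Qed.

(** The generating identity after clearing Gamma_(n+1). All factors lie in A[t], so solving this
    recursion proves the integrality of H_n and shows that [AT_H] is not a default value. *)
Definition AT_rec (H : nat -> {poly {poly F}}) : Prop := forall n,
  H n = (n == 0%N)%:R + \sum_(i < n.+1 | (q ^ i <= n)%N)
          AT_G F i * (AT_B F n i)^:P * H (n - q ^ i)%N.

Lemma AT_den_AT_rec (H : nat -> {poly {poly F}}) :
  ps_mul (AT_den F) (fun n => frac (H n) / frac (carlitz_gamma F n.+1)^:P)
    = ps_one _ <-> AT_rec H.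
Proof.
apply: iff_trans (sparse_den_rec g (q_gt1 F) _) _.
have key n i : (q ^ i <= n)%N ->
    g i * (frac (H (n - q ^ i)%N) / frac (carlitz_gamma F (n - q ^ i).+1)^:P) =
    frac (AT_G F i * (AT_B F n i)^:P * H (n - q ^ i)%N) /
      frac (carlitz_gamma F n.+1)^:P.
  move=> qn; rewrite (carlitz_gamma_split qn) !rmorphM /= /g.
  apply: frac_cancel; apply: frac_polyC_neq0.
  - exact: prod_bracket_neq0.
  - exact: carlitz_gamma_neq0.
  - exact: carlitzD_neq0.
have one n : (n == 0%N)%:R =
    frac (n == 0%N)%:R / frac (carlitz_gamma F n.+1)^:P.
  case: n => [|n]; last by rewrite rmorph0 mul0r.
  by rewrite (carlitz_gammaE F (leqnn 0)) big_geq // !rmorph1 divff ?oner_neq0.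
have rhs n : (n == 0%N)%:R + \sum_(i < n.+1 | (q ^ i <= n)%N)
    g i * (frac (H (n - q ^ i)%N) / frac (carlitz_gamma F (n - q ^ i).+1)^:P) =
  frac ((n == 0%N)%:R + \sum_(i < n.+1 | (q ^ i <= n)%N)
          AT_G F i * (AT_B F n i)^:P * H (n - q ^ i)%N)
    / frac (carlitz_gamma F n.+1)^:P.
  rewrite rmorphD rmorph_sum mulrDl mulr_suml -one; congr (_ + _).
  by apply: eq_bigr => i qn; exact: key.
split=> HE n; last by rewrite rhs -HE.
have := HE n; rewrite rhs => /(mulIf _) /eqP.
by rewrite invr_eq0 frac_polyC_neq0 ?carlitz_gamma_neq0 // tofrac_eq => /(_ isT)/eqP.
Qed.

Lemma AT_H_rec : AT_rec (AT_H F).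
Proof.
have [|H HE] := @strong_recursion _ 0 (fun n (H : nat -> {poly {poly F}}) =>
  (n == 0%N)%:R + \sum_(i < n.+1 | (q ^ i <= n)%N)
          AT_G F i * (AT_B F n i)^:P * H (n - q ^ i)%N).
  move=> n f f' ff'; congr (_ + _); apply: eq_bigr => i qn.
  by rewrite ff' // ltn_subrL expn_gt0 q_gt0 (leq_trans _ qn) // expn_gt0 q_gt0.
rewrite /AT_H; case: xgetP => [H' _ /AT_den_AT_rec//|/(_ H)[]].
exact/AT_den_AT_rec.
Qed.

(** Degrees in theta are multiplied by q - 1 so that the bound n q / (q - 1) stays integral; the
    zero coefficient counts as degree 0. *)
Definition coef_deg_le (k : nat) (p : {poly {poly F}}) : Prop :=
  forall j, (q.-1 * (size (p`_j)%R).-1 <= k)%N.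

Lemma deg_le_sum (I : Type) (r : seq I) (P : pred I) (f : I -> {poly F}) k :
  (forall i, P i -> (q.-1 * (size (f i)).-1 <= k)%N) ->
  (q.-1 * (size (\sum_(i <- r | P i) f i)%R).-1 <= k)%N.
Proof.
move=> fk; elim/big_rec: _ => [|i p /fk fi pk]; first by rewrite size_poly0 muln0.
have := size_polyD (f i) p; rewrite leq_max => /orP[] h.
  by apply: leq_trans fi; rewrite leq_mul2l; apply/orP; right; lia.
by apply: leq_trans pk; rewrite leq_mul2l; apply/orP; right; lia.
Qed.

Lemma coef_deg_leM k l p r :
  coef_deg_le k p -> coef_deg_le l r -> coef_deg_le (k + l) (p * r).
Proof.
move=> pk rl j; rewrite coefM; apply: deg_le_sum => i _.
apply: leq_trans (leq_add (pk i) (rl (j - i)%N)); rewrite -mulnDr leq_mul2l.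
apply/orP; right; have := size_polyMleq p`_i r`_(j - i)%N.
by move: (size (p`_i * r`_(j - i)%N)) (size p`_i) (size r`_(j - i)%N) => a b c; lia.
Qed.

Lemma coef_deg_le_polyC (p : {poly F}) : coef_deg_le 0 p^:P.
Proof.
move=> j; rewrite coef_map /= size_polyC; by case: (_ != 0); rewrite muln0.
Qed.

(** The degree in theta is at most q + ... + q^n, and q - 1 times this is q^(n+1) - q. *)
Lemma coef_deg_le_AT_G n : coef_deg_le (q ^ n * q) (AT_G F n).
Proof.
have h m : coef_deg_le (\sum_(1 <= i < m.+1) q.-1 * q ^ i)%N
    (\prod_(1 <= i < m.+1) ('X ^+ (q ^ n) - ('X ^+ (q ^ i))%:P)).
  elim: m => [|m IHm].
    rewrite !big_geq // => j; rewrite coef1.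
    by case: (j == 0%N); rewrite ?size_poly1 ?size_poly0 muln0.
  rewrite !(big_nat_recr m.+1) //=; apply: coef_deg_leM => // j.
  rewrite coefB coefXn coefC leq_mul2l; apply/orP; right.
  rewrite -subn1 leq_subLR add1n; apply: leq_trans (size_polyD _ _) _.
  rewrite geq_max size_polyN; apply/andP; split.
    by case: (j == _); rewrite ?size_poly1 ?size_poly0.
  by case: ifP => _; rewrite ?size_polyXn ?size_poly0.
move=> j; apply: leq_trans (h n j) _.
rewrite -big_distrr /=; have := q_gt0 F; move: (q) => b b0.
elim: n {h} => [|n IHn]; first by rewrite big_geq ?muln0.
rewrite big_nat_recr //= mulnDr.
apply: leq_trans (leq_add IHn (leqnn _)) _.
by rewrite -expnSr -mulSn prednK // mulnC.
Qed.

(** In the recursion G_i contributes q^i q, H_(n-q^i) contributes (n - q^i) q, and the factor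
    [AT_B], a polynomial in t alone, contributes nothing. *)
Lemma AT_H_deg n : coef_deg_le (n * q) (AT_H F n).
Proof.
elim/ltn_ind: n => n IHn j; rewrite AT_H_rec coefD coef_sum.
have q0 := q_gt0 F.
have H0 : (q.-1 * (size (((n == 0%N)%:R : {poly {poly F}})`_j)%R).-1 <= n * q)%N.
  case: (n == 0%N); rewrite ?coef1 ?coef0 ?size_poly0 ?muln0 //.
  by case: (j == 0%N); rewrite ?size_poly1 ?size_poly0 ?muln0.
have Hs : (q.-1 * (size (\sum_(i < n.+1 | (q ^ i <= n)%N)
     (AT_G F i * (AT_B F n i)^:P * AT_H F (n - q ^ i)%N)`_j)%R).-1 <= n * q)%N.
  apply: deg_le_sum => i qn.
  have lt : (n - q ^ i < n)%N.
    by rewrite ltn_subrL expn_gt0 q0 (leq_trans _ qn) // expn_gt0 q0.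
  have := coef_deg_leM (coef_deg_leM (@coef_deg_le_AT_G i)
    (coef_deg_le_polyC (AT_B F n i))) (IHn _ lt) j.
  by rewrite addn0 -mulnDl subnKC.
(* The sum of the two parts is treated as a sum over a two-element index list. *)
have := @deg_le_sum bool [:: true; false] predT (fun b : bool => if b then
   ((n == 0%N)%:R : {poly {poly F}})`_j else \sum_(i < n.+1 | (q ^ i <= n)%N)
     (AT_G F i * (AT_B F n i)^:P * AT_H F (n - q ^ i)%N)`_j) (n * q)%N.
by rewrite big_cons big_seq1; apply; case.
Qed.

End AndersonThakurPolynomials.

(** * Evaluation of A at theta and its absolute value *)

Section PolynomialEvaluation.
Variables (R : realType) (F : finFieldType) (C : Cinfty R F).
Local Notation q := #|F|.
Local Notation theta := (theta C).

Lemma ofA_is_zmod_morphism : zmod_morphism (ofA C).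
Proof. by move=> a b; rewrite /ofA rmorphB hornerD hornerN. Qed.

Lemma ofA_is_monoid_morphism : monoid_morphism (ofA C).
Proof. by split=> [|a b]; rewrite /ofA ?rmorph1 ?hornerC ?rmorphM ?hornerM. Qed.

HB.instance Definition _ :=
  GRing.isZmodMorphism.Build {poly F} C (ofA C) ofA_is_zmod_morphism.
HB.instance Definition _ :=
  GRing.isMonoidMorphism.Build {poly F} C (ofA C) ofA_is_monoid_morphism.

Lemma ofAC c : ofA C c%:P = Cconst C c.
Proof. by rewrite /ofA map_polyC hornerC. Qed.

Lemma ofAX : ofA C 'X = theta.
Proof. by rewrite /ofA map_polyX hornerX. Qed.

Lemma cabs_const c : c != 0 -> cabs (Cconst C c) = 1.
Proof.
move=> c0; apply/eqP; rewrite eq_le cabs_const_le1 /=.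
have := cabs_const_le1 C c^-1; rewrite fmorphV cabsV invf_le1 //.
by rewrite cabs_gt0 fmorph_eq0.
Qed.

Lemma cabs_ofA a : a != 0 -> cabs (ofA C a) = q%:R ^+ (size a).-1.
Proof.
elim/poly_ind: a => [|p c IHp]; first by rewrite eqxx.
rewrite -size_poly_eq0 size_MXaddC.
have [->|p0] := eqVneq p 0.
  have [//|c0 _] := eqVneq c 0.
  by rewrite mul0r add0r ofAC size_poly0 cabs_const.
move=> _ /=; rewrite rmorphD rmorphM /= ofAX ofAC.
have pE : cabs (ofA C p * theta) = q%:R ^+ (size p).
  by rewrite cabsM cabs_theta IHp // -exprSr prednK ?size_poly_gt0.
rewrite cabsD_eq pE //; apply: le_lt_trans (cabs_const_le1 C c) _.
by rewrite exprn_egt1 ?qR_gt1 // size_poly_eq0.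
Qed.

Lemma cabs_ofA_le a : cabs (ofA C a) <= q%:R ^+ (size a).-1.
Proof.
have [->|/cabs_ofA->//] := eqVneq a 0.
by rewrite rmorph0 cabs0 exprn_ge0 ?ler0n.
Qed.

Lemma ofA_eq0 a : (ofA C a == 0) = (a == 0).
Proof.
have [->|a0] := eqVneq a 0; first by rewrite rmorph0 eqxx.
by apply/negbTE; rewrite -cabs_gt0 cabs_ofA // exprn_gt0 ?qR_gt0.
Qed.

End PolynomialEvaluation.

(** * Convergence of the star series and decomposition of zeta^AT into them *)

Section StarSeries.
Variables (R : realType) (F : finFieldType) (C : Cinfty R F).
Local Notation q := #|F|.
Local Notation theta := (theta C).

(** One factor of a general term of Li^star. Taking exponent and numerator as a pair makes it
    multiplicative in the pair, which is what the merging of blocks uses. *)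
Definition xterm (p : nat * C) (i : nat) : fps C :=
  fps_poly (frob i p.2)%:P * ps_inv (ps_of_poly (LL C i ^+ p.1)).

Lemma xterm_mul n n' w w' i :
  xterm ((n + n')%N, w * w') i = xterm (n, w) i * xterm (n', w') i.
Proof.
have [[h _ _] [h' _ _]] := (ps_inv_LL C i n, ps_inv_LL C i n').
rewrite /xterm /= rmorphM polyCM rmorphM mulrACA; congr (_ * _).
by apply: ps_inv_eq; rewrite exprD -/(fps_poly _) rmorphM mulrACA h h' mulr1.
Qed.

Lemma xterm1 i : xterm (0%N, 1) i = 1.
Proof.
rewrite /xterm rmorph1 rmorph1 mul1r; apply: ps_inv_eq.
by rewrite -/(fps_poly _) expr0 rmorph1 mulr1.
Qed.

Lemma xterm_prod (I : Type) (l : seq I) (h : I -> nat * C) i :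
  \prod_(k <- l) xterm (h k) i =
  xterm ((\sum_(k <- l) (h k).1)%N, \prod_(k <- l) (h k).2) i.
Proof.
elim: l => [|k l IHl]; first by rewrite !big_nil xterm1.
by rewrite !big_cons IHl xterm_mul -surjective_pairing.
Qed.

Lemma LLdegE i : (q.-1 * LLdeg F i + q = q ^ i.+1)%N.
Proof.
have := q_gt0 F; rewrite /LLdeg; move: (q) => b b0.
elim: i => [|i IHi]; first by rewrite big_geq ?muln0.
rewrite big_nat_recr //= mulnDr addnAC IHi -{1}[(b ^ i.+1)%N]mul1n -mulnDl.
by rewrite add1n prednK // -expnS.
Qed.

(** Decay at rate q^-i is enough for nested sums: inner sums are then bounded uniformly in the outer
    index, while the increments of the outer sum tend to 0. *)
Definition decaying (x : nat -> fps C) : Prop :=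
  (forall i, in_Ttheta (x i)) /\
  exists2 K, 0 <= K & forall i, gauss_le (K * (q%:R ^+ i)^-1) (x i).

(* |w| <= q^delta with (q - 1) delta + k <= n q; for k = 1 this is the region
   |w| < q^(n q / (q - 1)) for absolute values in q^Z. *)
Definition weight_le (k : nat) (p : nat * C) : Prop :=
  exists2 delta, cabs p.2 <= q%:R ^+ delta & (q.-1 * delta + k <= p.1 * q)%N.

Lemma weight_leW k l p : (k <= l)%N -> weight_le l p -> weight_le k p.
Proof.
move=> kl [d dw dn]; exists d => //; apply: leq_trans dn; by rewrite leq_add2l.
Qed.

(** Exponents, logarithmic bounds and margins all add up, so a nonempty block retains a margin of at
    least 1. *)
Lemma weight_le_prod (I : eqType) (l : seq I) (h : I -> nat * C) :
  {in l, forall k, weight_le 1 (h k)} ->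
  weight_le (size l) ((\sum_(k <- l) (h k).1)%N, \prod_(k <- l) (h k).2).
Proof.
elim: l => [|k l IHl] hl.
  by exists 0%N; rewrite /= ?big_nil ?expr0 ?cabs1 ?muln0.
have [k' kl|d /= dw dn] := IHl; first by apply: hl; rewrite inE kl orbT.
have [d' d'w d'n] := hl k (mem_head _ _).
exists (d' + d)%N; rewrite /= big_cons.
  by rewrite cabsM exprD ler_pM ?cabs_ge0.
by rewrite mulnDl mulnDr -add1n addnACA leq_add.
Qed.

Lemma xterm_inT p i : in_Ttheta (xterm p i).
Proof. by have [_ gT _] := ps_inv_LL C i p.1; apply: inT_M => //; exact: inT_poly. Qed.

(** With n = p.1, the exponent of q in the bound for the i-th term, multiplied by q - 1, is at most
    n q - q^i by [LLdegE] and the weight bound. The Bernoulli-type inequality (q - 1) i < q^i then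
    gives an exponent at most n q - i. *)
Lemma decaying_xterm p : weight_le 1 p -> decaying (xterm p).
Proof.
case=> d dw dn; have q0 := qR_gt0 R F; split=> [i|]; first exact: xterm_inT.
exists (q%:R ^+ (p.1 * q)); first by rewrite exprn_ge0 // ltW.
move=> i; have [_ _ gM] := ps_inv_LL C i p.1.
have := gauss_leM (gauss_leC (frob i p.2)) gM; apply: gauss_le_trans.
rewrite cabs_frob.
apply: le_trans (_ : (q%:R ^+ d) ^+ (q ^ i) / q%:R ^+ (p.1 * LLdeg F i) <= _).
  rewrite ler_wpM2r ?invr_ge0 ?exprn_ge0 ?(ltW q0) //.
  by rewrite lerXn2r ?nnegrE ?cabs_ge0 ?exprn_ge0 ?(ltW q0).
rewrite ler_pdivrMr ?exprn_gt0 // mulrAC ler_pdivlMr ?exprn_gt0 //.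
rewrite -exprM -!exprD ler_weXn2l ?(ltW (qR_gt1 R F)) //.
have bern : (q.-1 * i < q ^ i)%N.
  have := q_gt0 F; move: (q) => b b0; elim: i {gM} => [|j IHj]; rewrite ?muln0 //.
  have bj : (b.-1 <= b.-1 * b ^ j)%N by rewrite leq_pmulr // expn_gt0 b0.
  have -> : (b ^ j.+1 = b ^ j + b.-1 * b ^ j)%N by rewrite -mulSn prednK // expnS.
  rewrite mulnS; move: bj IHj; move: (b ^ j)%N (b.-1 * b ^ j)%N (b.-1 * j)%N.
  by move: (b.-1) => r n m' m; lia.
have q1 : (0 < q.-1)%N by rewrite -subn1 subn_gt0 q_gt1.
rewrite -(leq_pmul2l q1); have LE := LLdegE i; rewrite expnS in LE.
move: (LLdeg F i) (q ^ i)%N (p.1) (q.-1) (q) LE bern dn => M Q n r b LE bern dn.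
nia.
Qed.

Lemma decaying_le x : decaying x -> exists2 K, 0 <= K & forall i, gauss_le K (x i).
Proof.
case=> _ [K K0 xK]; exists K => // i; apply: gauss_le_trans (xK i).
rewrite ler_piMr // invf_le1 ?exprn_gt0 ?qR_gt0 //.
by rewrite exprn_ege1 // ltW ?qR_gt1.
Qed.

Section NestedLimits.
Variables (I : eqType) (h : I -> nat -> fps C).
Implicit Types l : seq I.

Lemma nsum_inT d N l : {in l, forall k i, in_Ttheta (h k i)} ->
  in_Ttheta (nsum d N [seq h k | k <- l]).
Proof.
elim: l N => [|k l IHl] N hl; first exact: inT_1.
apply: inT_sum => i _; apply: inT_M; first exact/hl/mem_head.
by apply: IHl => k' kl; apply: hl; rewrite inE kl orbT.
Qed.

Lemma nsum_bounded d l : {in l, forall k, decaying (h k)} ->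
  exists2 K, 0 <= K & forall N, gauss_le K (nsum d N [seq h k | k <- l]).
Proof.
elim: l => [|k l IHl] hl; first by exists 1 => // N; exact: gauss_le1.
have [k' kl|K K0 lK] := IHl; first by apply: hl; rewrite inE kl orbT.
have [K' K'0 kK'] := decaying_le (hl k (mem_head _ _)).
exists (K' * K) => [|N]; first exact: mulr_ge0.
apply: gauss_le_sum => [|i _]; first exact: mulr_ge0.
exact: gauss_leM.
Qed.

Lemma nsum_cvg d l : {in l, forall k, decaying (h k)} ->
  exists f, cvgT (fun N => nsum d N [seq h k | k <- l]) f.
Proof.
case: l => [|k l] hl; first by exists (1 : fps C); exact: (cvgT_cst (@inT_1 _ _ C)).
have hl' : {in l, forall k, decaying (h k)}.
  by move=> k' kl; apply: hl; rewrite inE kl orbT.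
have [K K0 lK] := nsum_bounded d hl'.
have [_ [K' K'0 kK']] := hl k (mem_head _ _).
apply: (@cvgT_steps _ _ _ _ (fun N => (K' * K) * (q%:R ^+ N)^-1)) => [N||N].
- by apply: nsum_inT => k' /hl[].
- by apply: vanishingM; [exact: mulr_ge0 | exact: vanishing_expV (q_gt1 F)].
rewrite [map _ _]/= nsumS addrAC subrr add0r mulrAC.
exact: gauss_leM.
Qed.

End NestedLimits.

Definition Li_terms (n : seq nat) (w : seq C) : seq (nat -> fps C) :=
  [seq xterm p | p <- zip n w].

Lemma Li_star_cvg n w : size w = size n -> {in zip n w, forall p, weight_le 1 p} ->
  cvgT (fun N => nsum 1 N (Li_terms n w)) (Li_star n w).
Proof.
move=> wn hw.
have [|f ff] := @nsum_cvg _ xterm 1 (zip n w); first by move=> p /hw; exact: decaying_xterm.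
suff -> : Li_star n w = f by [].
rewrite -(limT_eq ff) /Li_star; congr (limT _); apply/funext => N; apply/funext => m.
rewrite -(@nsum_weak_ffun _ N (size n)) ?size_map ?size_zip ?wn ?minnn //.
rewrite fps_sum; apply: eq_bigr => i _.
apply: (congr1 (fun g : fps C => g m)); apply: (@eq_bigr (fps C) 1 *%R) => a _.
by rewrite (nth_map (0%N, 0)) ?nth_zip // size_zip wn minnn.
Qed.

Definition AT_term (s' i : nat) : fps C :=
  fps_poly (AT_Htwist C s'.-1 i) * ps_inv (ps_of_poly (LL C i ^+ s')).

Lemma zeta_ATE s :
  zeta_AT C s = limT (fun N => nsum 0 N [seq AT_term s' | s' <- s]).
Proof.
congr (limT _); apply/funext => N; apply/funext => m.
rewrite -(@nsum_strict_ffun _ N (size s)) ?size_map //.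
rewrite fps_sum; apply: eq_bigr => i _.
apply: (congr1 (fun g : fps C => g m)); apply: (@eq_bigr (fps C) 1 *%R) => a _.
by rewrite (nth_map 0%N).
Qed.

Definition AT_deg (s' : nat) : nat := (size (AT_H F s'.-1)).-1.

Definition AT_coef_term (p : nat * nat) : nat * C :=
  (p.1, ofA C (AT_H F p.1.-1)`_p.2).

Lemma AT_term_sum s' i : AT_term s' i =
  \sum_(0 <= j < (AT_deg s').+1) fps_poly 'X^j * xterm (AT_coef_term (s', j)) i.
Proof.
rewrite /AT_term /xterm /=; under eq_bigr do rewrite mulrA.
rewrite -mulr_suml; congr (_ * _); under eq_bigr do rewrite -rmorphM.
rewrite -rmorph_sum; congr fps_poly.
apply/polyP => k; rewrite coef_sum /AT_Htwist !coef_map /=.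
have XC j (c : C) : ('X^j * c%:P)`_k = if j == k then c else 0.
  by rewrite mulrC coefCM coefXn eq_sym; case: eqP => _; rewrite ?mulr1 ?mulr0.
under eq_bigr do rewrite XC.
rewrite -big_mkcond /= big_nat1_eq /=; case: ltnP => // dk.
rewrite nth_default ?rmorph0 ?rmorph0 //.
by move: dk; rewrite /AT_deg; case: (size _).
Qed.

(** The index set as an explicit duplicate-free list, of which any [triple_enum] is a
    permutation. *)
Definition triples (s : seq nat) : seq (seq nat * seq nat) :=
  [seq (js, c) | js <- boxes [seq AT_deg s' | s' <- s], c <- comps (size s)].

Lemma mem_triples s y : y \in triples s <-> triple_index F s y.
Proof.
case: y => js c; split=> [/allpairsP[[js' c'] /= [/mem_boxes[sjs js_le]]]|].
  rewrite mem_comps => /andP[c0 /eqP cn] [-> ->]; split=> //=.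
    by rewrite sjs size_map.
  move=> i si; have := js_le i; rewrite size_map (nth_map 0%N) //; exact.
case=> /= sjs js_le c0 cn; apply/allpairsP; exists (js, c); split=> //=.
  apply/mem_boxes; rewrite size_map; split=> // i si.
  by rewrite (nth_map 0%N) //; exact: js_le.
by rewrite mem_comps c0 cn eqxx.
Qed.

Lemma triples_uniq s : uniq (triples s).
Proof.
by rewrite allpairs_uniq ?boxes_uniq ?comps_uniq // => -[? ?] [? ?] _ _ [-> ->].
Qed.

Lemma sum_triple_enum (V : nmodType) s (s1 m : nat)
    (x : 'I_(s1 + m) -> seq nat * seq nat) (G : seq nat * seq nat -> V) :
  triple_enum F s x -> \sum_(l < s1 + m) G (x l) = \sum_(y <- triples s) G y.
Proof.
case=> x_inj x_im _.
rewrite -(big_map x predT G); apply: perm_big; apply: uniq_perm.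
- by rewrite map_inj_uniq // index_enum_uniq.
- exact: triples_uniq.
move=> y; apply/mapP/idP => [[l _ ->]|/mem_triples/x_im[l <-]].
  by apply/mem_triples/x_im; exists l.
by exists l; rewrite ?mem_index_enum.
Qed.

Definition triple_terms s y : seq (nat -> fps C) :=
  Li_terms (triple_s s y) [seq ofA C a | a <- triple_u F s y].

Definition triple_pair s (js : seq nat) (B : seq nat) : nat * C :=
  ((\sum_(k <- B) (AT_coef_term (nth 0 s k, nth 0 js k)).1)%N,
   \prod_(k <- B) (AT_coef_term (nth 0%N s k, nth 0%N js k)).2).

Lemma zip_triple s js c :
  zip (triple_s s (js, c)) [seq ofA C a | a <- triple_u F s (js, c)] =
  [seq triple_pair s js B | B <- reshape c (iota 0 (size s))].
Proof.
have sE : s = map (nth 0%N s) (iota 0 (size s)) by rewrite map_nth_iota0 ?take_size.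
rewrite /triple_s /triple_u {1}sE -map_reshape -!map_comp zip_map.
apply: eq_map => B /=; congr pair; first by rewrite sumnE big_map.
by rewrite rmorph_prod; apply: eq_bigr => k _.
Qed.

Lemma merge_triple s js c : size js = size s ->
  merge_blocks c [seq xterm (AT_coef_term p) | p <- zip s js] =
  triple_terms s (js, c).
Proof.
move=> sjs; rewrite /triple_terms /Li_terms zip_triple -map_comp.
have -> : zip s js = [seq (nth 0%N s k, nth 0%N js k) | k <- iota 0 (size s)].
  rewrite -zip_map map_nth_iota0 ?take_size //.
  by rewrite -sjs map_nth_iota0 ?take_size.
rewrite /merge_blocks -map_comp -map_reshape -map_comp.
apply: eq_map => B /=; apply/funext => i; rewrite big_map.
by rewrite -xterm_prod.
Qed.

Lemma nsum_AT N s : nsum 0 N [seq AT_term s' | s' <- s] =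
  \sum_(y <- triples s) fps_poly 'X^(sumn y.1) *
    ((-1) ^+ (size s + size y.2) * nsum 1 N (triple_terms s y)).
Proof.
pose G s' j i : fps C := fps_poly 'X^j * xterm (AT_coef_term (s', j)) i.
have -> : [seq AT_term s' | s' <- s] =
    [seq (fun i => \sum_(0 <= j < p.2.+1) p.1 j i) |
      p <- zip [seq G s' | s' <- s] [seq AT_deg s' | s' <- s]].
  by rewrite zip_map -map_comp; apply: eq_map => s'; apply/funext => i;
    exact: AT_term_sum.
rewrite nsum_multilinear ?size_map // /triples big_allpairs_dep /=.
rewrite [LHS]big_seq [RHS]big_seq; apply: eq_bigr => js /mem_boxes[].
rewrite size_map => sjs _.
have -> : [seq p.1 p.2 | p <- zip [seq G s' | s' <- s] js] =
    [seq (fun i => fps_poly 'X^(p.2) * xterm (AT_coef_term p) i) | p <- zip s js].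
  by elim: s js {sjs} => [|s' s IHs] [|j js] //=; rewrite IHs.
rewrite nsum_scale.
have -> : \prod_(p <- zip s js) fps_poly ('X^(p.2) : {poly C}) = fps_poly 'X^(sumn js).
  elim: s js sjs => [|s' s IHs] [|j js] //=.
    by move=> _; rewrite big_nil expr0 rmorph1.
  by move=> [sjs]; rewrite big_cons IHs //= exprD rmorphM.
have sz : size [seq xterm (AT_coef_term p) | p <- zip s js] = size s.
  by rewrite size_map size_zip sjs minnn.
rewrite nsum_strict_weak sz mulr_sumr; apply: eq_bigr => c _.
by rewrite merge_triple.
Qed.

Section Positive.
Variable s : seq nat.
Hypothesis s_gt0 : all (ltn 0%N) s.

Lemma weight_AT_coef k j : (k < size s)%N ->
  weight_le 1 (AT_coef_term (nth 0%N s k, j)).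
Proof.
move=> ks; have sk : (0 < nth 0%N s k)%N by apply: (all_nthP 0%N s_gt0).
exists (size ((AT_H F (nth 0%N s k).-1)`_j)%R).-1; first exact: cabs_ofA_le.
have := AT_H_deg F (nth 0%N s k).-1 j; rewrite /=; have := q_gt0 F.
move: sk; move: (nth 0%N s k) (q.-1 * _)%N => n a n0; move: (q) => b b0 ab.
by rewrite -(prednK n0) mulSn addnC leq_add.
Qed.

Lemma weight_triple y p : y \in triples s ->
  p \in zip (triple_s s y) [seq ofA C a | a <- triple_u F s y] -> weight_le 1 p.
Proof.
move=> /mem_triples; case: y => js c [/= sjs js_le c0 cn].
rewrite zip_triple => /mapP[B BR ->].
have B0 : (0 < size B)%N.
  have : size B \in c.
    rewrite -[c](@reshapeKl _ c (iota 0 (size s))) ?size_iota ?cn //.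
    exact: map_f.
  by move=> /(allP c0).
apply: (weight_leW B0); apply: weight_le_prod => k kB; apply: weight_AT_coef.
have : k \in flatten (reshape c (iota 0 (size s))) by apply/flattenP; exists B.
by rewrite reshapeKr ?size_iota ?cn // mem_iota.
Qed.

Lemma size_triple_u y : size [seq ofA C a | a <- triple_u F s y] = size (triple_s s y).
Proof. by rewrite !size_map !size_reshape. Qed.

Lemma triple_Li_star_cvg y : y \in triples s ->
  cvgT (fun N => nsum 1 N (triple_terms s y))
       (Li_star (triple_s s y) [seq ofA C a | a <- triple_u F s y]).
Proof.
move=> ys; apply: Li_star_cvg => [|p]; [exact: size_triple_u | exact: weight_triple].
Qed.

Lemma zeta_AT_cvg : cvgT (fun N => nsum 0 N [seq AT_term s' | s' <- s])
  (\sum_(y <- triples s) fps_poly 'X^(sumn y.1) *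
    ((-1) ^+ (size s + size y.2) *
     (Li_star (triple_s s y) [seq ofA C a | a <- triple_u F s y] : fps C))).
Proof.
under eq_fun do rewrite nsum_AT.
rewrite [X in cvgT _ X]big_seq; under eq_fun do rewrite big_seq.
apply: cvgT_sum => y ys; apply: cvgTM; first exact: inT_poly.
apply: cvgTM; first by apply: inT_X; apply: inT_N; exact: inT_1.
exact: triple_Li_star_cvg.
Qed.

Lemma zeta_AT_triples : zeta_AT C s =
  \sum_(y <- triples s) fps_poly 'X^(sumn y.1) *
    ((-1) ^+ (size s + size y.2) *
     (Li_star (triple_s s y) [seq ofA C a | a <- triple_u F s y] : fps C)).
Proof. by rewrite zeta_ATE (limT_eq zeta_AT_cvg). Qed.

End Positive.

End StarSeries.

(** * Ultrametric matrix bounds, Sylvester equations and additive series *)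

Section MatrixBounds.
Variables (R : realType) (F : finFieldType) (C : Cinfty R F).
Local Notation q := #|F|.
Local Notation theta := (theta C).

Definition mx_le (K : R) m n (A : 'M[C]_(m, n)) : Prop := forall i j, cabs (A i j) <= K.

(** K is the largest absolute value of an entry; the disjunction accommodates matrices without
    entries, where K = 0 is not attained. *)
Lemma mx_le_max m n (A : 'M[C]_(m, n)) : exists2 K, 0 <= K /\ mx_le K A &
  forall L, (0 <= L) -> (K <= L) \/ exists i j, cabs (A i j) = K.
Proof.
have [p0 _|p0] := pickP (xpredT : pred ('I_m * 'I_n)).
  case: (@arg_maxP _ R _ p0 xpredT (fun p => cabs (A p.1 p.2))) => //.
  move=> p _ pmax; exists (cabs (A p.1 p.2)) => [|L _]; last by right; exists p.1, p.2.
  by split=> [|i j]; [exact: cabs_ge0 | exact: (pmax (i, j))].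
exists 0 => [|L L0]; last by left.
by split=> // i j; have := p0 (i, j).
Qed.

Lemma mx_leM K L m n p (A : 'M[C]_(m, n)) (B : 'M[C]_(n, p)) : 0 <= K -> 0 <= L ->
  mx_le K A -> mx_le L B -> mx_le (K * L) (A *m B).
Proof.
move=> K0 L0 AK BL i j; rewrite mxE; apply: cabs_sum_le => [|k _]; first exact: mulr_ge0.
by rewrite cabsM ler_pM ?cabs_ge0.
Qed.

(** Let M be the largest entry of X. Isolating lam X gives |lam| M <= max(K, M), and |lam| > 1
    excludes the maximum M unless M = 0. *)
Lemma sylvester_bound d lam (N X : 'M[C]_d) K : 1 < cabs lam -> mx_le 1 N -> 0 <= K ->
  mx_le K (lam *: X + X *m N - N *m X) -> mx_le (K / cabs lam) X.
Proof.
move=> lam1 N1 K0 XK; have lam0 : 0 < cabs lam := lt_trans ltr01 lam1.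
have [M [M0 XM] Mmax] := mx_le_max X.
have h i j : cabs lam * cabs (X i j) <= Num.max K M.
  have -> : cabs lam * cabs (X i j) =
      cabs ((lam *: X + X *m N - N *m X) i j - (X *m N) i j + (N *m X) i j).
    by rewrite -cabsM; congr cabs; rewrite !mxE; ring.
  have XN : cabs ((X *m N) i j) <= Num.max K M.
    by rewrite le_max -[M]mulr1 (mx_leM M0 ler01) // orbT.
  have NX : cabs ((N *m X) i j) <= Num.max K M.
    by rewrite le_max -[M]mul1r (mx_leM ler01 M0) // orbT.
  apply: cabsD_le => //; apply: cabsB_le => //.
  by rewrite le_max XK.
move=> i j; rewrite ler_pdivlMr // mulrC.
have [M'|[i' [j' Mij]]] := Mmax _ (divr_ge0 K0 (cabs_ge0 lam)).
  rewrite mulrC -ler_pdivlMr //; exact: le_trans (XM i j) M'.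
have := h i' j'; rewrite Mij le_max => /orP[MK|].
  by apply: le_trans MK; rewrite ler_pM2l.
rewrite -{2}[M]mul1r => MM.
have M00 : M <= 0.
  by rewrite leNgt; apply/negP => M0'; move: MM; rewrite ler_pM2r // leNgt lam1.
have -> : cabs (X i j) = 0 by apply/eqP; rewrite eq_le cabs_ge0 andbT (le_trans (XM i j)).
by rewrite mulr0.
Qed.

Definition sylvester d (lam : C) (N X : 'M[C]_d) : 'M[C]_d :=
  lam *: X + X *m N - N *m X.

Lemma sylvester_is_linear d lam (N : 'M[C]_d) : linear (sylvester lam N).
Proof.
move=> a X Y; rewrite /sylvester mulmxDl mulmxDr !scalerDr scalerN -!scalemxAl.
rewrite -!scalemxAr !scalerA [lam * a]mulrC opprD !addrA.
apply/matrixP => i j; rewrite !mxE; ring.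
Qed.

HB.instance Definition _ d lam (N : 'M[C]_d) :=
  GRing.isLinear.Build C 'M[C]_d 'M[C]_d _ (sylvester lam N)
    (sylvester_is_linear lam N).

(** The bound with K = 0 says that the operator is injective; on a finite-dimensional space it is
    then bijective. *)
Lemma sylvester_solve d lam (N B : 'M[C]_d) : 1 < cabs lam -> mx_le 1 N ->
  exists X, sylvester lam N X = B.
Proof.
move=> lam1 N1; pose M := lin_mx (sylvester lam N).
have Munit : M \in unitmx.
  rewrite -row_free_unit; apply: inj_row_free => v; rewrite -[v]vec_mxK mul_vec_lin.
  move=> /(canRL mxvecK) vN.
  suff -> : vec_mx v = 0 by rewrite linear0.
  have h : mx_le 0 (sylvester lam N (vec_mx v)).
    by move: vN; rewrite linear0 => -> i j; rewrite mxE cabs0.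
  apply/matrixP => i j; rewrite [RHS]mxE; apply: cabs_eq0; apply/eqP.
  rewrite eq_le cabs_ge0 andbT.
  by have := sylvester_bound lam1 N1 (lexx 0) h i j; rewrite mul0r.
exists (vec_mx (mxvec B *m invmx M)); apply: (can_inj mxvecK).
by rewrite -mul_vec_lin vec_mxK -mulmxA mulVmx // mulmx1.
Qed.

(* Near 0 the lowest nonzero term would dominate. *)
Lemma additive_series_eq0 (a : nat -> C) :
  (forall x, cvgC (fun N => \sum_(i < N) a i * frob i x) 0) -> forall i, a i = 0.
Proof.
move=> a0.
(* At x = 1 consecutive partial sums differ by a_i, so convergence there bounds the coefficients. *)
have [M M0 aM] : exists2 M, 0 <= M & forall i, cabs (a i) <= M.
  have /cvgCP v := a0 1; have [N NP] := v 1 ltr01.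
  have big i : (N <= i)%N -> cabs (a i) <= 1.
    move=> Ni; have := cabsB_le (ltW (NP i.+1 (leqW Ni))) (ltW (NP i Ni)).
    by rewrite !subr0 big_ord_recr /= rmorph1 mulr1 addrAC subrr add0r.
  exists (Num.max 1 (\big[Num.max/0]_(i < N) cabs (a i))); first by rewrite le_max ler01.
  move=> i; rewrite le_max; have [/big->//|iN] := leqP N i.
  by rewrite (le_bigmax _ (fun i : 'I_N => cabs (a i)) (Ordinal iN)) orbT.
elim/ltn_ind => i IHi; apply: cabs_eq0; apply/eqP; rewrite eq_le cabs_ge0 andbT.
apply: (@vanishing_le0 _ _ (fun t => M * (q%:R ^+ t)^-1)).
  by apply: vanishingM => //; exact: vanishing_expV (q_gt1 F).
(* At x = theta^-t the terms after the i-th are at most M |x|^(q^(i+1)). Dividing by |x|^(q^i)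
   leaves |a_i| <= M |x|, and |x| = q^-t tends to 0. *)
move=> t; pose x : C := (theta ^+ t)^-1.
have qt0 : 0 < (q%:R : R) ^+ t by rewrite exprn_gt0 // qR_gt0.
have x1 : cabs x <= 1.
  by rewrite cabsV cabsX cabs_theta invf_le1 // exprn_ege1 // ltW // qR_gt1.
have x0 : 0 < cabs x by rewrite cabsV cabsX cabs_theta invr_gt0.
have le_x : cabs (0 - a i * frob i x) <= M * cabs x ^+ (q ^ i.+1).
  apply: cvgC_le (a0 x) _; exists i.+1 => N iN.
  rewrite -(big_mkord xpredT (fun i => a i * frob i x)) (big_cat_nat (n := i)) //=.
    rewrite big_nat big1 ?add0r => [|k /andP[_ ki]]; last by rewrite IHi // mul0r.
    rewrite big_ltn // addrAC subrr add0r big_nat; apply: cabs_sum_le.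
      by rewrite mulr_ge0 // exprn_ge0 // cabs_ge0.
    move=> k /andP[ik _]; rewrite cabsM cabs_frob ler_pM ?exprn_ge0 ?cabs_ge0 //.
    by apply: ler_wiXn2l => //; rewrite ?cabs_ge0 // leq_pexp2l ?q_gt0.
  exact: ltnW.
move: le_x; rewrite sub0r cabsN cabsM cabs_frob => h.
have xq0 : 0 < cabs x ^+ (q ^ i) by rewrite exprn_gt0.
have -> : (q%:R ^+ t)^-1 = cabs x by rewrite cabsV cabsX cabs_theta.
rewrite -(ler_pM2r xq0); apply: le_trans h _; rewrite -mulrA; apply: ler_wpM2l => //.
rewrite -exprS; apply: ler_wiXn2l => //; first exact: cabs_ge0.
by rewrite expnS -[ltnLHS]mul1n ltn_mul2r expn_gt0 q_gt0 q_gt1.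
Qed.

End MatrixBounds.

(** * Twisted power series with matrix coefficients *)

Section TwistedSeries.
Variables (R : realType) (F : finFieldType) (C : Cinfty R F) (d : nat).
Local Notation q := #|F|.
Implicit Types (f g h : nat -> 'M[C]_d) (z y : 'cV[C]_d).

Lemma twmxD e n (A B : 'M[C]_(d, e)) : twmx n (A + B) = twmx n A + twmx n B.
Proof. exact: map_mxD. Qed.

Lemma twmxM e k n (A : 'M[C]_(d, e)) (B : 'M[C]_(e, k)) :
  twmx n (A *m B) = twmx n A *m map_mx (frob n) B.
Proof. exact: map_mxM. Qed.

Lemma twmx0 e n : twmx n (0 : 'M[C]_(d, e)) = 0. Proof. exact: map_mx0. Qed.

Lemma twmx1 n : twmx n (1%:M : 'M[C]_d) = 1%:M. Proof. exact: map_mx1. Qed.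

Lemma twmx_id e (A : 'M[C]_(d, e)) : twmx 0 A = A.
Proof. by apply/matrixP => i j; rewrite mxE frob0. Qed.

Lemma twmx_twmx e m n (A : 'M[C]_(d, e)) : twmx m (twmx n A) = twmx (m + n) A.
Proof. by apply/matrixP => i j; rewrite !mxE frobD. Qed.

Lemma twmx_sum e n (I : Type) (r : seq I) (P : pred I) (A : I -> 'M[C]_(d, e)) :
  twmx n (\sum_(i <- r | P i) A i) = \sum_(i <- r | P i) twmx n (A i).
Proof. by apply: (big_morph (twmx n)); [exact: twmxD | exact: twmx0]. Qed.

Lemma tw_mulA f g h : tw_mul f (tw_mul g h) = tw_mul (tw_mul f g) h.
Proof.
apply/funext => n; rewrite /tw_mul.
transitivity (\sum_(i < n.+1) \sum_(j < (n - i).+1)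
    f i *m twmx i (g j) *m twmx (i + j) (h (n - i - j)%N)).
  apply: eq_bigr => i _; rewrite twmx_sum mulmx_sumr; apply: eq_bigr => j _.
  by rewrite twmxM -/(twmx i (twmx j _)) twmx_twmx mulmxA.
rewrite (triangular_exchange n (fun i j k => f i *m twmx i (g j) *m twmx (i + j) (h k))).
apply: eq_bigr => k _; rewrite mulmx_suml; apply: eq_bigr => i _.
by rewrite subnKC // -ltnS.
Qed.

Lemma tw_mul1l f : tw_mul (@tw_one _ _ C d) f = f.
Proof.
apply/funext => n; rewrite /tw_mul big_ord_recl /tw_one /= mul1mx subn0 twmx_id.
by rewrite big1 ?addr0 // => i _; rewrite mul0mx.
Qed.

Lemma tw_mul1r f : tw_mul f (@tw_one _ _ C d) = f.
Proof.
apply/funext => n; rewrite /tw_mul big_ord_recr /= subnn /tw_one /= twmx1 mulmx1.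
rewrite big1 ?add0r // => i _; rewrite subn_eq0 leqNgt ltn_ord /=.
by rewrite twmx0 mulmx0.
Qed.

(** A right and a left inverse come from separate recursions, each solved for its top coefficient;
    associativity identifies them. *)
Lemma tw_inverse f : f 0%N = 1%:M ->
  exists g, tw_mul f g = @tw_one _ _ C d /\ tw_mul g f = @tw_one _ _ C d.
Proof.
move=> f0.
have [|g gE] := @strong_recursion _ (0 : 'M[C]_d) (fun n g => @tw_one _ _ C d n -
    \sum_(i < n) f i.+1 *m twmx i.+1 (g (n - i.+1)%N)).
  move=> n g g' gg'; congr (_ - _); apply: eq_bigr => i _; rewrite gg' //.
  by rewrite ltn_subrL /= (leq_ltn_trans _ (ltn_ord i)).
have [|g' g'E] := @strong_recursion _ (0 : 'M[C]_d) (fun n g => @tw_one _ _ C d n -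
    \sum_(i < n) g i *m twmx i (f (n - i)%N)).
  by move=> n h h' hh'; congr (_ - _); apply: eq_bigr => i _; rewrite hh'.
have fg : tw_mul f g = @tw_one _ _ C d.
  apply/funext => n; rewrite /tw_mul big_ord_recl f0 mul1mx subn0 twmx_id /=.
  by rewrite gE subrK.
have g'f : tw_mul g' f = @tw_one _ _ C d.
  apply/funext => n; rewrite /tw_mul big_ord_recr /= subnn f0 twmx1 mulmx1.
  by rewrite [X in _ + X]g'E addrC subrK.
exists g; split=> //; suff -> : g = g' by [].
by rewrite -[LHS]tw_mul1l -g'f -tw_mulA fg tw_mul1r.
Qed.

Lemma cvgV_unique (u : nat -> 'cV[C]_d) y z : cvgV u y -> cvgV u z -> y = z.
Proof.
move=> uy uz; apply/matrixP => i j; rewrite (ord1 j); exact: cvgC_unique (uy i) (uz i).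
Qed.

Lemma tw_eval_eq f z y : cvgV (tw_psum f z) y -> tw_eval f z = y.
Proof.
move=> fy; rewrite /tw_eval; case: xgetP => [y' _ fy'|/(_ y)] //.
exact: cvgV_unique fy' fy.
Qed.

Lemma cvgVD (u v : nat -> 'cV[C]_d) y z : cvgV u y -> cvgV v z ->
  cvgV (fun n => u n + v n) (y + z).
Proof.
by move=> uy vz i; rewrite mxE; under eq_fun do rewrite mxE; exact: cvgCD.
Qed.

Lemma cvgVM (A : 'M[C]_d) (u : nat -> 'cV[C]_d) y : cvgV u y ->
  cvgV (fun n => A *m u n) (A *m y).
Proof.
move=> uy i; rewrite mxE; under eq_fun do rewrite mxE.
by apply: cvgC_sum => j _; exact: cvgCZ.
Qed.

Lemma cvgV_tw m (u : nat -> 'cV[C]_d) y : cvgV u y ->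
  cvgV (fun n => twmx m (u n)) (twmx m y).
Proof.
by move=> uy i; rewrite mxE; under eq_fun do rewrite mxE; exact: cvgC_frob.
Qed.

Lemma cvgV_shift k (u : nat -> 'cV[C]_d) y :
  cvgV (fun n => u (n + k)%N) y <-> cvgV u y.
Proof.
by split=> uy i; [apply/(cvgC_shift (fun n => u n i 0) _ k) |
  apply/(cvgC_shift (fun n => u n i 0) _ k)]; exact: uy.
Qed.

End TwistedSeries.

(** * Existence of Exp and the recursion for the coefficients of Log *)

Section ExponentialLogarithm.
Variables (R : realType) (F : finFieldType) (C : Cinfty R F).
Variables (n : seq nat) (w : seq C).
Local Notation q := #|F|.
Local Notation theta := (theta C).
Local Notation d := (tdim n).
Local Notation N := (tmN C n).
Local Notation E := (tmE n w).
Implicit Types (c : nat -> 'M[C]_d) (z y : 'cV[C]_d).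

(** In global coordinates an entry of N becomes a sum of products of 0/1 indicators, from which both
    |N_ab| <= 1 and the invariance under Frobenius can be read off. *)
Lemma tmN_entry a b : N a b = \sum_(j < bdim n (tagnat.sig1 a))
  (j == (tagnat.sig2 a).+1 :> nat)%:R * (tagnat.Rank (tagnat.sig1 a) j == b)%:R.
Proof.
have -> : N a b = (N *m delta_mx b 0) a (0 : 'I_1).
  rewrite [RHS]mxE (bigD1 b) //= [delta_mx _ _ _ _]mxE !eqxx mulr1 big1 ?addr0 // => j jb.
  by rewrite [delta_mx _ _ _ _]mxE (negbTE jb) mulr0.
rewrite -[delta_mx b 0]submxcolK mul_mxdiag_mxcol !mxE.
by apply: eq_bigr => j _; rewrite !mxE andbT.
Qed.

Lemma tmN_le1 : mx_le 1 N.
Proof.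
move=> a b; rewrite tmN_entry; apply: cabs_sum_le => // j _.
by rewrite -natrM cabs_natr_le1.
Qed.

Lemma twmx_tmN i : twmx i N = N.
Proof.
apply/matrixP => a b; rewrite mxE tmN_entry rmorph_sum; apply: eq_bigr => j _.
by rewrite -natrM rmorph_nat.
Qed.

Definition tw_cst (A : 'M[C]_d) : nat -> 'M[C]_d := fun i => if i == 0%N then A else 0.

Lemma drhoX : drho n w 'X = theta%:M + N.
Proof.
rewrite /drho /rho size_polyX big_ord_recr big_ord1 /= !coefX /= rmorph0 scale0r.
by rewrite add0r rmorph1 scale1r tw_mul1r.
Qed.

Lemma rhoX : rho n w 'X = rho_t n w.
Proof.
apply/funext => i; rewrite /rho size_polyX big_ord_recr big_ord1 /= !coefX /=.
by rewrite rmorph0 scale0r add0r rmorph1 scale1r tw_mul1r.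
Qed.

Lemma twmx_A i : twmx i (theta%:M + N) = (theta ^+ (q ^ i))%:M + N.
Proof.
by rewrite twmxD twmx_tmN; congr (_ + _); rewrite /twmx map_scalar_mx.
Qed.

Lemma rho_t_eval y : tw_eval (rho_t n w) y = (theta%:M + N) *m y + E *m twmx 1 y.
Proof.
apply: tw_eval_eq => i; apply/(cvgC_shift _ _ 2) => /=.
have -> : (fun k => tw_psum (rho_t n w) y (k + 2) i 0) =
    (fun=> ((theta%:M + N) *m y + E *m twmx 1 y) i 0).
  apply/funext => k; congr (fun_of_matrix _ _ _).
  rewrite /tw_psum addn2 big_ord_recl big_ord_recl /= twmx_id big1 ?addr0 //.
  by move=> j _; rewrite /rho_t /= mul0mx.
exact: cvgC_cst.
Qed.

(** The coefficient of tau^i in c drho(t) - rho(t) c; it vanishes for all i exactly when c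
    intertwines the two actions of t. *)
Definition defect c (i : nat) : 'M[C]_d :=
  c i *m twmx i (theta%:M + N) - (theta%:M + N) *m c i -
  (if i is i'.+1 then E *m twmx 1 (c i') else 0).

Lemma defect0 c : c 0%N = 1%:M -> defect c 0 = 0.
Proof. by move=> c0; rewrite /defect c0 twmx_id mul1mx mulmx1 subrr subr0. Qed.

Lemma defectS c i : defect c i.+1 =
  sylvester (theta ^+ (q ^ i.+1) - theta) N (c i.+1) - E *m twmx 1 (c i).
Proof.
rewrite /defect twmx_A mulmxDr mulmxDl mul_mx_scalar mul_scalar_mx /sylvester.
congr (_ - _); rewrite scalerBl opprD !addrA; congr (_ - _).
by rewrite addrAC.
Qed.

(** On partial sums the functional equation fails by the defects alone. The term E tau raises the
    degree in tau, hence the shorter partial sum behind E. *)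
Lemma psum_defect c z k : tw_psum c ((theta%:M + N) *m z) k.+1 =
  (theta%:M + N) *m tw_psum c z k.+1 + E *m twmx 1 (tw_psum c z k) +
  \sum_(i < k.+1) defect c i *m twmx i z.
Proof.
rewrite /tw_psum.
have -> : E *m twmx 1 (\sum_(i < k) c i *m twmx i z) =
    \sum_(i < k.+1) (if nat_of_ord i is i'.+1 then E *m twmx 1 (c i') else 0 : 'M_d) *m twmx i z.
  rewrite big_ord_recl mul0mx add0r twmx_sum mulmx_sumr; apply: eq_bigr => i _.
  by rewrite twmxM -/(twmx 1 (twmx i z)) twmx_twmx mulmxA.
rewrite mulmx_sumr -!big_split; apply: eq_bigr => i _ /=.
rewrite twmxM -/(twmx i z) !mulmxA -!mulmxDl; congr (_ *m _).
have split3 (X Y Z : 'M[C]_d) : X = Y + Z + (X - Y - Z).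
  by rewrite -[X - Y - Z]addrA -opprD [RHS]addrC subrK.
exact: split3.
Qed.

Lemma cvg_psum_defect c z y : cvgV (tw_psum c z) y ->
  cvgV (fun k => (theta%:M + N) *m tw_psum c z k.+1 + E *m twmx 1 (tw_psum c z k))
    (tw_eval (rho_t n w) y).
Proof.
move=> cy; rewrite rho_t_eval; apply: cvgVD; apply: cvgVM; last exact: cvgV_tw.
by have /(_ 1%N) h := cvgV_shift _ (tw_psum c z) y; move: cy => /h;
  under eq_fun do rewrite addn1.
Qed.

Lemma Exp_defect c : is_Exp w c -> forall i, defect c i = 0.
Proof.
case=> c0; rewrite drhoX rhoX => c_cvg c_eq i; apply/matrixP => a b.
rewrite [RHS]mxE; move: i; apply: (@additive_series_eq0 _ _ C) => x.
(* On the multiples x e_b of a basis vector, the a-th coordinate of the functional equation is an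
   additive series in x with coefficients [defect c i a b]. *)
pose z : 'cV[C]_d := x *: delta_mx b 0.
have zE j : twmx j z = frob j x *: delta_mx b 0.
  apply/matrixP => k l; rewrite !mxE rmorphM; congr (_ * _).
  by rewrite rmorph_nat.
have [y zy] := c_cvg z; have [y' zy'] := c_cvg ((theta%:M + N) *m z).
have := c_eq z; rewrite (tw_eval_eq zy) (tw_eval_eq zy') => yy'.
have := cvgVD (proj2 (cvgV_shift 1 _ _) zy') (cvgVM (- 1%:M) (cvg_psum_defect zy)).
rewrite -yy' mulNmx mul1mx subrr => /(_ a); rewrite mxE => /(proj1 (cvgCP _ _)) h.
apply/(cvgC_shift _ _ 1)/cvgCP; apply: le_vanishing h => k; rewrite !subr0 addn1.
rewrite psum_defect mulNmx mul1mx addrAC subrr add0r summxE.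
rewrite le_eqVlt; apply/orP; left; apply/eqP; congr cabs; apply: eq_bigr => j _.
by rewrite zE -scalemxAr [RHS]mxE -colE [col _ _ _ _]mxE mulrC.
Qed.

Lemma cabs_theta_pow_sub i : cabs (theta ^+ (q ^ i.+1) - theta) = q%:R ^+ (q ^ i.+1).
Proof.
rewrite cabsD_eq cabsX cabs_theta // cabsN cabs_theta -[ltLHS]expr1.
rewrite ltr_eXn2l ?qR_gt1 // -[X in (X < _)%N](expn0 q) ltn_exp2l //; exact: q_gt1.
Qed.

Lemma cabs_theta_pow_sub_gt1 i : 1 < cabs (theta ^+ (q ^ i.+1) - theta).
Proof.
by rewrite cabs_theta_pow_sub exprn_egt1 ?qR_gt1 // -lt0n expn_gt0 q_gt0.
Qed.

Section Growth.
Variables (c : nat -> 'M[C]_d) (e r : R).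
Hypotheses (c0 : c 0%N = 1%:M) (c_defect : forall i, defect c i = 0).
Hypotheses (e1 : 1 <= e) (Ee : mx_le e E) (r1 : 1 <= r).

(** The bound is e^(q^i - 1) q^(-i q^i), written with the radius r so that |z| <= r makes the i-th
    term at most (r e / q^i)^(q^i). One step raises the previous bound to the power q, multiplies by
    e, and gains q^(-q^(i+1)) from the Sylvester equation. *)
Lemma Exp_growth i :
  mx_le ((r * e / q%:R ^+ i) ^+ (q ^ i) / (e * r ^+ (q ^ i))) (c i).
Proof.
have e0 : 0 < e := lt_le_trans ltr01 e1; have r0 : 0 < r := lt_le_trans ltr01 r1.
have q0 := qR_gt0 R F.
elim: i => [|i IHi].
  rewrite expn0 !expr1 expr0 divr1 [e * r]mulrC divff ?mulf_neq0 ?gt_eqF // c0.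
  by move=> a b; rewrite mxE; apply: cabs_natr_le1.
have := c_defect i.+1; rewrite defectS => /eqP; rewrite subr_eq0 => /eqP c_eq.
set K := (_ / _) in IHi *; have K0 : 0 <= K.
  by rewrite /K divr_ge0 ?mulr_ge0 ?exprn_ge0 ?divr_ge0 ?mulr_ge0 ?exprn_ge0 // ltW.
have Kq : mx_le (K ^+ q) (twmx 1 (c i)).
  by move=> a b; rewrite mxE cabs_frob expn1 lerXn2r ?nnegrE ?cabs_ge0.
have h : mx_le (e * K ^+ q) (E *m twmx 1 (c i)).
  by apply: mx_leM; rewrite ?(ltW e0) ?exprn_ge0.
rewrite -c_eq in h.
have eK0 : 0 <= e * K ^+ q by rewrite mulr_ge0 ?(ltW e0) ?exprn_ge0.
have := sylvester_bound (cabs_theta_pow_sub_gt1 i) tmN_le1 eK0 h.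
rewrite cabs_theta_pow_sub => h' a b; apply: le_trans (h' a b) _.
have -> : r * e / q%:R ^+ i.+1 = r * e / q%:R ^+ i / q%:R.
  by rewrite exprSr invfM mulrA.
rewrite /K expnSr !exprM; set Q := (q ^ i)%N; set B := r * e / _.
have B0 : 0 <= B by rewrite /B divr_ge0 ?mulr_ge0 ?exprn_ge0 // ltW.
move: B B0 => B B0; rewrite !expr_div_n exprMn.
have [BQ0 rQ0 qQ0 eq0] : [/\ 0 <= (B ^+ Q) ^+ q, 0 < (r ^+ Q) ^+ q,
    0 < ((q%:R : R) ^+ Q) ^+ q & 0 < e ^+ q].
  by rewrite !exprn_gt0 // !exprn_ge0.
have ee : e / e ^+ q <= e^-1.
  rewrite ler_pdivrMr // mulrC ler_pdivlMr // -expr2.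
  by apply: ler_weXn2l => //; exact: q_gt1.
move: ((B ^+ Q) ^+ q) ((r ^+ Q) ^+ q) (((q%:R : R) ^+ Q) ^+ q) (e ^+ q) BQ0 rQ0 qQ0 eq0 ee.
move=> b' r' q' e' b'0 r'0 q'0 e'0 ee.
have -> : e * (b' / (e' * r')) / q' = (b' / r' / q') * (e / e').
  by field; rewrite ?gt_eqF.
have -> : b' / q' / (e * r') = (b' / r' / q') * e^-1.
  by field; rewrite ?gt_eqF.
by apply: ler_wpM2l => //; rewrite !divr_ge0 // ltW.
Qed.

Lemma Exp_cvg z : mx_le r z -> exists y, cvgV (tw_psum c z) y.
Proof.
move=> zr.
have e0 : 0 < e := lt_le_trans ltr01 e1; have r0 : 0 < r := lt_le_trans ltr01 r1.
have q0 := qR_gt0 R F.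
have term k a : cabs ((c k *m twmx k z) a 0) <= (r * e / q%:R ^+ k) ^+ (q ^ k).
  have B0 : 0 <= (r * e / q%:R ^+ k) ^+ (q ^ k).
    by rewrite exprn_ge0 // divr_ge0 ?mulr_ge0 ?exprn_ge0 // ltW.
  have K0 : 0 <= (r * e / q%:R ^+ k) ^+ (q ^ k) / (e * r ^+ (q ^ k)).
    by rewrite divr_ge0 // mulr_ge0 ?exprn_ge0 // ltW.
  have rk0 : 0 < r ^+ (q ^ k) by rewrite exprn_gt0.
  have zk : mx_le (r ^+ (q ^ k)) (twmx k z).
    by move=> i j; rewrite mxE cabs_frob lerXn2r ?nnegrE ?cabs_ge0 // ltW.
  apply: le_trans (mx_leM K0 (ltW rk0) (@Exp_growth k) zk a 0) _.
  rewrite invfM mulrA divfK ?gt_eqF //.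
  by rewrite ler_piMr // invf_le1.
have cvg a : exists l, cvgC (fun k => tw_psum c z k a 0) l.
  have [|l ll] := @series_cvgC _ _ C (fun k => (c k *m twmx k z) a 0).
    have re0 : 0 <= r * e by rewrite mulr_ge0 // ltW.
    have v := vanishingM re0 (vanishing_expV (R := R) (q_gt1 F)).
    move=> eps eps0; have [|M MP] := v (Num.min eps 1); first by rewrite lt_min eps0 ltr01.
    exists M => k /MP; rewrite lt_min => /andP[keps k1].
    apply: le_lt_trans (term k a) _; apply: le_lt_trans keps.
    rewrite -[leRHS]expr1; apply: ler_wiXn2l; rewrite ?(ltW k1) //.
      by rewrite divr_ge0 // exprn_ge0 // ltW.
    by rewrite expn_gt0 q_gt0.
  by exists l; move: ll; congr (cvgC _ _); apply/funext => k; rewrite summxE.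
exists (\col_a xget 0 [set l | cvgC (fun k => tw_psum c z k a 0) l]) => a.
by rewrite mxE; have [l la] := cvg a; case: xgetP => // /(_ l).
Qed.

End Growth.

Fixpoint exp_coef (i : nat) : 'M[C]_d :=
  if i is i'.+1 then
    xget 0 [set X | sylvester (theta ^+ (q ^ i'.+1) - theta) N X =
                    E *m twmx 1 (exp_coef i')]
  else 1%:M.

Lemma exp_coef_defect i : defect exp_coef i = 0.
Proof.
case: i => [|i]; first exact: defect0.
rewrite defectS /=; case: xgetP => [X _ /= ->|]; first by rewrite subrr.
have [X XE] := sylvester_solve (E *m twmx 1 (exp_coef i))
  (cabs_theta_pow_sub_gt1 i) tmN_le1.
by move=> /(_ X).
Qed.

Lemma exp_coef_is_Exp : is_Exp w exp_coef.
Proof.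
have [K [K0 EK] _] := mx_le_max E.
have cvg z : exists y, cvgV (tw_psum exp_coef z) y.
  have [L [L0 zL] _] := mx_le_max z.
  apply: (@Exp_cvg exp_coef (Num.max 1 K) (Num.max 1 L)) => //; rewrite ?le_max ?lexx //.
  - exact: exp_coef_defect.
  - by move=> i j; rewrite le_max EK orbT.
  - by move=> i j; rewrite le_max zL orbT.
split=> // z; rewrite drhoX rhoX; have [y zy] := cvg z.
rewrite (tw_eval_eq zy); apply: tw_eval_eq; apply/(cvgV_shift 1).
have -> : (fun k => tw_psum exp_coef ((theta%:M + N) *m z) (k + 1)) =
    (fun k => (theta%:M + N) *m tw_psum exp_coef z k.+1 +
              E *m twmx 1 (tw_psum exp_coef z k)).
  apply/funext => k; rewrite addn1 psum_defect big1 ?addr0 // => i _.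
  by rewrite exp_coef_defect mul0mx.
exact: cvg_psum_defect.
Qed.

Lemma Exp_coefP : is_Exp w (Exp_coef n w).
Proof.
rewrite /Exp_coef; case: xgetP => // /(_ exp_coef) []; exact: exp_coef_is_Exp.
Qed.

Lemma Exp_coef0 : Exp_coef n w 0%N = 1%:M. Proof. by case: Exp_coefP. Qed.

Lemma Exp_coef_comm :
  tw_mul (Exp_coef n w) (tw_cst (theta%:M + N)) = tw_mul (rho_t n w) (Exp_coef n w).
Proof.
apply/funext => i; have := Exp_defect Exp_coefP i.
rewrite /tw_mul big_ord_recr big1 ?add0r /=; last first.
  move=> j _; rewrite /tw_cst subn_eq0 leqNgt ltn_ord /=.
  by rewrite twmx0 mulmx0.
rewrite subnn /tw_cst /= big_ord_recl subn0 twmx_id /defect => /eqP.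
rewrite -addrA -opprD subr_eq0 add0r => /eqP->; congr (_ + _).
case: i => [|i]; first by rewrite big1 // => -[].
rewrite big_ord_recl big1 ?addr0 /= ?subSS ?subn0 // => j _.
by rewrite /rho_t /= mul0mx.
Qed.

Lemma Log_coefP : tw_mul (Exp_coef n w) (Log_coef n w) = @tw_one _ _ C d /\
  tw_mul (Log_coef n w) (Exp_coef n w) = @tw_one _ _ C d.
Proof.
have [l lP] := tw_inverse Exp_coef0.
by rewrite /Log_coef; case: xgetP => // /(_ l).
Qed.

Lemma Log_coef0 : Log_coef n w 0%N = 1%:M.
Proof.
have [/(congr1 (fun f => f 0%N)) + _] := Log_coefP.
by rewrite /tw_mul big_ord1 Exp_coef0 mul1mx twmx_id.
Qed.

(** Multiplying the relation of [Exp_coef_comm] by Log on both sides gives Log rho(t) = drho(t) Log;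
    this is its coefficient at tau^(i+1). *)
Lemma Log_coef_rec i : (theta%:M + N) *m Log_coef n w i.+1 =
  Log_coef n w i.+1 *m ((theta ^+ (q ^ i.+1))%:M + N) + Log_coef n w i *m twmx i E.
Proof.
have [el le] := Log_coefP.
have : tw_mul (Log_coef n w) (rho_t n w) = tw_mul (tw_cst (theta%:M + N)) (Log_coef n w).
  rewrite -[LHS]tw_mul1r -el tw_mulA -[tw_mul (tw_mul _ (rho_t n w)) _]tw_mulA.
  by rewrite -Exp_coef_comm tw_mulA le tw_mul1l.
move=> /(congr1 (fun f => f i.+1)); rewrite /tw_mul.
rewrite [RHS]big_ord_recl [X in _ = _ + X]big1 ?addr0; last first.
  by move=> j _; rewrite /tw_cst /= mul0mx.
rewrite subn0 twmx_id /tw_cst /= => <-.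
rewrite big_ord_recr big_ord_recr /= subnn subSnn big1 ?add0r; last first.
  move=> j _; rewrite subSn ?(ltnW (ltn_ord j)) //.
  by have := ltn_ord j; rewrite -subn_gt0; case: (i - j)%N => //= k _; rewrite twmx0 mulmx0.
by rewrite addrC /rho_t /= twmx_A.
Qed.

End ExponentialLogarithm.

Lemma drop_zip (A B : Type) i (s : seq A) (t : seq B) :
  drop i (zip s t) = zip (drop i s) (drop i t).
Proof. by elim: s t i => [|x s IHs] [|y t] [|i] //=; case: (drop i _). Qed.

(** * Jets, and the partial sums of Log at the special point *)

Section Jets.
Variables (R : realType) (F : finFieldType) (C : Cinfty R F).
Variables (n : seq nat) (w : seq C).
Hypotheses (n_gt0 : all (ltn 0%N) n) (wn : size w = size n).
Local Notation q := #|F|.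
Local Notation theta := (theta C).
Local Notation k := (size n).
Local Notation d := (tdim n).
Local Notation N := (tmN C n).
Implicit Types (phi psi : nat -> fps C).

(* Block i of C^d is identified with C[[X]] / X^(bdim n i), X = t - theta, so
   that the tau^0-part of rho(t) becomes multiplication by t = theta + X. *)
Definition jet phi : 'cV[C]_d :=
  \mxcol_(i < k) (\col_(a < bdim n i) phi i (bdim n i - a.+1)%N).

Lemma jet_ext phi psi :
  (forall i r, (i < k)%N -> (r < bdim n i)%N -> phi i r = psi i r) -> jet phi = jet psi.
Proof.
move=> pp; apply: eq_mxcol => i; apply/matrixP => a b; rewrite !mxE; apply: pp => //.
by rewrite ltn_subrL /= (leq_ltn_trans _ (ltn_ord a)).
Qed.

Lemma jetD phi psi : jet phi + jet psi = jet (fun i => phi i + psi i).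
Proof. by rewrite /jet -mxcolD; apply: eq_mxcol => i; apply/matrixP => a b; rewrite !mxE. Qed.

Lemma jet0 : jet (fun=> 0) = 0.
Proof.
rewrite /jet -(mxcol0 _ (p_ := fun i : 'I_k => bdim n i)).
by apply: eq_mxcol => i; apply/matrixP => a b; rewrite !mxE.
Qed.

Lemma jetZ c phi : c *: jet phi = jet (fun i => fps_poly c%:P * phi i).
Proof. by apply/matrixP => a b; rewrite !mxE fps_polyC_mul. Qed.

Lemma jet_sum (I : Type) (r : seq I) (P : pred I) (f : I -> nat -> fps C) :
  \sum_(l <- r | P l) jet (f l) = jet (fun i => \sum_(l <- r | P l) f l i).
Proof.
elim: r => [|l r IHr].
  by rewrite big_nil -jet0; apply: jet_ext => i j _ _; rewrite big_nil.
rewrite big_cons IHr; case: ifP => Pl; rewrite ?jetD; apply: jet_ext => i j _ _;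
  by rewrite big_cons Pl.
Qed.

Lemma tmN_jet phi : N *m jet phi = jet (fun i => fps_poly 'X * phi i).
Proof.
rewrite /jet mul_mxdiag_mxcol; apply: eq_mxcol => i; apply/matrixP => a b.
rewrite !mxE fps_polyX_mul; have ae := ltn_ord a.
have [ae'|ea] := ltnP a.+1 (bdim n i).
  rewrite (bigD1 (Ordinal ae')) //= big1 ?addr0.
    by rewrite !mxE eqxx mul1r -[(bdim n i - a.+1)%N]prednK ?subn_gt0 // subnS.
  by move=> c; rewrite !mxE -val_eqE /= => /negbTE->; rewrite mul0r.
rewrite (_ : bdim n i - a.+1 = 0)%N; last by apply/eqP; rewrite subn_eq0.
rewrite big1 // => c _; rewrite !mxE (_ : _ == _ = false) ?mul0r //.
by apply: ltn_eqF; exact: leq_trans (ltn_ord c) ea.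
Qed.

Lemma tmA_jet c phi : (c%:M + N) *m jet phi = jet (fun i => fps_poly ('X + c%:P) * phi i).
Proof.
rewrite mulmxDl mul_scalar_mx tmN_jet jetZ jetD; apply: jet_ext => i r _ _.
by rewrite rmorphD mulrDl addrC.
Qed.

Lemma bdimS m : (m < k)%N -> bdim n m = (nth 0 n m + bdim n m.+1)%N.
Proof. by move=> mk; rewrite /bdim (drop_nth 0%N). Qed.

Lemma bdim_size : bdim n k = 0%N. Proof. by rewrite /bdim drop_size. Qed.

Lemma bdim_gt0 m : (m < k)%N -> (0 < bdim n m)%N.
Proof.
by move=> mk; rewrite bdimS // ltn_addr //; apply: (all_nthP 0%N n_gt0).
Qed.

Lemma bdim_sum l m : (l <= m <= k)%N ->
  bdim n l = (\sum_(l <= c < m) nth 0 n c + bdim n m)%N.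
Proof.
case/andP=> lm; rewrite -(subnKC lm); elim: (m - l)%N => [|r IHr].
  by rewrite addn0 big_geq.
rewrite addnS => lk; rewrite big_nat_recr ?leq_addr //= -addnA -bdimS //.
by apply: IHr; exact: ltnW.
Qed.

(** In terms of jets, E reads the top coefficient X^(d_m - 1) of block m, its first coordinate, and
    writes into the constant coefficient of block l, its last coordinate. *)
Lemma tmE_jet (w' : seq C) phi : tmE n w' *m jet phi =
  jet (fun l => fps_poly (\sum_(l <= m < k) (-1) ^+ (m - l) *
    (\prod_(l <= c < m) w'`_c) * phi m (bdim n m).-1)%:P).
Proof.
rewrite /tmE /jet mxblockEv mxcol_mul; apply: eq_mxcol => l.
rewrite mul_mxrow_mxcol; apply/matrixP => a b; rewrite summxE [RHS]mxE.
rewrite /fps_poly /ps_of_poly coefC subn_eq0.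
have al := ltn_ord a.
have aE : (bdim n l <= a.+1)%N = (a.+1 == bdim n l) by rewrite eqn_leq al.
rewrite aE big_geq_mkord; transitivity (\sum_(m < k) if (a.+1 == bdim n l) && (l <= m)%N
    then (-1) ^+ (m - l) * (\prod_(l <= c < m) w'`_c) * phi m (bdim n m).-1 else 0).
  apply: eq_bigr => m _; rewrite mxE.
  rewrite (bigD1 (Ordinal (bdim_gt0 (ltn_ord m)))) //= [X in _ + X](_ : _ = 0) ?addr0; last first.
    by apply: big1 => c; rewrite !mxE -val_eqE /= => /negbTE->; rewrite !andbF mul0r.
  rewrite !mxE /= eqxx andbT subn1 [(l <= m)%N && _]andbC.
  by case: ifP; rewrite ?mul0r.
by rewrite -big_mkcond; case: (_ == _); rewrite /= ?big_pred0_eq.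
Qed.

Lemma nth_map_frob i c : [seq frob i x | x <- w]`_c = frob i w`_c.
Proof.
have [cw|wc] := ltnP c (size w); first by rewrite (nth_map 0).
by rewrite !nth_default ?size_map // rmorph0.
Qed.

Lemma twmx_tmE i : twmx i (tmE n w) = tmE n [seq frob i x | x <- w].
Proof.
apply/matrixP => a b; rewrite !mxE; case: ifP => _; last by rewrite rmorph0.
rewrite rmorphM rmorph_prod /= rmorph_sign; congr (_ * _).
by apply: eq_bigr => c _; rewrite nth_map_frob.
Qed.

Definition v_coef (i m : nat) : C :=
  (-1) ^+ (k - m.+1) * \prod_(m <= c < k) frob i w`_c.

Lemma twmx_tm_v i : twmx i (tm_v n w) = jet (fun m => fps_poly (v_coef i m)%:P).
Proof.
apply/matrixP => a b; rewrite !mxE /fps_poly /ps_of_poly coefC subn_eq0.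
have -> : (bdim n (tagnat.sig1 a) <= (tagnat.sig2 a).+1)%N =
  ((tagnat.sig2 a).+1 == bdim n (tagnat.sig1 a)) by rewrite eqn_leq ltn_ord.
case: ifP => _; last by rewrite rmorph0.
by rewrite rmorphM rmorph_prod /= rmorph_sign.
Qed.

(** The constant 1 in block m. Its jet is the basis vector of the last coordinate of that block, and
    v and its twists are combinations of these. *)
Definition unit_jet (m : nat) : nat -> fps C := fun j => (j == m)%:R.

Lemma jet_const (r : nat) (c : nat -> C) : (r <= k)%N ->
  jet (fun l => if (l < r)%N then fps_poly (c l)%:P else 0) =
  \sum_(0 <= l < r) c l *: jet (unit_jet l).
Proof.
move=> rk; under eq_bigr do rewrite jetZ.
rewrite jet_sum; apply: jet_ext => i j _ _.
apply: (congr1 (fun f : fps C => f j)).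
case: ltnP => [ir|ri].
  rewrite (bigD1_seq i) ?iota_uniq ?mem_index_iota //= big1 => [|l /negbTE li].
    by rewrite /unit_jet eqxx mulr1 addr0.
  by rewrite /unit_jet eq_sym li mulr0.
rewrite big_nat big1 // => l /andP[_ lr]; rewrite /unit_jet gtn_eqF ?mulr0 //.
exact: leq_trans lr ri.
Qed.

Definition iLL (i e : nat) : fps C := ps_inv (ps_of_poly (LL C i ^+ e)).

Lemma iLL_inT i e : in_Ttheta (iLL i e). Proof. by have [] := ps_inv_LL C i e. Qed.

Definition block_term (c i : nat) : fps C := xterm (nth 0%N n c, w`_c) i.

Local Notation terms := (rev_range block_term).

Lemma terms_inT i j m : in_Ttheta (nsum 1 i (terms j m)).
Proof. by apply: nsum_inT => c _ i'; exact: xterm_inT. Qed.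

Lemma block_term_prod i l m : (l <= m <= k)%N ->
  iLL i (bdim n m) * \prod_(l <= c < m) block_term c i =
  fps_poly (\prod_(l <= c < m) frob i w`_c)%:P * iLL i (bdim n l).
Proof.
move=> lmk; rewrite xterm_prod /= (bdim_sum lmk) /xterm /= rmorph_prod mulrCA.
congr (_ * _); have := @xterm_mul _ _ C (\sum_(l <= c < m) nth 0 n c)%N (bdim n m) 1 1 i.
by rewrite mulr1 /xterm /= !rmorph1 !mul1r -!/(iLL _ _) mulrC => ->.
Qed.

(** The predicted j-th block of the column of Log_i at the last coordinate of block m. The star sum
    involves the blocks j, ..., m - 1 with indices below i; the remaining blocks are supplied by v
    at index i. *)
Definition log_col (i m j : nat) : fps C :=
  if (j <= m)%N then
    (-1) ^+ (m - j) * tay (iLL i (bdim n m) * nsum 1 i (terms j m))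
  else 0.

Lemma log_col0 m j : log_col 0 m j = (j == m)%:R.
Proof.
rewrite /log_col; case: ltngtP => // [jm|->].
  case: m jm => // m jm; rewrite rev_rangeS // nsum_cons big_ord0 mulr0 tay0.
  by rewrite mulr0.
rewrite subnn expr0 mul1r rev_range_nil mulr1 /iLL.
rewrite (@ps_inv_eq _ _ 1) ?tay1 // -/(fps_poly _) /LL big_geq // expr1n rmorph1.
exact: mulr1.
Qed.

Lemma iLL_step i e : fps_poly ('X - (theta ^+ (q ^ i.+1))%:P) ^+ e * iLL i.+1 e = iLL i e.
Proof.
symmetry; apply: ps_inv_eq; rewrite mulrA -/(fps_poly _) -rmorphXn -rmorphM -exprMn.
have -> : LL C i * ('X - (theta ^+ (q ^ i.+1))%:P) = LL C i.+1.
  by rewrite /LL [RHS]big_nat_recr.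
by have [] := ps_inv_LL C i.+1 e.
Qed.

(** The power of t - theta^(q^(i+1)) lowers 1/LL_(i+1)^(d_m) to 1/LL_i^(d_m). In the star sum below
    i + 1, [nsum_rev_range] splits off the blocks l, ..., m - 1 with index i, and their denominators
    raise the exponent from d_m to d_l. *)
Lemma log_col_rec i m j : (m < k)%N ->
  fps_poly ('X + (theta - theta ^+ (q ^ i.+1))%:P) ^+ bdim n m * log_col i.+1 m j =
  \sum_(0 <= l < m.+1)
    fps_poly ((-1) ^+ (m - l) * \prod_(l <= c < m) frob i w`_c)%:P * log_col i l j.
Proof.
move=> mk; rewrite /log_col; have [jm|mj] := leqP j m; last first.
  rewrite mulr0 big_nat big1 // => l /andP[_ lm].
  by rewrite leqNgt (leq_trans lm mj) mulr0.
rewrite (big_cat_nat (n := j)) ?leqW //= [X in _ = X + _](_ : _ = 0) ?add0r; last first.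
  by rewrite big_nat big1 // => l /andP[_ lj]; rewrite leqNgt lj mulr0.
have -> : fps_poly ('X + (theta - theta ^+ (q ^ i.+1))%:P) =
    tay (fps_poly ('X - (theta ^+ (q ^ i.+1))%:P)).
  by rewrite tay_poly comp_polyB comp_polyX comp_polyC polyCB addrA.
have tayX (f : fps C) s : in_Ttheta f -> tay f ^+ s = tay (f ^+ s).
  move=> fT; elim: s => [|s IHs]; first by rewrite !expr0 tay1.
  by rewrite !exprS IHs tayM //; exact: inT_X.
have pT := inT_poly ('X - (theta ^+ (q ^ i.+1))%:P).
rewrite tayX // mulrCA -tayM; [|exact: inT_X|]; last first.
  by apply: inT_M; [exact: iLL_inT | exact: terms_inT].
rewrite mulrA iLL_step nsum_rev_range // mulr_sumr tay_sum; last first.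
  move=> l _; apply: inT_M; first exact: iLL_inT.
  apply: inT_M; last exact: terms_inT.
  by apply: inT_prod => c _; exact: xterm_inT.
rewrite mulr_sumr; apply: eq_big_nat => l /andP[jl lm].
rewrite jl mulrA block_term_prod ?(ltnW mk) ?andbT //.
rewrite -mulrA tayM; [|exact: inT_poly|]; last first.
  by apply: inT_M; [exact: iLL_inT | exact: terms_inT].
rewrite tayC polyCM rmorphM /= !rmorph_sign mulrACA -exprD.
by rewrite (_ : m - l + (l - j) = m - j)%N //; move: jl lm; lia.
Qed.

(** N does not increase the largest entry of a vector, whereas lam strictly enlarges it. *)
Lemma jet_shift_inj lam (z z' : 'cV[C]_d) : 1 < cabs lam ->
  (lam%:M + N) *m z = (lam%:M + N) *m z' -> z = z'.
Proof.
move=> lam1 zz'; apply/eqP; rewrite -subr_eq0; apply/eqP; set y := z - z'.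
have {zz'} : lam *: y + N *m y = 0.
  by rewrite -mul_scalar_mx -mulmxDl mulmxBr zz' subrr.
move=> /eqP; rewrite addr_eq0 => /eqP yE.
have [M [M0 yM] Mmax] := mx_le_max y.
have h i j : cabs lam * cabs (y i j) <= M.
  have -> : cabs lam * cabs (y i j) = cabs ((N *m y) i j).
    rewrite -cabsM -cabsN; congr cabs.
    by have := congr1 (fun A : 'cV_d => A i j) yE; rewrite !mxE => ->; rewrite opprK.
  by rewrite -[M]mul1r; apply: mx_leM => //; exact: tmN_le1.
have M00 : M <= 0.
  have [//|[i [j Mij]]] := Mmax 0 (lexx _).
  have := h i j; rewrite Mij -{2}[M]mul1r => MM.
  by rewrite leNgt; apply/negP => M0'; move: MM; rewrite ler_pM2r // leNgt lam1.
apply/matrixP => i j; rewrite [RHS]mxE; apply/eqP; rewrite -cabs_eq0E eq_le cabs_ge0 andbT.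
exact: le_trans (yM i j) M00.
Qed.

Lemma Log_unit_jet i m : (m < k)%N ->
  Log_coef n w i *m jet (unit_jet m) = jet (log_col i m).
Proof.
elim: i m => [|i IHi] m mk.
  rewrite Log_coef0 mul1mx; apply: jet_ext => j r _ _; by rewrite log_col0.
set P' := Log_coef n w i.+1; set lam := theta ^+ (q ^ i.+1).
pose B : 'M[C]_d := (theta - lam)%:M + N.
have lam1 : 1 < cabs (theta - lam).
  by rewrite cabs_distC; exact: cabs_theta_pow_sub_gt1.
(* [B] acts on jets as t - theta^(q^(i+1)): both scalars of [Log_coef_rec] have been collected on
   the left. *)
have BP phi : B *m (P' *m jet phi) = P' *m jet (fun j => fps_poly 'X * phi j) +
    Log_coef n w i *m (twmx i (tmE n w) *m jet phi).
  rewrite !mulmxA.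
  have -> : B *m P' = P' *m N + Log_coef n w i *m twmx i (tmE n w).
    have := Log_coef_rec n w i; rewrite -/P' -/lam /B.
    rewrite mulmxDl mulmxDr mul_scalar_mx mul_mx_scalar => h.
    rewrite mulmxDl mul_scalar_mx scalerBl addrAC h; apply/eqP.
    by rewrite subr_eq [eqbRHS]addrC addrA.
  by rewrite mulmxDl -!mulmxA tmN_jet.
pose v r := jet (fun j => fps_poly 'X^r * unit_jet m j).
have vE r phi : (forall j l, phi j l = (fps_poly 'X^r * unit_jet m j) l) -> jet phi = v r.
  by move=> pv; apply: jet_ext => j l _ _; rewrite pv.
have Xr r j l : (fps_poly ('X^r : {poly C}) * unit_jet m j) l = ((j == m) && (l == r))%:R.
  rewrite /unit_jet; case: (j == m) => /=; last by rewrite mulr0.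
  by rewrite mulr1 /fps_poly /ps_of_poly coefXn.
have vS r : jet (fun j => fps_poly 'X * (fps_poly 'X^r * unit_jet m j)) = v r.+1.
  by apply: vE => j l; rewrite mulrA -rmorphM -exprS.
have e0 := bdim_gt0 mk.
have Ev r : twmx i (tmE n w) *m v r = (r == (bdim n m).-1)%:R *:
    \sum_(0 <= l < m.+1)
      ((-1) ^+ (m - l) * \prod_(l <= c < m) frob i w`_c) *: jet (unit_jet l).
  rewrite -(jet_const (fun l => (-1) ^+ (m - l) * \prod_(l <= c < m) frob i w`_c)) //.
  rewrite jetZ twmx_tmE tmE_jet; apply: jet_ext => l j lk _.
  rewrite ltnS; case: leqP => [lm|ml].
    rewrite -rmorphM -polyCM; apply: (congr1 (fun a : C => fps_poly a%:P j)).
    rewrite (bigD1_seq m) ?iota_uniq ?mem_index_iota ?lm ?mk //= [X in _ + X](_ : _ = 0) ?addr0.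
      rewrite Xr eqxx /= [RHS]mulrC [_.-1 == r]eq_sym; congr (_ * _ * _).
      by apply: eq_bigr => c _; rewrite nth_map_frob.
    by apply: big1 => l' /negbTE lm'; rewrite Xr lm' mulr0.
  rewrite mulr0 [X in fps_poly X%:P](_ : _ = 0) ?rmorph0 // big_nat.
  apply: big1 => l' /andP[ll' _].
  by rewrite Xr gtn_eqF ?mulr0 // (leq_trans ml ll').
(* E sees only X^(d_m - 1); before that power is reached, shifting the argument by X and applying
   [B] to the value coincide. *)
have iterB r : (r < bdim n m)%N -> iter r (mulmx B) (P' *m jet (unit_jet m)) = P' *m v r.
  elim: r => [_|r IHr rm].
    congr (_ *m _); apply: vE => j l; by rewrite expr0 rmorph1 mul1r.
  rewrite iterS IHr ?(ltnW rm) // BP vS -/(v r) Ev ltn_eqF ?scale0r ?mulmx0 ?addr0 //.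
  by rewrite ltn_predRL.
have iterD r phi : iter r (mulmx B) (jet phi) =
    jet (fun j => fps_poly ('X + (theta - lam)%:P) ^+ r * phi j).
  elim: r => [|r IHr]; first by apply: jet_ext => j l _ _; rewrite mul1r.
  by rewrite iterS IHr tmA_jet; apply: jet_ext => j l _ _; rewrite mulrA -exprS.
have iter_inj r (z z' : 'cV[C]_d) : iter r (mulmx B) z = iter r (mulmx B) z' -> z = z'.
  elim: r => // r IHr; rewrite !iterS => zz'; apply: IHr.
  exact: (jet_shift_inj lam1 zz').
apply: (iter_inj (bdim n m)); rewrite iterD.
rewrite -{1}(prednK e0) iterS iterB ?prednK // BP vS prednK // -/(v _) Ev eqxx scale1r.
(* The last shift leaves block m, which removes the unknown P' from the right-hand side; only the
   contribution of E at X^(d_m - 1) remains. *)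
have -> : v (bdim n m) = 0.
  rewrite -jet0; apply: jet_ext => j r jk re; rewrite Xr fps0.
  by case: eqP => [jm|//] /=; rewrite ltn_eqF // -jm.
rewrite mulmx0 add0r mulmx_sumr.
transitivity (\sum_(0 <= l < m.+1)
  ((-1) ^+ (m - l) * \prod_(l <= c < m) frob i w`_c) *: jet (log_col i l)).
  apply: eq_big_nat => l /andP[_ lm]; rewrite -scalemxAr IHi //.
  exact: leq_trans lm mk.
under eq_bigr do rewrite jetZ.
by rewrite jet_sum; apply: jet_ext => j r _ _; rewrite log_col_rec.
Qed.

Lemma Log_psum M : tw_psum (Log_coef n w) (tm_v n w) M =
  jet (fun j => fps_poly ((-1) ^+ (k - j.+1))%:P * tay (nsum 1 M (terms j k))).
Proof.
elim: M => [|M IHM].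
  rewrite /tw_psum big_ord0 -jet0; apply: jet_ext => j r jk _.
  by rewrite -(subnKC jk) addSn rev_rangeS ?leq_addr // nsum_cons big_ord0 tay0 mulr0.
rewrite /tw_psum big_ord_recr /= -/(tw_psum _ _ M) IHM twmx_tm_v.
have -> : jet (fun m => fps_poly (v_coef M m)%:P) =
    \sum_(0 <= l < k) v_coef M l *: jet (unit_jet l).
  by rewrite -jet_const //; apply: jet_ext => l r lk _; rewrite lk.
rewrite mulmx_sumr.
have -> : \sum_(0 <= l < k) Log_coef n w M *m (v_coef M l *: jet (unit_jet l)) =
    \sum_(0 <= l < k) jet (fun j => fps_poly (v_coef M l)%:P * log_col M l j).
  by apply: eq_big_nat => l /andP[_ lk]; rewrite -scalemxAr Log_unit_jet // jetZ.
rewrite jet_sum jetD; apply: jet_ext => j r jk _.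
apply: (congr1 (fun f : fps C => f r)).
(* Raising M by one adds the tuples with leading index M. Sorted by the number of indices equal to
   M, they match the columns of Log_M weighted by the coefficients of the twisted v; the summand l =
   k is the old partial sum. *)
rewrite nsum_rev_range ?(ltnW jk) // big_nat_recr ?(ltnW jk) //=.
rewrite [X in _ = _ * tay (_ + X * _)]big_geq // mul1r.
have sT : in_Ttheta (\sum_(j <= l < k)
    (\prod_(l <= c < k) block_term c M) * nsum 1 M (terms j l)).
  apply: inT_sum => l _; apply: inT_M; last exact: terms_inT.
  by apply: inT_prod => c _; exact: xterm_inT.
rewrite tayD //; last exact: terms_inT.
rewrite mulrDr addrC; congr (_ + _).
rewrite (big_cat_nat (n := j)) ?(ltnW jk) //= [X in X + _](_ : _ = 0) ?add0r; last first.
  by rewrite big_nat big1 // => l /andP[_ lj]; rewrite /log_col leqNgt lj mulr0.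
rewrite tay_sum => [|l _]; last first.
  apply: inT_M; last exact: terms_inT.
  by apply: inT_prod => c _; exact: xterm_inT.
rewrite mulr_sumr; apply: eq_big_nat => l /andP[jl lk].
rewrite /log_col jl /v_coef.
have -> : \prod_(l <= c < k) block_term c M =
    fps_poly (\prod_(l <= c < k) frob M w`_c)%:P * iLL M (bdim n l).
  rewrite -block_term_prod ?(ltnW lk) ?leqnn // bdim_size /iLL expr0.
  rewrite (@ps_inv_eq _ _ 1) ?mul1r // -/(fps_poly _) rmorph1; exact: mulr1.
rewrite -[X in _ = _ * tay X]mulrA [in RHS]tayM; [|exact: inT_poly|]; last first.
  by apply: inT_M; [exact: iLL_inT | exact: terms_inT].
rewrite tayC polyCM rmorphM /= !rmorph_sign mulrACA -exprD.
rewrite (_ : k - l.+1 + (l - j) = k - j.+1)%N //.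
by move: jl lk; move: (k) => K; lia.
Qed.

Hypothesis w_weight : {in zip n w, forall p, weight_le 1 p}.

Lemma terms_Li j : (j < k)%N ->
  terms j k = Li_terms (rev (drop j n)) (rev (drop j w)).
Proof.
move=> jk; rewrite /Li_terms -rev_zip ?size_drop ?wn // /rev_range !map_rev.
congr rev; rewrite -drop_zip.
apply: (@eq_from_nth _ (block_term 0)).
  by rewrite !size_map size_iota size_drop size_zip wn minnn.
move=> i; rewrite size_map size_iota => ik.
rewrite (nth_map 0%N) ?size_iota // nth_iota //.
rewrite (nth_map (0%N, 0)) ?size_drop ?size_zip ?wn ?minnn //.
by rewrite nth_drop nth_zip ?wn.
Qed.

Lemma Log_cvg : cvgV (tw_psum (Log_coef n w) (tm_v n w)) (tm_Y n w).
Proof.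
move=> a; have -> : (fun M => tw_psum (Log_coef n w) (tm_v n w) M a 0) = (fun M =>
    jet (fun j => fps_poly ((-1) ^+ (k - j.+1))%:P * tay (nsum 1 M (terms j k))) a 0).
  by apply/funext => M; rewrite Log_psum.
rewrite mxE mxE; under eq_fun do rewrite mxE mxE fps_polyC_mul.
apply: cvgCZ; apply: tay_continuous; rewrite terms_Li ?ltn_ord //.
apply: Li_star_cvg => [|p]; first by rewrite !size_rev !size_drop wn.
rewrite -rev_zip ?size_drop ?wn // mem_rev -drop_zip => /mem_drop.
exact: w_weight.
Qed.

Lemma tm_Z_eq : tm_Z n w = tm_Y n w.
Proof. exact/tw_eval_eq/Log_cvg. Qed.

End Jets.

(** * Carlitz's polynomials E_d, power sums and interpolation *)

Section CarlitzModulePolynomials.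
Variables (R : realType) (F : finFieldType) (C : Cinfty R F).
Local Notation q := #|F|.
Local Notation theta := (theta C).

Definition cD (i : nat) : C := ofA C (carlitzD F i).

Definition cL (i : nat) : C := \prod_(1 <= k < i.+1) (theta - theta ^+ (q ^ k)).

Lemma carlitzDS i : carlitzD F i.+1 = bracket F i.+1 * carlitzD F i ^+ q.
Proof.
rewrite !carlitzD_bracket big_nat_recr //= subnn expn0 expr1 mulrC; congr (_ * _).
rewrite -prodrXl; apply: eq_big_nat => l /andP[_ li].
by rewrite subSn // expnSr exprM.
Qed.

Lemma cDS i : cD i.+1 = (theta ^+ (q ^ i.+1) - theta) * cD i ^+ q.
Proof. by rewrite /cD carlitzDS rmorphM rmorphB !rmorphXn /= ofAX. Qed.

Lemma cLS i : cL i.+1 = cL i * (theta - theta ^+ (q ^ i.+1)).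
Proof. by rewrite /cL big_nat_recr. Qed.

Lemma theta_pow_sub_neq0 i : theta ^+ (q ^ i.+1) - theta != 0.
Proof. by rewrite -cabs_gt0 (lt_trans ltr01) // cabs_theta_pow_sub_gt1. Qed.

Lemma cD_neq0 i : cD i != 0. Proof. by rewrite ofA_eq0 carlitzD_neq0. Qed.

Lemma cL_neq0 i : cL i != 0.
Proof.
elim: i => [|i IHi]; first by rewrite /cL big_geq ?oner_neq0.
by rewrite cLS mulf_neq0 // -opprB oppr_eq0 theta_pow_sub_neq0.
Qed.

Lemma theta_pow_subX a b k : (theta ^+ (q ^ a) - theta ^+ (q ^ b)) ^+ (q ^ k) =
  theta ^+ (q ^ (a + k)) - theta ^+ (q ^ (b + k)).
Proof. by rewrite (exprB_q (Cconst C)) -!exprM -!expnD. Qed.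

Lemma theta_subX b k : (theta - theta ^+ (q ^ b)) ^+ (q ^ k) =
  theta ^+ (q ^ k) - theta ^+ (q ^ (b + k)).
Proof. by rewrite -{1}[theta]expr1 -{1}(expn0 q) theta_pow_subX add0n. Qed.

(* The coefficients of the polynomial E_d(z) = prod_(deg a < d) (z - a). *)
Definition ecoef (d i : nat) : C := cD d / (cD i * cL (d - i) ^+ (q ^ i)).

Lemma ecoef_diag d : ecoef d d = 1.
Proof.
by rewrite /ecoef subnn /cL big_geq // expr1n mulr1 divff ?cD_neq0.
Qed.

(** A coefficient of E_(d+1)(theta z) = theta E_(d+1)(z) + (theta^(q^(d+1)) - theta) E_d(z)^q. *)
Lemma ecoef_mulS d i : (i <= d)%N ->
  ecoef d.+1 i.+1 * (theta ^+ (q ^ i.+1) - theta) =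
  (theta ^+ (q ^ d.+1) - theta) * ecoef d i ^+ q.
Proof.
move=> id; rewrite /ecoef subSS !cDS expr_div_n exprMn -exprM -expnSr.
have := theta_pow_sub_neq0 i; have := expf_neq0 q (cD_neq0 i).
have := expf_neq0 (q ^ i.+1) (cL_neq0 (d - i)).
move: (cL _ ^+ _) (cD i ^+ q) (cD d ^+ q) (_ - theta) (_ - theta) => l Y X v u l0 Y0 u0.
by field; rewrite l0 Y0 u0.
Qed.

(** A coefficient of E_(d+1)(z) = E_d(z)^q - D_d^(q-1) E_d(z). *)
Lemma ecoefS d i : (i < d)%N ->
  ecoef d.+1 i.+1 = ecoef d i ^+ q - cD d ^+ q.-1 * ecoef d i.+1.
Proof.
move=> id; rewrite /ecoef subSS !cDS expr_div_n exprMn -exprM -expnSr.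
rewrite -[(d - i)%N]prednK ?subn_gt0 // -subnS cLS exprMn theta_subX.
have -> : ((d - i.+1).+1 + i.+1 = d.+1)%N by rewrite addSn subnK.
have uv0 : theta ^+ (q ^ i.+1) - theta ^+ (q ^ d.+1) != 0.
  have -> : d.+1 = ((d - i.+1).+1 + i.+1)%N by rewrite addSn subnK.
  rewrite -theta_subX expf_neq0 // -opprB oppr_eq0; exact: theta_pow_sub_neq0.
have -> : cD d ^+ q.-1 * (cD d / ((theta ^+ (q ^ i.+1) - theta) * cD i ^+ q *
    cL (d - i.+1) ^+ (q ^ i.+1))) = cD d ^+ q / ((theta ^+ (q ^ i.+1) - theta) *
    cD i ^+ q * cL (d - i.+1) ^+ (q ^ i.+1)).
  by rewrite mulrA -exprSr prednK ?q_gt0.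
have := theta_pow_sub_neq0 i; have := expf_neq0 q (cD_neq0 i).
have := expf_neq0 (q ^ i.+1) (cL_neq0 (d - i.+1)).
move: (cL _ ^+ _) (cD i ^+ q) (cD d ^+ q) uv0 => l Y X.
move: theta (theta ^+ (q ^ d.+1)) (theta ^+ (q ^ i.+1)) => t v u uv0 l0 Y0 u0.
by field; rewrite l0 Y0 u0 uv0.
Qed.

Lemma ecoefS0 d : ecoef d.+1 0 = - (cD d ^+ q.-1 * ecoef d 0).
Proof.
rewrite /ecoef !subn0 expn0 !expr1 cDS cLS [cD d ^+ q.-1 * _]mulrA -exprSr.
rewrite prednK ?q_gt0 //.
have := theta_pow_sub_neq0 d; have := cL_neq0 d; have := cD_neq0 0.
move: (cD d ^+ q) (cD 0) (cL d) => X Y l.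
move: theta (theta ^+ (q ^ d.+1)) => t v Y0 l0 v0.
have v0' : t - v != 0 by rewrite -opprB oppr_eq0.
by field; rewrite ?l0 ?Y0 ?v0 ?v0'.
Qed.

Definition epol (d : nat) (z : C) : C := \sum_(i < d.+1) ecoef d i * z ^+ (q ^ i).

Lemma epolX d z : epol d z ^+ q = \sum_(i < d.+1) ecoef d i ^+ q * z ^+ (q ^ i.+1).
Proof.
have frob1 x : x ^+ q = frob 1 x :> C by rewrite /frob expn1.
rewrite frob1 rmorph_sum; apply: eq_bigr => i _.
by rewrite rmorphM /= -!frob1 -exprM -expnSr.
Qed.

Lemma epolS d z : epol d.+1 z = epol d z ^+ q - cD d ^+ q.-1 * epol d z.
Proof.
rewrite epolX /epol big_ord_recl big_ord_recr [X in X - _]big_ord_recr /=.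
rewrite [X in _ - _ * X]big_ord_recl mulrDr opprD ecoefS0 !ecoef_diag expr1n.
rewrite mulr_sumr (eq_bigr (fun i : 'I_d => ecoef d i ^+ q * z ^+ (q ^ i.+1) -
    cD d ^+ q.-1 * (ecoef d i.+1 * z ^+ (q ^ i.+1)))); last first.
  by move=> i _; rewrite /bump /= ecoefS // mulrBl !mulrA.
rewrite sumrB /bump /= expn0; ring.
Qed.

Lemma epol_theta d z :
  epol d.+1 (theta * z) = theta * epol d.+1 z + (theta ^+ (q ^ d.+1) - theta) * epol d z ^+ q.
Proof.
rewrite epolX /epol big_ord_recl [X in _ = theta * X + _]big_ord_recl /=.
rewrite [theta * (_ + _)]mulrDr -addrA; congr (_ + _).
  by rewrite expn0 !expr1 mulrCA.
rewrite !mulr_sumr -big_split; apply: eq_bigr => i _ /=.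
by rewrite /bump /= add1n [_ * (ecoef d i ^+ q * _)]mulrA -ecoef_mulS -1?ltnS // exprMn; ring.
Qed.

Lemma epolD d x y : epol d (x + y) = epol d x + epol d y.
Proof.
rewrite /epol -big_split; apply: eq_bigr => i _ /=.
by rewrite -mulrDr -[(x + y) ^+ _]/(frob i (x + y)) rmorphD.
Qed.

Lemma epol_const d c x : epol d (Cconst C c * x) = Cconst C c * epol d x.
Proof.
rewrite /epol mulr_sumr; apply: eq_bigr => i _.
by rewrite exprMn -[Cconst C c ^+ _]/(frob i _) frob_const mulrCA.
Qed.

Lemma epol0 d : epol d 0 = 0.
Proof.
by rewrite /epol big1 // => i _; rewrite expr0n gtn_eqF ?mulr0 // expn_gt0 q_gt0.
Qed.

(** By F-linearity these values determine E_d on every polynomial of degree at most d. The recursion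
    [epolS] gives the zeros, including the new one at theta^d, and [epol_theta] gives the top
    value. *)
Lemma epol_theta_pow d : (forall j, (j < d)%N -> epol d (theta ^+ j) = 0) /\
  epol d (theta ^+ d) = cD d.
Proof.
elim: d => [|d [IH0 IHd]].
  split=> //; rewrite /epol big_ord1 ecoef_diag mul1r expr0 expr1n.
  by rewrite /cD /carlitzD big_ord0 rmorph1.
have vanish j : (j < d.+1)%N -> epol d.+1 (theta ^+ j) = 0.
  rewrite ltnS leq_eqVlt epolS => /predU1P[->|/IH0->].
    by rewrite IHd -exprSr prednK ?q_gt0 // subrr.
  by rewrite mulr0 expr0n gtn_eqF ?q_gt0 // subrr.
by split=> //; rewrite exprS epol_theta vanish // mulr0 add0r IHd cDS.
Qed.

Lemma epol_monic d (a : {poly F}) : a \is monic -> size a = d.+1 ->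
  epol d (ofA C a) = cD d.
Proof.
move=> a_monic sa.
have -> : ofA C a = \sum_(j < d.+1) Cconst C a`_j * theta ^+ j.
  rewrite /ofA (horner_coef_wide _ (n := d.+1)); last by rewrite size_map_poly sa.
  by apply: eq_bigr => j _; rewrite coef_map.
rewrite (big_morph (epol d) (epolD d) (epol0 d)) big_ord_recr big1 /= => [|j _].
  rewrite epol_const add0r (epol_theta_pow d).2.
  by have /monicP := a_monic; rewrite /lead_coef sa /= => ->; rewrite rmorph1 mul1r.
by rewrite epol_const (epol_theta_pow d).1 // mulr0.
Qed.

Definition epoly (d : nat) : {poly C} := \sum_(i < d.+1) ecoef d i *: 'X^(q ^ i).

Definition monics (d : nat) : seq {poly F} :=
  [seq 'X^d + val b | b <- enum {: {poly_d F}}].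

Lemma monicsP d a : a \in monics d -> a \is monic /\ size a = d.+1.
Proof.
case/mapP => b _ ->; have sb : (size (val b) < (d.+1))%N by rewrite ltnS size_npoly.
have sa : size ('X^d + val b) = d.+1 by rewrite size_polyDl ?size_polyXn.
split=> //; apply/monicP; rewrite /lead_coef sa coefD coefXn eqxx /=.
by rewrite nth_default ?addr0 // size_npoly.
Qed.

(** The right-hand side is monic of degree q^d and vanishes at the q^d distinct monic polynomials of
    degree d. *)
Lemma prod_monics d :
  \prod_(a <- [seq ofA C a | a <- monics d]) ('X - a%:P) = epoly d - (cD d)%:P.
Proof.
set rs := map _ _; set p := epoly d - _.
have epd : epoly d = \sum_(i < d) ecoef d i *: 'X^(q ^ i) + 'X^(q ^ d).
  by rewrite /epoly big_ord_recr /= ecoef_diag scale1r.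
have qd0 : (0 < q ^ d)%N by rewrite expn_gt0 q_gt0.
have slow : (size (\sum_(i < d) ecoef d i *: 'X^(q ^ i) - (cD d)%:P)%R <= q ^ d)%N.
  apply: leq_trans (size_polyD _ _) _; rewrite geq_max size_polyN.
  rewrite (leq_trans (size_polyC_leq1 _)) // andbT.
  apply: (leq_trans (size_sum _ _ _)); apply/bigmax_leqP => i _.
  apply: leq_trans (size_scale_leq _ _) _.
  by rewrite size_polyXn ltn_exp2l ?q_gt1.
have pE : p = 'X^(q ^ d) + (\sum_(i < d) ecoef d i *: 'X^(q ^ i) - (cD d)%:P).
  by rewrite /p epd addrA; congr (_ - _); rewrite addrC.
have sp : size p = (q ^ d).+1 by rewrite pE size_polyDl ?size_polyXn.
have lp : lead_coef p = 1.
  rewrite /lead_coef sp pE coefD coefXn eqxx /= nth_default ?addr0 //.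
have srs : size rs = (q ^ d)%N.
  by rewrite -[RHS](card_npoly F d) cardE /rs size_map /monics size_map.
rewrite [RHS](@all_roots_prod_XsubC _ p rs) ?lp ?scale1r ?sp ?srs //.
  apply/allP => z /mapP[a /monicsP[am sa] ->]; rewrite rootE /p hornerD hornerN hornerC.
  suff -> : (epoly d).[ofA C a] = epol d (ofA C a) by rewrite epol_monic ?subrr.
  rewrite /epoly horner_sum; apply: eq_bigr => i _.
  by rewrite hornerZ hornerXn.
rewrite uniq_rootsE map_inj_in_uniq.
  by rewrite map_inj_uniq ?enum_uniq // => b b' /addrI /val_inj.
move=> a a' _ _ /eqP; rewrite -subr_eq0 -rmorphB ofA_eq0 subr_eq0 => /eqP //.
Qed.

Lemma natr_q : q%:R = 0 :> C.
Proof.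
have qn := pchar_nat_q (Cconst C) 1; rewrite expn1 in qn.
have pC : pdiv q \in [pchar C] by rewrite (pnatPpi qn) // pi_pdiv q_gt1.
by apply/eqP; rewrite -(dvdn_pcharf pC) pdiv_dvd.
Qed.

Lemma deriv_epoly d : (epoly d - (cD d)%:P)^`() = (ecoef d 0)%:P.
Proof.
rewrite derivB derivC subr0 /epoly raddf_sum big_ord_recl big1 /= => [|i _].
  by rewrite addr0 expn0 expr1 derivZ derivX alg_polyC.
rewrite derivZ derivXn /bump /= expnS -mulr_natr natrM.
by rewrite -(rmorph_nat (@polyC C) q) natr_q rmorph0 mul0r mulr0 scaler0.
Qed.

(** The expansion at 0 of 1 / (a - X). *)
Definition inv_powers (a : C) : fps C := fun n => (a ^+ n.+1)^-1.

Lemma inv_powers_mul a : a != 0 -> fps_poly ('X - a%:P) * inv_powers a = - 1.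
Proof.
move=> a0; rewrite rmorphB mulrBl; apply: fpsP => n.
rewrite fpsD !fpsN fps_polyX_mul fps_polyC_mul fps1 /inv_powers.
case: n => [|n] /=; first by rewrite sub0r expr1 divff.
by rewrite [a ^+ n.+2]exprS invfM mulrA divff // mul1r subrr oppr0.
Qed.

(* P' / P = sum 1 / (X - a), expanded at 0. *)
Lemma log_derivative (rs : seq C) : all (fun a => a != 0) rs ->
  fps_poly (\prod_(a <- rs) ('X - a%:P))^`() =
  - (fps_poly (\prod_(a <- rs) ('X - a%:P)) * \sum_(a <- rs) inv_powers a).
Proof.
elim: rs => [|a rs IHrs] /=; first by rewrite !big_nil -polyC1 derivC rmorph0 mulr0 oppr0.
case/andP=> a0 /IHrs IH; rewrite !big_cons derivM derivB derivX derivC subr0 mul1r.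
rewrite rmorphD !rmorphM /= IH mulrDr.
have := inv_powers_mul a0; move: (fps_poly ('X - _)) (inv_powers a) => x t xt.
move: (fps_poly _) (\sum_(_ <- _) _) => P S.
have -> : x * P * t = P * (x * t) by ring.
by rewrite xt; ring.
Qed.

Lemma fps_polyXn_mul k (f : fps C) n :
  (fps_poly 'X^k * f) n = if (k <= n)%N then f (n - k)%N else 0.
Proof.
elim: k n => [|k IHk] n; first by rewrite expr0 rmorph1 mul1r subn0.
by rewrite exprS rmorphM -mulrA fps_polyX_mul; case: n => // n; rewrite IHk.
Qed.

Definition power_sum (d n : nat) : C := \sum_(a <- monics d) (ofA C a ^+ n.+1)^-1.

(** The coefficient of X^n in P' = - P sum 1 / (a - X) for P = E_d - D_d, whose derivative is the
    constant [ecoef d 0]. *)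
Lemma power_sum_rec d n : cD d * power_sum d n = (n == 0%N)%:R * ecoef d 0 +
  \sum_(i < d.+1 | (q ^ i <= n)%N) ecoef d i * power_sum d (n - q ^ i).
Proof.
have nz : all (fun a => a != 0) [seq ofA C a | a <- monics d].
  apply/allP => z /mapP[a /monicsP[am _] ->]; rewrite ofA_eq0; exact: monic_neq0.
have SE k : (\sum_(a <- [seq ofA C a | a <- monics d]) inv_powers a) k = power_sum d k.
  by rewrite fps_sum big_map.
have := congr1 (fun f : fps C => f n) (log_derivative nz).
rewrite prod_monics deriv_epoly fpsN rmorphB mulrBl fpsD fpsN fps_polyC_mul SE.
have -> : fps_poly (ecoef d 0)%:P n = (n == 0%N)%:R * ecoef d 0.
  by rewrite /fps_poly /ps_of_poly coefC; case: (n == 0%N); rewrite ?mul1r ?mul0r.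
move=> ->; rewrite /epoly rmorph_sum mulr_suml fps_sum.
rewrite [X in _ = _ + X]big_mkcond (eq_bigr (fun i : 'I_d.+1 =>
  if (q ^ i <= n)%N then ecoef d i * power_sum d (n - q ^ i) else 0)); first by ring.
move=> i _; rewrite -mul_polyC rmorphM -mulrA fps_polyC_mul fps_polyXn_mul.
by rewrite SE; case: ifP; rewrite ?mulr0.
Qed.

(** The d-fold twist of G_i at t = theta, divided by D_i. *)
Definition AT_ratio (d i : nat) : C :=
  (\prod_(1 <= j < i.+1) (theta ^+ (q ^ i) - theta ^+ (q ^ (j + d)))) / cD i.

Lemma AT_ratio_gt d i : (d < i)%N -> AT_ratio d i = 0.
Proof.
move=> di; rewrite /AT_ratio (bigD1_seq (i - d)%N) ?iota_uniq //=.
  by rewrite subnK ?(ltnW di) // subrr !mul0r.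
by rewrite mem_index_iota subn_gt0 di ltnS leq_subr.
Qed.

(** The product L_d^(q^i) splits at k = d - i: the lower part cancels the denominator of
    [ecoef d i], and the upper part, with k = j + d - i, is the numerator of [AT_ratio d i]. *)
Lemma AT_ratio_le d i : (i <= d)%N -> AT_ratio d i * cD d = ecoef d i * cL d ^+ (q ^ i).
Proof.
move=> id; rewrite /AT_ratio /ecoef.
have -> : cL d ^+ (q ^ i) = cL (d - i) ^+ (q ^ i) *
    \prod_(1 <= j < i.+1) (theta ^+ (q ^ i) - theta ^+ (q ^ (j + d))).
  rewrite {1}/cL (big_cat_nat (n := (d - i).+1)) //= ?ltnS ?leq_subr // exprMn.
  congr (_ * _); rewrite -[(d - i).+1]add1n big_addn.
  rewrite (_ : d.+1 - (d - i) = i.+1)%N; last by rewrite subSn ?leq_subr // subKn.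
  by rewrite -prodrXl; apply: eq_bigr => j _; rewrite theta_subX -addnA subnK.
have := cD_neq0 i; have := expf_neq0 (q ^ i) (cL_neq0 (d - i)).
move: (\prod_(_ <- _) _) (cL _ ^+ _) (cD i) (cD d) => P l Y X l0 Y0.
by field; rewrite l0 Y0.
Qed.

Lemma power_sum_AT_rec d n : power_sum d n * cL d ^+ n.+1 = (n == 0%N)%:R +
  \sum_(i < n.+1 | (q ^ i <= n)%N)
    AT_ratio d i * (power_sum d (n - q ^ i) * cL d ^+ (n - q ^ i).+1).
Proof.
pose T i := if (q ^ i <= n)%N then
  AT_ratio d i * (power_sum d (n - q ^ i) * cL d ^+ (n - q ^ i).+1) else 0.
(* One recursion runs over i <= n and the other over i <= d. Both extend by zeros to a common range:
   q^i > n beyond n, and [AT_ratio d i] vanishes beyond d. *)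
have wide m : (m < n + d.+1)%N -> (forall i, (m < i)%N -> T i = 0) ->
    \sum_(i < m.+1) T i = \sum_(i < n + d.+1) T i.
  move=> mnd T0; rewrite -!(big_mkord xpredT T) [RHS](big_cat_nat (n := m.+1)) //=.
  rewrite [X in _ = _ + X](_ : _ = 0) ?addr0 // big_nat.
  by apply: big1 => i /andP[mi _]; exact: T0.
have T_le : \sum_(i < n.+1) T i = \sum_(i < d.+1) T i.
  rewrite !wide ?addnS ?ltnS ?leq_addr ?leq_addl // => i.
    by move=> di; rewrite /T AT_ratio_gt // mul0r if_same.
  by move=> ni; rewrite /T leqNgt (ltn_trans ni) //; exact/ltn_expl/q_gt1.
rewrite big_mkcond [X in _ = _ + X]T_le.
apply: (mulfI (cD_neq0 d)); rewrite mulrA power_sum_rec mulrDl mulrDr; congr (_ + _).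
  case: n {T wide T_le} => [|n]; last by rewrite !mul0r mulr0.
  rewrite /ecoef subn0 expn0 !expr1 mul1r /cD {2}/carlitzD big_ord0 rmorph1 mul1r.
  by rewrite divfK ?cL_neq0 // mulr1.
rewrite mulr_suml mulr_sumr big_mkcond; apply: eq_bigr => i _.
rewrite /T; case: ifP => [qn|_]; last by rewrite mulr0.
rewrite [cD d * (_ * _)]mulrA [cD d * AT_ratio _ _]mulrC AT_ratio_le -1?ltnS //.
have -> : n.+1 = (q ^ i + (n - q ^ i).+1)%N by rewrite addnS subnKC.
by rewrite exprD; ring.
Qed.

Definition ATev (d : nat) (p : {poly {poly F}}) : C :=
  (map_poly (frob d) (map_poly (ofA C) p)).[theta].

Lemma ATevM d p r : ATev d (p * r) = ATev d p * ATev d r.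
Proof. by rewrite /ATev !rmorphM hornerM. Qed.

Lemma ATevD d p r : ATev d (p + r) = ATev d p + ATev d r.
Proof. by rewrite /ATev !rmorphD hornerD. Qed.

Lemma ATev0 d : ATev d 0 = 0. Proof. by rewrite /ATev !rmorph0 horner0. Qed.

Lemma ATev1 d : ATev d 1 = 1. Proof. by rewrite /ATev !rmorph1 hornerC. Qed.

Lemma ATev_polyC d (a : {poly F}) : ATev d a^:P = ofA C a.
Proof.
rewrite /ATev [RHS]/ofA; congr (_.[_]); apply/polyP => i.
by rewrite !coef_map /= ofAC frob_const.
Qed.

Lemma ATev_AT_G d i : ATev d (AT_G F i) = AT_ratio d i * cD i.
Proof.
rewrite /AT_ratio divfK ?cD_neq0 // /AT_G.
rewrite (big_morph (ATev d) (ATevM d) (ATev1 d)); apply: eq_bigr => j _.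
rewrite /ATev !rmorphB !rmorphXn /= !map_polyX !map_polyC /= hornerD hornerN.
by rewrite !horner_exp hornerX !hornerC ofAX /frob -exprM -expnD addnC.
Qed.

(** The Anderson-Thakur interpolation formula. On evaluating [AT_rec], the factors B and D_i
    complete the Gamma factor of n - q^i to that of n by [carlitz_gamma_split], leaving
    [power_sum_AT_rec]. *)
Lemma AT_interpolation d n : ATev d (AT_H F n) =
  ofA C (carlitz_gamma F n.+1) * (power_sum d n * cL d ^+ n.+1).
Proof.
elim/ltn_ind: n => n IHn; rewrite AT_H_rec ATevD power_sum_AT_rec mulrDr.
congr (_ + _).
  case: n {IHn} => [|n]; last by rewrite ATev0 mulr0.
  by rewrite ATev1 (carlitz_gammaE F (leqnn 0)) big_geq // rmorph1 mulr1.
rewrite (big_morph (ATev d) (ATevD d) (ATev0 d)) mulr_sumr; apply: eq_bigr => i qn.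
have nq : (n - q ^ i < n)%N.
  by rewrite ltn_subrL expn_gt0 q_gt0 (leq_trans _ qn) // expn_gt0 q_gt0.
rewrite !ATevM ATev_AT_G ATev_polyC IHn // (carlitz_gamma_split qn) !rmorphM /=.
rewrite -/(cD i); ring.
Qed.

Lemma power_sum_npoly N d e : (d < N)%N ->
  \sum_(b : {poly_N F} | (val b \is monic) && (size (val b) == d.+1))
    (ofA C (val b) ^+ e.+1)^-1 = power_sum d e.
Proof.
move=> dN; rewrite /power_sum /monics big_map big_enum /=.
pose h (b : {poly_d F}) : {poly_N F} := npolyp N ('X^d + val b).
pose h' (b : {poly_N F}) : {poly_d F} := npolyp d (val b).
have hE b : val (h b) = 'X^d + val b.
  apply: npolypK; apply: leq_trans (size_polyD _ _) _; rewrite size_polyXn geq_max dN.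
  exact: leq_trans (size_npoly b) (ltnW dN).
rewrite (reindex_onto h h') => [|b /andP[bm /eqP sb]].
  apply: eq_big => [b|b _]; last by rewrite hE.
  have /monicsP[bm sb] : 'X^d + val b \in monics d by apply: map_f; rewrite mem_enum.
  rewrite inE hE bm sb eqxx /=; apply/eqP/val_inj/polyP => j.
  rewrite coef_npolyp hE coefD coefXn; case: ltnP => jd; first by rewrite ltn_eqF ?add0r.
  by rewrite nth_default // (leq_trans (size_npoly b)).
apply/val_inj; rewrite hE; apply/polyP => j; rewrite coefD coefXn coef_npolyp.
case: ltngtP => [jd|dj|->]; rewrite ?add0r ?addr0 //.
  by rewrite nth_default // sb.
by have /monicP := bm; rewrite /lead_coef sb.
Qed.

(** Tuples are grouped by their degree vectors: on monic polynomials the order of absolute values is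
    the order of degrees, and for fixed degrees the sum of products factors into power sums. *)
Lemma zeta_A_partial N (s : seq nat) : all (ltn 0%N) s ->
  \sum_(a : {ffun 'I_(size s) -> {poly_N F}} |
        [forall i : 'I_(size s), (a i : {poly F}) \is monic] &&
        [forall i : 'I_(size s), forall j : 'I_(size s),
           (i < j)%N ==> (cabs (ofA C (a j)) < cabs (ofA C (a i)))])
    \prod_(i < size s) (ofA C (a i) ^+ nth 0%N s i)^-1 =
  nsum 0 N [seq (fun i => power_sum i s'.-1) | s' <- s].
Proof.
move=> s0; rewrite -(@nsum_strict_ffun _ N (size s)) ?size_map //.
pose Q (i : {ffun 'I_(size s) -> 'I_N}) (k : 'I_(size s)) (b : {poly_N F}) :=
  (val b \is monic) && (size (val b) == (i k).+1).
pose G (k : 'I_(size s)) (b : {poly_N F}) : C := (ofA C (val b) ^+ nth 0%N s k)^-1.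
pose dec (i : {ffun 'I_(size s) -> 'I_N}) :=
  [forall a : 'I_(size s), forall b : 'I_(size s), (a < b)%N ==> (i b < i a)%N].
transitivity (\sum_(i | dec i) \sum_(a in family (Q i)) \prod_k G k (a k)); last first.
  apply: eq_bigr => i _; rewrite -bigA_distr_big_dep; apply: eq_bigr => k _.
  rewrite (nth_map 0%N) // -(power_sum_npoly _ (ltn_ord (i k))).
  by rewrite /G prednK //; apply: (all_nthP 0%N s0).
pose good (a : {ffun 'I_(size s) -> {poly_N F}}) :=
  [forall i : 'I_(size s), (a i : {poly F}) \is monic] &&
  [forall i : 'I_(size s), forall j : 'I_(size s),
     (i < j)%N ==> (cabs (ofA C (a j)) < cabs (ofA C (a i)))].
have lt_deg (a b : {poly F}) : a \is monic -> b \is monic ->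
    (cabs (ofA C b) < cabs (ofA C a)) = (size b < size a)%N.
  move=> am bm; rewrite !cabs_ofA ?monic_neq0 // ltr_eXn2l ?qR_gt1 //.
  have := monic_neq0 am; have := monic_neq0 bm; rewrite -!size_poly_gt0.
  by case: (size a) (size b) => [|m] [|m'].
rewrite (exchange_big_dep good) /=; last first.
  move=> i a /forallP dec_i /familyP fa; apply/andP; split.
    by apply/forallP => k; have /andP[] := fa k.
  apply/forallP => k; apply/forallP => l; apply/implyP => kl.
  have [/andP[km /eqP sk] /andP[lm /eqP sl]] := (fa k, fa l).
  rewrite lt_deg // sk sl ltnS; have /forallP/(_ l)/implyP := dec_i k; exact.
apply: eq_bigr => a /andP[/forallP am /forallP a_dec].
have pf k : ((size (val (a k))).-1 < N)%N.
  have : (0 < size (val (a k)))%N by rewrite size_poly_gt0 monic_neq0 // am.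
  by have := size_npoly (a k); rewrite /=; case: (size _).
(* After the exchange of sums each admissible tuple is counted once, at its own degree vector. *)
rewrite (big_pred1 [ffun k => Ordinal (pf k)]) // => i.
have szE k : (size (val (a k)) = ((size (val (a k))).-1).+1)%N.
  by rewrite prednK // size_poly_gt0 monic_neq0 // am.
apply/andP/eqP => [[_ /familyP fa]|->].
  apply/ffunP => k; rewrite ffunE; apply: val_inj => /=.
  by have /andP[_ /eqP->] := fa k.
split; last by apply/familyP => k; rewrite unfold_in /Q ffunE /= -szE eqxx am.
apply/forallP => k; apply/forallP => l; apply/implyP => kl; rewrite !ffunE /=.
have /forallP/(_ l)/implyP/(_ kl) := a_dec k.
by rewrite lt_deg ?am // (szE k) (szE l).
Qed.

End CarlitzModulePolynomials.

(** * The value of zeta^AT at theta *)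

Section SpecialValue.
Variables (R : realType) (F : finFieldType) (C : Cinfty R F).
Local Notation q := #|F|.
Local Notation theta := (theta C).

Lemma fpsM0 (f g : fps C) : (f * g) 0%N = f 0%N * g 0%N.
Proof. by rewrite fpsM big_ord1. Qed.

Lemma tay_poly0 (p : {poly C}) : tay (fps_poly p) 0%N = p.[theta].
Proof.
rewrite tay_poly -[LHS]horner_coef0 horner_comp hornerD hornerX hornerC add0r //.
Qed.

Lemma AT_term_inT s' i : in_Ttheta (AT_term C s' i).
Proof. by apply: inT_M; [exact: inT_poly | exact: iLL_inT]. Qed.

Lemma tay_AT_term s' i : (0 < s')%N -> tay (AT_term C s' i) 0%N =
  ofA C (carlitz_gamma F s') * power_sum C i s'.-1.
Proof.
move=> s0; rewrite /AT_term tayM; [|exact: inT_poly|exact: iLL_inT].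
rewrite fpsM0 tay_poly0 -/(ATev C i (AT_H F s'.-1)) AT_interpolation prednK //.
rewrite -!mulrA; congr (_ * _); rewrite -[RHS]mulr1; congr (_ * _).
have [h gT _] := ps_inv_LL C i s'.
have := congr1 (fun f : fps C => tay f 0%N) h.
rewrite tayM ?tay1 //; last exact: inT_poly.
rewrite fpsM0 tay_poly0 horner_exp /LL horner_prod => h0; apply: etrans h0.
congr (_ ^+ _ * _); by apply: eq_bigr => j _; rewrite hornerXsubC.
Qed.

Lemma tay_nsum_AT N (s : seq nat) :
  tay (nsum 0 N [seq AT_term C s' | s' <- s]) 0%N =
  nsum 0 N [seq (fun i => tay (AT_term C s' i) 0%N) | s' <- s].
Proof.
have sT M l : in_Ttheta (nsum 0 M [seq AT_term C s' | s' <- l]).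
  by apply: nsum_inT => k _ i; exact: AT_term_inT.
elim: s N => [|s' s IHs] N; first by rewrite tay1.
rewrite /= tay_sum => [|i _]; last exact: inT_M (AT_term_inT _ _) (sT _ _).
rewrite fps_sum; apply: eq_bigr => i _.
by rewrite tayM ?fpsM0 ?IHs //; exact: AT_term_inT.
Qed.

Lemma ps_eval_tay (f : fps C) : ps_eval f theta = tay f 0%N.
Proof.
rewrite /tay /taylor_at_theta; congr (ps_eval _ _); apply/funext => i.
by rewrite /hyperder addn0 bin0.
Qed.

Lemma zeta_AT_value (s : seq nat) : all (ltn 0%N) s ->
  ps_eval (zeta_AT C s) theta = ofA C (\prod_(i <- s) carlitz_gamma F i) * zeta_A C s.
Proof.
move=> s0; set G := ofA C _.
have G0 : G != 0.
  rewrite ofA_eq0 prodf_seq_neq0; apply/allP => s' s's; apply/implyP => _.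
  by rewrite -(prednK (allP s0 _ s's)) carlitz_gamma_neq0.
have := tay_continuous 0%N (zeta_AT_cvg C s0); rewrite -zeta_AT_triples // -ps_eval_tay.
have -> : (fun N => tay (nsum 0 N [seq AT_term C s' | s' <- s]) 0%N) =
    (fun N => G * nsum 0 N [seq (fun i => power_sum C i s'.-1) | s' <- s]).
  apply/funext => N; rewrite tay_nsum_AT /G rmorph_prod.
  rewrite -(nsum_scale 0 N s (fun s' => ofA C (carlitz_gamma F s'))
    (fun s' i => power_sum C i s'.-1)).
  congr nsum; apply/eq_in_map => s' s's; apply/funext => i.
  by rewrite tay_AT_term //; exact: (allP s0).
(* Convergence of the partial sums of [zeta_A] is inherited from zeta^AT after division by the
   nonzero G. *)
move=> /(cvgCZ G^-1) cvg; rewrite -[LHS](mulVKf G0); congr (_ * _); symmetry.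
apply: limC_eq; move: cvg; congr (cvgC _ _); apply/funext => N.
by rewrite mulKf // -zeta_A_partial.
Qed.

End SpecialValue.

(** * Assembly of the logarithmic vector *)

Section LogarithmicVector.
Variables (R : realType) (F : finFieldType) (C : Cinfty R F).
Local Notation theta := (theta C).

Lemma tm_Y_jet (n : seq nat) (w : seq C) : tm_Y n w =
  jet n (fun i => fps_poly ((-1) ^+ (size n - i.+1))%:P *
    tay (Li_star (rev (drop i n)) (rev (drop i w)))).
Proof. by apply/matrixP => a b; rewrite !mxE fps_polyC_mul. Qed.

Lemma vnth_jet (n : seq nat) (phi : nat -> fps C) i :
  (0 < size n)%N -> (i < bdim n 0)%N -> vnth (jet n phi) i = phi 0%N (bdim n 0 - i.+1)%N.
Proof.
move=> n0 ib; pose j : 'I_(tdim n) := tagnat.Rank (p_ := fun i : 'I_(size n) => bdim n i)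
  (Ordinal n0) (Ordinal ib).
have jE : j = i :> nat by rewrite /j tagnat.RankEsum big_pred0.
rewrite /vnth -{1}jE valK.
have := mxcolK (fun i : 'I_(size n) => \col_(a < bdim n i) phi i (bdim n i - a.+1)%N)
  (Ordinal n0).
by move=> /matrixP /(_ (Ordinal ib) 0); rewrite [LHS]mxE [RHS]mxE.
Qed.

Lemma drho_jet (n : seq nat) (w : seq C) (b : {poly F}) (phi : nat -> fps C) :
  drho n w b *m jet n phi =
  jet n (fun i => tay (fps_poly (map_poly (Cconst C) b)) * phi i).
Proof.
have iterE j : iter j (tw_mul (rho_t n w)) (@tw_one _ _ C (tdim n)) 0%N *m jet n phi =
    jet n (fun i => fps_poly ('X + theta%:P) ^+ j * phi i).
  elim: j => [|j IHj].
    by rewrite /= /tw_one /= mul1mx; apply: jet_ext => i r _ _; rewrite mul1r.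
  rewrite iterS /tw_mul big_ord1 twmx_id /= -mulmxA IHj tmA_jet.
  by apply: jet_ext => i r _ _; rewrite mulrA -exprS.
rewrite /drho /rho mulmx_suml; under eq_bigr do rewrite -scalemxAl iterE jetZ.
rewrite jet_sum; apply: jet_ext => i r _ _.
apply: (congr1 (fun f : fps C => f r)).
rewrite tay_poly comp_polyE size_map_poly rmorph_sum mulr_suml.
apply: eq_bigr => j _.
by rewrite coef_map -mul_polyC rmorphM rmorphXn mulrA.
Qed.

Variable s : seq nat.
Hypotheses (s_neq0 : s <> [::]) (s_gt0 : all (ltn 0%N) s).

Lemma G_Z_eq y : y \in triples F s -> G_Z C s y = G_Y C s y.
Proof.
move=> ys; have wt p := @weight_triple _ _ C s s_gt0 y p ys.
apply: tm_Z_eq => [||p].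
(* A zero exponent would turn the weight bound into (q - 1) delta + 1 <= 0, so the merged exponents
   are positive. *)
- rewrite all_rev.
  rewrite -(@unzip1_zip _ _ (triple_s s y) [seq ofA C a | a <- triple_u F s y]).
    rewrite all_map; apply/allP => p /wt[d _]; rewrite /= lt0n; apply: contraLR.
    by rewrite negbK => /eqP->; rewrite mul0n addn1.
  by rewrite size_triple_u.
- by rewrite !size_rev size_triple_u.
- by rewrite -rev_zip ?size_triple_u // mem_rev => /wt.
Qed.

Lemma vhat_G_Y y (i : 'I_(sumn s)) : y \in triples F s ->
  vhat (sumn s) (G_drho C s y *m G_Y C s y) i 0 =
  tay (fps_poly 'X^(sumn y.1) * ((-1) ^+ (size s + size y.2) *
     (Li_star (triple_s s y) [seq ofA C a | a <- triple_u F s y] : fps C)))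
    (sumn s - i.+1)%N.
Proof.
move=> ys; have [LiT _] := triple_Li_star_cvg C s_gt0 ys.
have /mem_triples[_ _ _ y2] := ys.
have r0 : (0 < size s)%N by case: (s) s_neq0.
have k0 : (0 < size y.2)%N by rewrite lt0n size_eq0; apply/eqP => y20; rewrite -y2 y20 in r0.
have sG : size (G_s s y) = size y.2 by rewrite size_rev size_map size_reshape.
have bG : bdim (G_s s y) 0 = sumn s.
  by rewrite /bdim drop0 sumn_rev -sumn_flatten reshapeKr // y2.
rewrite mxE /G_drho /G_Y tm_Y_jet drho_jet vnth_jet ?sG ?bG //.
rewrite !drop0 !revK.
apply: (congr1 (fun f : fps C => f (sumn s - i.+1)%N)).
have cT : in_Ttheta (fps_poly ((-1) ^+ (size y.2 - 1))%:P : fps C) by exact: inT_poly.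
rewrite -[X in _ * (X * _)]tayC -tayM // -tayM; [|exact: inT_poly|exact: inT_M].
congr tay; rewrite /triple_b !rmorphM !rmorph_sign /= !rmorphXn /= map_polyX.
have -> : (-1) ^+ (size s + size y.2) =
    (-1) ^+ (size s).-1 * (-1) ^+ (size y.2 - 1) :> fps C.
  rewrite -{1}(prednK r0) -{1}(prednK k0) addSn addnS !exprS mulrA mulN1r opprK mul1r.
  by rewrite exprD subn1.
move: ((-1) ^+ _) ((-1) ^+ _) (fps_poly _ ^+ _) => a b c; ring.
Qed.

End LogarithmicVector.

Theorem theorem6p2p1 (R : realType) (F : finFieldType) (C : Cinfty R F)
    (s : seq nat) (hr : s <> [::]) (hs : all (ltn 0%N) s)
    (s1 m : nat) (x : 'I_(s1 + m) -> seq nat * seq nat)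
    (hx : triple_enum F s x) :
  Z_s C s x =
    col_mx
      (\col_(i < sumn s) taylor_at_theta (sumn s - i.+1) (zeta_AT C s))
      (\mxcol_(l < m) vminus (sumn s)
         (G_drho C s (x (rshift s1 l)) *m G_Y C s (x (rshift s1 l))))
  /\ ps_eval (zeta_AT C s) (theta C) =
       ofA C (\prod_(i <- s) carlitz_gamma F i) * zeta_A C s.
Proof.
have xs l : x l \in triples F s.
  by case: hx => _ x_im _; apply/mem_triples/x_im; exists l.
split; last exact: zeta_AT_value.
congr col_mx; last by apply: eq_mxcol => l; rewrite G_Z_eq.
apply/matrixP => i j; rewrite (ord1 j) summxE [RHS]mxE -/(tay (zeta_AT C s) _).
under eq_bigr do rewrite G_Z_eq // vhat_G_Y //.
rewrite (sum_triple_enum (fun y => tay (fps_poly 'X^(sumn y.1) *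
  ((-1) ^+ (size s + size y.2) * (Li_star (triple_s s y)
     [seq ofA C a | a <- triple_u F s y] : fps C))) (sumn s - i.+1)%N) hx).
rewrite (zeta_AT_triples C hs) [in RHS]big_seq tay_sum => [|y ys]; last first.
  have [LiT _] := triple_Li_star_cvg C hs ys.
  apply: inT_M; first exact: inT_poly.
  by apply: inT_M => //; apply: inT_X; apply: inT_N; exact: inT_1.
by rewrite fps_sum -big_seq.
Qed.
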